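(* Let $N\ge2$, $1<p<2$, $0<a<b$ and $\Omega:=\{x\in\mathbb{R}^N:\ a<|x|<b\}$. Let $u\in C^1(\overline\Omega)$ be the unique weak solution of $$-\Delta_p u=1\ \text{ in }\Omega,\qquad u=0\ \text{ on }\partial\Omega .$$ Then $u>0$ in $\Omega$, $u$ is radially symmetric, and there is a unique $r_0\in(a,b)$ such that $$Z_u:=\{x\in\Omega: Du(x)=0\}=\{x:\ |x|=r_0\},\qquad \lim_{|x|\to r_0}\frac{|Du(x)|}{\big||x|-r_0\big|^{\frac{1}{p-1}}}=1 ,$$ while $|Du|$ is bounded away from $0$ outside any neighbourhood of $Z_u$. Consequently the critical set of $u$ is a smooth hypersurface, and, with $\theta:=\frac{2-p}{p-1}$ and $\rho=|Du|^{p-2}$, $$\rho\in L^1(\Omega)\iff p>\tfrac32 ,$$ $$\int_{B_r(x_0)}\rho\,dx\simeq r^{N-\theta}\quad\text{for }x_0\in Z_u\text{ and }B_r(x_0)\subset\Omega,\ \text{ when }p>\tfrac32 ,$$ whereas for $1<p\le\frac32$ one has $\int_{B_r(x_0)\cap\Omega}\rho\,dx=+\infty$ for every $x_0\in Z_u$ and every $r>0$.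
   Context: $\Delta_p u=\operatorname{div}(|Du|^{p-2}Du)$; weak solution means $\int_\Omega |Du|^{p-2}(Du,D\varphi)\,dx=\int_\Omega \varphi\,dx$ for all $\varphi\in C_c^\infty(\Omega)$. $B_r(x_0)$ is the open ball; $a(r)\simeq b(r)$ means that the ratio is bounded above and below by positive constants independent of $r$. *)

(* Defs.v *)
From HB Require Import structures.
From mathcomp Require Import all_boot all_order all_algebra.
From mathcomp Require Import all_classical all_reals all_analysis.

Set Implicit Arguments.
Unset Strict Implicit.
Unset Printing Implicit Defensive.

Import Order.TTheory GRing.Theory Num.Theory.
Import numFieldNormedType.Exports.

Local Open Scope classical_set_scope.
Local Open Scope ring_scope.

(* Borel sets of R^n, generated by the coordinate maps. *)
Section measurable_rV.
Variables (R : realType) (n : nat).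

Definition coord_rV (i : 'I_n) (v : 'rV[R]_n) : R := v ord0 i.

Let rV_set0 : g_sigma_preimage coord_rV set0.
Proof. exact: sigma_algebra0. Qed.

Let rV_setC A : g_sigma_preimage coord_rV A -> g_sigma_preimage coord_rV (~` A).
Proof. exact: sigma_algebraC. Qed.

Let rV_bigcup (F : _^nat) : (forall i, g_sigma_preimage coord_rV (F i)) ->
  g_sigma_preimage coord_rV (\bigcup_i (F i)).
Proof. exact: sigma_algebra_bigcup. Qed.

HB.instance Definition _ := @isMeasurable.Build default_measure_display
  'rV[R]_n (g_sigma_preimage coord_rV) rV_set0 rV_setC rV_bigcup.

End measurable_rV.

Lemma measurable_coord_rV (R : realType) n (i : 'I_n) :
  measurable_fun [set: 'rV[R]_n] (coord_rV i).
Proof.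
move=> _ A mA; rewrite setTI; apply: sub_sigma_algebra.
case: n i => [[] []//|m i].
rewrite -bigcup_mkord_ord; exists i; first exact: ltn_ord.
by exists A => //; rewrite inord_val setTI.
Qed.

Lemma measurable_fun_rVP (R : realType) n d (T : measurableType d)
    (f : T -> 'rV[R]_n) :
  (forall i, measurable_fun [set: T] (fun x => f x ord0 i)) ->
  measurable_fun [set: T] f.
Proof.
move=> mf _ A mA; rewrite setTI.
suff : g_sigma_preimage (fun i => coord_rV (R := R) i \o f) `<=` measurable.
  by apply; rewrite g_sigma_preimage_comp; exists A => //; rewrite setTI.
apply: smallest_sub; first exact: sigma_algebra_measurable.
case: n f mf {A mA} => [|m] f mf; first by rewrite big_ord0.
rewrite -bigcup_mkord_ord; apply: bigcup_sub => i Ii.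
by move=> B [C mC <-]; exact: mf.
Qed.

Section lebesgue_rV.
Variable R : realType.
Local Open Scope ereal_scope.

Definition cons_rV n (xv : R * 'rV[R]_n) : 'rV[R]_n.+1 :=
  row_mx (const_mx xv.1 : 'rV_1) xv.2.

Definition uncons_rV n (v : 'rV[R]_n.+1) : R * 'rV[R]_n :=
  (v ord0 ord0, \row_i v ord0 (lift ord0 i)).

Lemma cons_rV0 n xv : @cons_rV n xv ord0 ord0 = xv.1.
Proof.
have -> : @ord0 n = lshift n (ord0 : 'I_1) by exact: val_inj.
by rewrite /cons_rV (row_mxEl (const_mx xv.1 : 'rV_1)) mxE.
Qed.

Lemma cons_rVS n xv i : @cons_rV n xv ord0 (lift ord0 i) = xv.2 ord0 i.
Proof.
have -> : lift ord0 i = rshift 1 i by exact: val_inj.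
by rewrite /cons_rV (row_mxEr (const_mx xv.1 : 'rV_1)).
Qed.

Lemma cons_rVK n : cancel (@cons_rV n) (@uncons_rV n).
Proof.
move=> xv; rewrite [RHS]surjective_pairing /uncons_rV cons_rV0; congr pair.
by apply/rowP => i; rewrite mxE cons_rVS.
Qed.

Lemma measurable_cons_rV n : measurable_fun setT (@cons_rV n).
Proof.
apply: measurable_fun_rVP => i.
have [j ->|->] := unliftP ord0 i.
  rewrite (_ : (fun _ => _) = coord_rV j \o snd); last first.
    by apply/funext => xv; rewrite cons_rVS.
  by apply: measurableT_comp => //; exact: measurable_coord_rV.
under eq_fun do rewrite cons_rV0.
exact: measurable_fst.
Qed.

Lemma measurable_uncons_rV n : measurable_fun setT (@uncons_rV n).
Proof.
apply: measurable_fun_pair; first exact: (measurable_coord_rV ord0).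
apply: measurable_fun_rVP => i /=.
under eq_fun do rewrite mxE.
exact: (measurable_coord_rV (lift ord0 i)).
Qed.

Section cons_measure.
Variables (n : nat) (m : {sigma_finite_measure set 'rV[R]_n -> \bar R}).

Definition cons_measure : set 'rV[R]_n.+1 -> \bar R :=
  pushforward (@lebesgue_measure R \x m) (@cons_rV n).

Let cons_measure0 : cons_measure set0 = 0.
Proof. by rewrite /cons_measure /pushforward preimage_set0 measure0. Qed.

Let cons_measure_ge0 A : 0 <= cons_measure A.
Proof. by rewrite /cons_measure /pushforward; exact: measure_ge0. Qed.

Let cons_measure_sigma_additive : semi_sigma_additive cons_measure.
Proof.
move=> F mF tF mUF; rewrite /cons_measure /pushforward preimage_bigcup.
have mcF k : measurable (@cons_rV n @^-1` F k).
  by rewrite -[X in measurable X]setTI; exact: measurable_cons_rV.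
apply: measure_semi_sigma_additive => //.
- apply/trivIsetP => /= i j _ _ ij; rewrite -preimage_setI.
  by move/trivIsetP : tF => /(_ _ _ _ _ ij) ->//; rewrite preimage_set0.
- by apply: bigcup_measurable => k _; exact: mcF.
Qed.

HB.instance Definition _ := isMeasure.Build _ _ _ cons_measure
  cons_measure0 cons_measure_ge0 cons_measure_sigma_additive.

Let cons_measure_sigma_finite : sigma_finite setT cons_measure.
Proof.
have /sigma_finiteP[F [TF ndF Foo]] := sigma_finiteT (@lebesgue_measure R).
have /sigma_finiteP[G [TG ndG Goo]] := sigma_finiteT m.
exists (fun k => @uncons_rV n @^-1` (F k `*` G k)).
  rewrite -preimage_bigcup (_ : \bigcup_k _ = setT) ?preimage_setT//.
  rewrite -setXTT TF TG; apply/seteqP; split=> [[x y] [k _ [/= ? ?]]|].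
    by split; exists k.
  move=> [x y] [[k _ /= Fkx] [l _ /= Gly]]; exists (maxn k l) => //; split => /=.
    by move: x Fkx; exact/subsetPset/ndF/leq_maxl.
  by move: y Gly; exact/subsetPset/ndG/leq_maxr.
move=> k; have [mF Fk] := Foo k; have [mG Gk] := Goo k; split.
  by rewrite -[X in measurable X]setTI; apply: measurable_uncons_rV => //;
    exact: measurableX.
rewrite /cons_measure /pushforward -comp_preimage.
rewrite (_ : _ \o _ = id); last by apply/funext => xv; exact: cons_rVK.
by rewrite preimage_id product_measure1E// lte_mul_pinfty// ge0_fin_numE.
Qed.

HB.instance Definition _ := Measure_isSigmaFinite.Build _ _ _ cons_measure
  cons_measure_sigma_finite.

End cons_measure.

(* Lebesgue measure on R^n; cf. lebesgue_rV_box. *)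
Fixpoint lebesgue_rV (n : nat) : {sigma_finite_measure set 'rV[R]_n -> \bar R} :=
  match n with
  | 0 => \d_(0%R : 'rV[R]_0)
  | n'.+1 => cons_measure (lebesgue_rV n')
  end.

Lemma lebesgue_rV_box n (A : 'I_n -> set R) : (forall i, measurable (A i)) ->
  lebesgue_rV n [set v | forall i, A i (v ord0 i)] =
  \prod_(i < n) lebesgue_measure (A i).
Proof.
elim: n A => [|n IH] A mA /=.
  by rewrite big_ord0 diracE mem_set//= => -[].
have mbox : measurable [set v : 'rV[R]_n | forall i, A (lift ord0 i) (v ord0 i)].
  rewrite (_ : [set v | _] =
    \bigcap_(i in [set: 'I_n]) coord_rV i @^-1` A (lift ord0 i)); last first.
    by apply/seteqP; split => [v vA i _|v vA i]; [exact: vA|exact: (vA i I)].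
  apply: fin_bigcap_measurable => // i _.
  by rewrite -[X in measurable X]setTI; exact: measurable_coord_rV.
have mA0 := mA ord0.
rewrite big_ord_recl -IH// -product_measure1E// /cons_measure /pushforward.
congr (_ _); apply/seteqP; split => [xv /= xvA|xv /= [x0 vA] i].
  by split => [|i]; [rewrite -cons_rV0; exact: xvA|rewrite -cons_rVS; exact: xvA].
by have [j ->|->] := unliftP ord0 i; rewrite ?cons_rVS ?cons_rV0.
Qed.

End lebesgue_rV.

Section euclidean.
Variables (R : realType) (N : nat).
Implicit Types (v w x y : 'rV[R]_N) (f : 'rV[R]_N -> R) (U : set 'rV[R]_N).

Definition dotv v w : R := \sum_(i < N) v ord0 i * w ord0 i.

(* The library norm on 'rV[R]_N is the sup norm: it gives the topology and the
   differentials, but not the Euclidean length or Euclidean balls. *)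
Definition enorm v : R := Num.sqrt (dotv v v).

Definition eball x (r : R) : set 'rV[R]_N := [set y | enorm (y - x) < r].

Definition annulus (a b : R) : set 'rV[R]_N := [set x | a < enorm x < b].

Definition partial (i : 'I_N) f : 'rV[R]_N -> R :=
  fun x => 'D_(delta_mx ord0 i) f x.

Definition grad f x : 'rV[R]_N := \row_i partial i f x.

(* f is C^oo on the open set U: every iterated partial derivative of f is
   differentiable, hence continuous, on U. *)
Definition smooth_on U f : Prop :=
  forall s : seq 'I_N, {in U, forall x, differentiable (foldr partial f s) x}.

Definition test_function U (phi : 'rV[R]_N -> R) : Prop :=
  [/\ smooth_on setT phi, compact (closure [set x | phi x != 0])
    & closure [set x | phi x != 0] `<=` U].

(* u is in C^1(closure U): Du extends continuously from U to closure U. *)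
Definition C1_closure U f : Prop :=
  [/\ {within closure U, continuous f}, {in U, forall x, differentiable f x}
    & exists2 G : 'rV[R]_N -> 'rV[R]_N,
        {within closure U, continuous G} & {in U, grad f =1 G}].

(* At the zeros of Df the integrand is 0, as a `^ (p - 2) is finite at a = 0. *)
Definition weak_solution (p : R) U (u : 'rV[R]_N -> R) : Prop :=
  forall phi, test_function U phi ->
  (\int[lebesgue_rV R N]_(x in U)
      (enorm (grad u x) `^ (p - 2) * dotv (grad u x) (grad phi x))%:E =
   \int[lebesgue_rV R N]_(x in U) (phi x)%:E)%E.

Definition critical_set U f : set 'rV[R]_N := [set x | U x /\ grad f x = 0].

(* |Df|^(p-2), equal to +oo at the critical points since p < 2. *)
Definition weight (p : R) f x : \bar R :=
  if grad f x == 0 then +oo%E else (enorm (grad f x) `^ (p - 2))%:E.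

Definition radial_on U f : Prop :=
  exists g : R -> R, {in U, forall x, f x = g (enorm x)}.

Definition smooth_hypersurface (S : set 'rV[R]_N) : Prop :=
  forall x, S x -> exists (V : set 'rV[R]_N) (g : 'rV[R]_N -> R),
    [/\ open_nbhs x V, smooth_on V g, V `&` S = V `&` [set y | g y = 0]
      & {in V, forall y, grad g y != 0}].

End euclidean.

(* F(r) ~ G(r) for r in A: two-sided bounds with constants independent of r. *)
Definition comparable_on (R : realType) (A : set R) (F : R -> \bar R)
    (G : R -> R) : Prop :=
  exists c C : R, [/\ 0 < c, 0 < C
    & forall r, A r -> ((c * G r)%:E <= F r <= (C * G r)%:E)%E].

(* Main.v *)
From HB Require Import structures.
Require Import Defs.
From mathcomp Require Import all_boot all_order all_algebra.
From mathcomp Require Import all_classical all_reals all_analysis.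
From mathcomp Require Import measurable_realfun.
From mathcomp Require Import ring lra.
Import Order.TTheory GRing.Theory Num.Theory.
Import numFieldNormedType.Exports.
Local Open Scope classical_set_scope.
Local Open Scope ring_scope.

(** A radial solution is found by integrating once: a radial field of divergence
    -1 that vanishes at distance r0 has radial component
      flux r0 s = (r0^N - s^N) / (N s^(N-1)),
    and it is |w'|^(p-2) w' exactly when w' = flux |flux|^theta, because
    1 + theta = 1/(p-1).  The primitive of this slope that vanishes at a also
    vanishes at b for a suitable r0 in ]a, b[, by the intermediate value theorem
    ([exists_crit]): the slope is negative if r0 = a and positive if r0 = b.

    The solution u is this radial function w ([unique_radial]).  That w is a weak
    solution is the divergence theorem ([field_weak]), which for compactly
    supported functions comes down to integrating each partial derivative along
    its own coordinate lines ([integral_partial]).  Subtracting the two weak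
    equations and testing with v = u - w would give that the integral of
    (|Du|^(p-2) Du - |Dw|^(p-2) Dw, Du - Dw) is 0, and strict monotonicity of
    xi |-> |xi|^(p-2) xi ([pflux_monotone]) would force Dv = 0.  But v is neither
    compactly supported nor smooth.  Compact support is obtained by replacing v
    by a function of v that vanishes where |v| <= e: as v is 0 on the boundary and
    has a bounded gradient, |v| is at most a multiple of the distance to the
    boundary along rays ([ray_bound]).  The result is only C^1; convolution with a
    smooth kernel approximates it, with its gradient, uniformly by test functions
    ([mollify]), so that the weak equation extends to it ([weak_zero_C1]).  Letting
    e tend to 0 gives Dv = 0 wherever v <> 0, hence v = 0 along every ray
    ([comparison_eq0]).

    All the claims then follow from |Du| = |flux r0 |x||^(1/(p-1)).  The quotient
    flux r0 s / (r0 - s) is continuous, bounded away from 0 and equal to 1 at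
    s = r0 ([mean_flux_bounds]), which gives the critical sphere, the asymptotics
    of |Du| and the lower bound away from the sphere; the sphere is a hypersurface
    as the zero set of |x|^2 - r0^2.

    For the weight, |Du|^(p-2) = |flux|^-theta is comparable to
    | |x|^2 - r0^2 |^-theta.  On a line in the direction of x_i = t the difference
    |x|^2 - r0^2 is t^2 - tau with tau constant, and its roots are simple away
    from t = 0; by Tonelli its integral near a point of the sphere behaves like
    that of |t|^-theta over an interval of length r, of order r^(1-theta) if
    theta < 1 and infinite if theta >= 1, times r^(N-1) for the remaining
    coordinates ([sphere_integral_le], [sphere_integral_oo]).  The lower bound for
    theta < 1 is immediate, since the weight is at least a multiple of r^-theta on
    a ball of radius r centred on the sphere.  Finally theta < 1 means p > 3/2. *)

Set Implicit Arguments.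
Unset Strict Implicit.
Unset Printing Implicit Defensive.

(** * Lebesgue measure on row vectors *)

Section boxes.
Variable R : realType.

Definition box n (A : 'I_n -> set R) : set 'rV[R]_n :=
  [set v | forall i, A i (v ord0 i)].

Lemma measurable_box n (A : 'I_n -> set R) :
  (forall i, measurable (A i)) -> measurable (box A).
Proof.
move=> mA.
rewrite (_ : box A = \bigcap_(i in [set: 'I_n]) (@coord_rV R n i @^-1` A i)).
  by apply: fin_bigcap_measurable => // i _; rewrite -[X in measurable X]setTI;
    exact: measurable_coord_rV.
by apply/seteqP; split => [v vA i _|v vA i]; [exact: vA|exact: (vA i I)].
Qed.

Lemma ball_rVP n (x y : 'rV[R]_n) (e : R) : 0 < e ->
  ball x e y <-> forall i, `|x ord0 i - y ord0 i| < e.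
Proof.
move=> e0; split=> [[_ xy] i|xy]; first exact: xy.
by split => // i j; rewrite ord1; exact: xy.
Qed.

(** Boxes with rational endpoints are countably many and form a base of the
    topology. *)
Lemma open_measurable_rV n (U : set 'rV[R]_n) : open U -> measurable U.
Proof.
move=> oU.
pose B (q : {ffun 'I_n -> rat * rat}) :=
  box (fun i => `](ratr (q i).1 : R), ratr (q i).2[%classic).
have mB q : measurable (B q) by apply: measurable_box => i; exact: measurable_itv.
pose C q := if `[< B q `<=` U >] then B q else set0.
rewrite (_ : U = \bigcup_q C q).
  apply: countable_bigcupT_measurable; first exact: countableP.
  by move=> q; rewrite /C; case: ifP.
apply/seteqP; split; last first.
  by move=> x [q _]; rewrite /C; case: asboolP => // BU Bx; exact: BU.
move=> x Ux.
have /nbhs_ballP[e /= e0 eU] := open_nbhs_nbhs (conj oU Ux).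
have H i : exists q : rat * rat, [/\ x ord0 i - e < ratr q.1, ratr q.1 < x ord0 i,
    x ord0 i < ratr q.2 & ratr q.2 < x ord0 i + e].
  have [|q1] := @rat_in_itvoo R (x ord0 i - e) (x ord0 i); first by rewrite gtrBl.
  have [|q2] := @rat_in_itvoo R (x ord0 i) (x ord0 i + e); first by rewrite ltrDl.
  by rewrite !in_itv/= => /andP[? ?] /andP[? ?]; exists (q1, q2).
have [q /= Hq] := choice H.
exists [ffun i => q i] => //; rewrite /C; case: asboolP => [_|].
  by move=> i; rewrite ffunE /= in_itv/=; have [_ -> ->] := Hq i.
case=> y By; apply: eU; apply/ball_rVP => // i.
have := By i; rewrite ffunE /= in_itv/= => /andP[y1 y2].
have [a1 a2 a3 a4] := Hq i; rewrite ltr_norml; apply/andP; split; lra.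
Qed.

Lemma continuous_measurable_rV n (U : set 'rV[R]_n) (f : 'rV[R]_n -> R) :
  open U -> {in U, continuous f} -> measurable_fun U f.
Proof.
move=> oU; rewrite -(continuous_open_subspace f oU) => /continuousP cf mU.
apply: (measurability _ (RGenOpens.measurableE R)) => //.
move=> _ [_ [a [b ->] <-]].
have /open_subspaceP[V oV VE] : open (f @^-1` `]a, b[ : set (subspace U)).
  exact/cf/interval_open.
by rewrite setIC -VE; apply: measurableI; exact: open_measurable_rV.
Qed.

Lemma norm_coord_le n (v : 'rV[R]_n) i : `|v ord0 i| <= `|v|.
Proof.
rewrite [leRHS]/Num.Def.normr /= mx_normrE; apply/bigmax_geP; right => /=.
by exists (ord0, i).
Qed.

Lemma norm_rV_le n (v : 'rV[R]_n) (c : R) : 0 <= c ->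
  (forall i, `|v ord0 i| <= c) -> `|v| <= c.
Proof.
move=> c0 vc; rewrite [leLHS]/Num.Def.normr /= mx_normrE; apply/bigmax_leP; split => //.
by case=> i j _ /=; rewrite ord1.
Qed.

Lemma lebesgue_rV_boxE n (A : 'I_n -> set R) (l : 'I_n -> R) :
  (forall i, measurable (A i)) -> (forall i, lebesgue_measure (A i) = (l i)%:E) ->
  lebesgue_rV R n (box A) = (\prod_(i < n) l i)%:E.
Proof.
move=> mA Al; rewrite lebesgue_rV_box//.
by under eq_bigr do rewrite Al; rewrite prodEFin.
Qed.

(** Boxes are stable under intersection, generate the Borel sets and contain
    an exhausting sequence of sets of finite measure. *)
Lemma lebesgue_rV_unique n (m : {measure set 'rV[R]_n -> \bar R}) :
  (forall A : 'I_n -> set R, (forall i, measurable (A i)) ->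
    m (box A) = \prod_(i < n) lebesgue_measure (A i))%E ->
  forall X, measurable X -> lebesgue_rV R n X = m X.
Proof.
move=> mE X mX.
pose G := [set box A | A in [set A : 'I_n -> set R | forall i, measurable (A i)]].
pose g (k : nat) := box (fun _ : 'I_n => `]- (k%:R : R), k%:R[%classic).
apply: (@measure_unique _ R _ G g) => //.
- apply/seteqP; split.
  + apply: smallest_sub; first exact: smallest_sigma_algebra.
    case: n m mE X mX @G @g => [|n] m mE X mX G g; first by rewrite big_ord0.
    rewrite -bigcup_mkord_ord; apply: bigcup_sub => i Ii _ [B mB <-].
    apply: sub_sigma_algebra; rewrite setTI.
    exists (fun j => if j == inord i then B else setT).
      by move=> j /=; case: ifP.
    apply/seteqP; split => [v /(_ (inord i))|v /= Bv j]; first by rewrite eqxx.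
    by case: ifPn => // /eqP ->.
  + apply: smallest_sub; first exact: sigma_algebra_measurable.
    by move=> _ [A mA <-]; exact: measurable_box.
- move=> _ _ [A mA <-] [B mB <-]; exists (fun i => A i `&` B i).
    by move=> i; exact: measurableI.
  apply/seteqP; split => [v vAB|v [vA vB] i]; last by split; [exact: vA|exact: vB].
  by split => i; have [] := vAB i.
- by move=> k; exists (fun=> `]- (k%:R : R), k%:R[%classic).
- rewrite -subTset => v _.
  exists (Num.truncn `|v|).+1 => // i; rewrite /= in_itv/= -ltr_norml.
  by rewrite (le_lt_trans (norm_coord_le v i))// truncnS_gt.
- by move=> _ [A mA <-]; exact: etrans (lebesgue_rV_box mA) (esym (mE _ mA)).
- move=> k; rewrite [ltLHS](_ : _ = (\prod_(i < n) (k%:R + k%:R : R))%:E) ?ltry//.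
  apply: (@lebesgue_rV_boxE _ (fun=> `]- (k%:R : R), k%:R[%classic)) => // i.
  rewrite lebesgue_measure_itv/= lte_fin; case: ifPn; first by rewrite -EFinD opprK.
  by rewrite -leNgt => k0; congr EFin; have := ler0n R k; lra.
Qed.

Lemma measurable_row_rV n d (T : measurableType d) (f : 'I_n -> T -> R) :
  (forall i, measurable_fun [set: T] (f i)) ->
  measurable_fun [set: T] (fun x => \row_i f i x).
Proof.
move=> mf; apply: measurable_fun_rVP => i.
by under eq_fun do rewrite mxE; exact: mf.
Qed.

Definition insert_rV n (i : 'I_n.+1) (ty : R * 'rV[R]_n) : 'rV[R]_n.+1 :=
  \row_j oapp (fun k => ty.2 ord0 k) ty.1 (unlift i j).

Lemma insert_rV_same n (i : 'I_n.+1) ty : insert_rV i ty ord0 i = ty.1.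
Proof. by rewrite mxE unlift_none. Qed.

Lemma insert_rV_lift n (i : 'I_n.+1) ty j :
  insert_rV i ty ord0 (lift i j) = ty.2 ord0 j.
Proof. by rewrite mxE liftK. Qed.

Lemma measurable_insert_rV n (i : 'I_n.+1) :
  measurable_fun [set: R * 'rV[R]_n] (insert_rV i).
Proof.
apply: measurable_row_rV => j; case: unliftP => [k|] _ /=; last exact: measurable_fst.
exact: (measurableT_comp (measurable_coord_rV k) measurable_snd).
Qed.

(** The measure is built by splitting off the first coordinate. Its values on
    boxes treat all coordinates alike, so any coordinate can be split off
    instead; this is how integrals along an arbitrary coordinate direction are
    computed below. *)
Lemma lebesgue_rV_insert n (i : 'I_n.+1) X : measurable X ->
  lebesgue_rV R n.+1 X =
  pushforward (@lebesgue_measure R \x lebesgue_rV R n)%E (insert_rV i) X.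
Proof.
move: X; apply: lebesgue_rV_unique; first exact: measurable_insert_rV.
move=> mi A mA.
change ((@lebesgue_measure R \x lebesgue_rV R n)%E (insert_rV i @^-1` box A) =
  (\prod_(j < n.+1) lebesgue_measure (A j))%E).
rewrite (_ : _ @^-1` _ = A i `*` box (fun j => A (lift i j))).
  rewrite product_measure1E; [|exact: mA|by apply: measurable_box].
  by rewrite (bigD1_ord i)//= lebesgue_rV_box.
apply/seteqP; split => [[t y] /= tyA|[t y] [/= tA yA] j].
  split => /= [|j]; first by have := tyA i; rewrite insert_rV_same.
  by have := tyA (lift i j); rewrite insert_rV_lift.
case: (unliftP i j) => [k ->|->]; last by rewrite insert_rV_same.
by rewrite insert_rV_lift; exact: yA.
Qed.

Local Open Scope ereal_scope.

Let integral_insertE n (i : 'I_n.+1) (f : 'rV[R]_n.+1 -> \bar R) :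
  \int[lebesgue_rV R n.+1]_x f x =
  \int[pushforward (@lebesgue_measure R \x lebesgue_rV R n) (insert_rV i)]_x f x.
Proof.
apply: eq_measure_integral; first exact: measurable_insert_rV.
by move=> mi A mA _; exact: lebesgue_rV_insert.
Qed.

Lemma ge0_integral_rV_insert n (i : 'I_n.+1) (f : 'rV[R]_n.+1 -> \bar R) :
  measurable_fun setT f -> (forall x, 0 <= f x) ->
  \int[lebesgue_rV R n.+1]_x f x =
  \int[lebesgue_rV R n]_y \int[lebesgue_measure]_t f (insert_rV i (t, y)).
Proof.
move=> mf f0.
rewrite (integral_insertE i).
rewrite ge0_integral_pushforward//; last exact: measurable_insert_rV.
rewrite preimage_setT.
apply: (@fubini_tonelli2 _ _ _ _ _ (@lebesgue_measure R) (lebesgue_rV R n)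
  (f \o insert_rV i)) => //.
  exact: (measurableT_comp mf (measurable_insert_rV i)).
by move=> ty; exact: f0.
Qed.

Lemma integrable_rV_insert n (i : 'I_n.+1) (f : 'rV[R]_n.+1 -> \bar R) :
  (lebesgue_rV R n.+1).-integrable setT f ->
  \int[lebesgue_rV R n.+1]_x f x =
  \int[lebesgue_rV R n]_y \int[lebesgue_measure]_t f (insert_rV i (t, y)).
Proof.
move=> /[dup] /integrableP[mf intf] fi.
have mi := @measurable_insert_rV n i.
have fi' : (@lebesgue_measure R \x lebesgue_rV R n).-integrable setT (f \o insert_rV i).
  apply/integrableP; split; first exact: measurableT_comp.
  rewrite (le_lt_trans _ intf)//.
  rewrite (integral_insertE i).
  rewrite ge0_integral_pushforward//; exact: measurableT_comp.
rewrite (integral_insertE i).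
rewrite integral_pushforward// preimage_setT.
apply/esym.
exact: (@integral21_prod_meas1 _ _ _ _ _ (@lebesgue_measure R) (lebesgue_rV R n)
  (f \o insert_rV i)).
Qed.

Lemma measurable_subr (t : R) : measurable_fun [set: R] (fun s : R => t - s : measurableTypeR R)%R.
Proof. exact: measurable_funB. Qed.

Lemma lebesgue_measure_reflect (t : R) X : measurable X ->
  lebesgue_measure X = pushforward lebesgue_measure (fun s => t - s : measurableTypeR R)%R X.
Proof.
move: X; pose m := pushforward lebesgue_measure (fun s => t - s : measurableTypeR R)%R.
apply: (@lebesgue_measure_unique R m); first exact: measurable_subr.
move=> mm X [[a b] _ <-]; change (lebesgue_measure (`]a, b]) =
  pushforward lebesgue_measure (fun s => t - s : measurableTypeR R)%R `]a, b]).
rewrite (_ : pushforward _ _ _ = lebesgue_measure `[(t - b)%R, (t - a)%R[%classic).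
  rewrite !lebesgue_measure_itv/= !lte_fin ltrD2l ltrN2; case: ifP => // _.
  by rewrite -!EFinD; congr EFin; ring.
congr (lebesgue_measure _); apply/seteqP; split => s /=; rewrite !in_itv/=.
  by move=> /andP[? ?]; apply/andP; split; lra.
by move=> /andP[? ?]; apply/andP; split; lra.
Qed.

Lemma ge0_integral_reflect (t : R) (D : set R) (f : R -> \bar R) :
  measurable D -> measurable_fun D f -> (forall y, D y -> 0 <= f y) ->
  \int[lebesgue_measure]_(y in D) f y =
  \int[lebesgue_measure]_(y in (fun s => t - s)%R @^-1` D) f (t - y)%R.
Proof.
move=> mD mf f0.
rewrite [LHS](_ : _ = \int[pushforward lebesgue_measure
    (fun s => t - s : measurableTypeR R)%R]_(x in D) f x); last first.
  by apply: eq_measure_integral => [|mm A mA _];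
    [exact: measurable_subr|exact: lebesgue_measure_reflect].
rewrite ge0_integral_pushforward//; first exact: measurable_subr.
by move=> y /set_mem; exact: f0.
Qed.

Lemma measurable_reflect n (x : 'rV[R]_n) :
  measurable_fun setT (fun y : 'rV[R]_n => x - y)%R.
Proof.
apply: measurable_fun_rVP => i; under eq_fun do rewrite !mxE.
by apply: measurable_funB => //; exact: measurable_coord_rV.
Qed.

Lemma lebesgue_rV_reflect n (x : 'rV[R]_n) X : measurable X ->
  lebesgue_rV R n X = pushforward (lebesgue_rV R n) (fun y => x - y)%R X.
Proof.
have mxy := measurable_reflect x.
move: X; apply: lebesgue_rV_unique => A mA.
change (lebesgue_rV R n ((fun y => x - y)%R @^-1` box A) =
  \prod_(j < n) lebesgue_measure (A j)).
rewrite (_ : _ @^-1` _ =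
    box (fun i => (fun s => x ord0 i - s)%R @^-1` A i)); last first.
  by apply/seteqP; split => y /= yA i; have := yA i; rewrite !mxE.
rewrite lebesgue_rV_box/=; last first.
  move=> i; rewrite -[X in measurable X]setTI.
  exact: (@measurable_subr (x ord0 i) measurableT _ (mA i)).
by apply: eq_bigr => i _; apply/esym; exact: (@lebesgue_measure_reflect (x ord0 i) _ (mA i)).
Qed.

Lemma ge0_integral_rV_reflect n (x : 'rV[R]_n) (f : 'rV[R]_n -> \bar R) :
  measurable_fun setT f -> (forall y, 0 <= f y) ->
  \int[lebesgue_rV R n]_y f (x - y)%R = \int[lebesgue_rV R n]_y f y.
Proof.
move=> mf f0; apply/esym.
have mxy := measurable_reflect x.
rewrite [LHS](_ : _ =
  \int[pushforward (lebesgue_rV R n) (fun y => x - y)%R]_x f x); last first.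
  by apply: eq_measure_integral => A mA _; exact: lebesgue_rV_reflect.
by rewrite ge0_integral_pushforward// preimage_setT.
Qed.
End boxes.

(** * Cubes and the integral of a partial derivative *)

Section ibp.
Variable R : realType.

Definition cube_at n (x : 'rV[R]_n) (r : R) : set 'rV[R]_n :=
  box (fun i => `[x ord0 i - r, x ord0 i + r]%classic).

Lemma cube_atP n (x : 'rV[R]_n) r y : 0 <= r -> cube_at x r y <-> `|x - y| <= r.
Proof.
move=> r0; split=> [H|H i].
  apply: norm_rV_le => // i; rewrite !mxE.
  by have := H i; rewrite /= in_itv/= => /andP[? ?]; rewrite ler_norml; apply/andP; split; lra.
have := le_trans (norm_coord_le (x - y) i) H.
by rewrite !mxE ler_norml /= in_itv/= => /andP[? ?]; apply/andP; split; lra.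
Qed.

Lemma measurable_cube_at n (x : 'rV[R]_n) r : measurable (cube_at x r).
Proof. by apply: measurable_box => i; exact: measurable_itv. Qed.

Lemma lebesgue_cube_at n (x : 'rV[R]_n) r : 0 <= r -> lebesgue_rV R n (cube_at x r) = ((2 * r) ^+ n)%:E.
Proof.
move=> r0; rewrite (@lebesgue_rV_boxE _ _ _ (fun=> 2 * r)).
- by rewrite prodr_const card_ord.
- by move=> i; exact: measurable_itv.
- move=> i; rewrite lebesgue_measure_itv/= lte_fin; case: ifPn => [_|].
    by rewrite -EFinD; congr EFin; ring.
  by rewrite -leNgt => H; congr EFin; lra.
Qed.

Definition cube n (M : R) : set 'rV[R]_n := cube_at 0 M.

Lemma cubeP n (M : R) (x : 'rV[R]_n) : cube M x <-> forall i, `|x ord0 i| <= M.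
Proof.
split=> xM i; have := xM i; rewrite /= in_itv/= mxE sub0r add0r -ler_norml//.
Qed.

Lemma norm_le_cube n (M : R) (x : 'rV[R]_n) : `|x| <= M -> cube M x.
Proof. by move=> xM; apply/cubeP => i; rewrite (le_trans (norm_coord_le x i)). Qed.

Lemma measurable_cube n (M : R) : measurable (@cube n M).
Proof. exact: measurable_cube_at. Qed.

Lemma lebesgue_cube_lty n (M : R) : (lebesgue_rV R n (cube M) < +oo)%E.
Proof.
apply: (@le_lt_trans _ _ (lebesgue_rV R n (cube_at 0 `|M|))); last first.
  by rewrite lebesgue_cube_at// ltry.
apply: le_measure; rewrite ?inE; try exact: measurable_cube_at.
move=> x xM i; have := xM i; rewrite /= !in_itv/= mxE !sub0r !add0r -!ler_norml.
by move=> h; rewrite (le_trans h)// ler_norm.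
Qed.

Lemma bounded_integrable_rV n (D : set 'rV[R]_n) (M C : R) (f : 'rV[R]_n -> R) :
  measurable D -> D `<=` cube M -> measurable_fun D f ->
  (forall x, D x -> `|f x| <= C) ->
  (lebesgue_rV R n).-integrable D (EFin \o f).
Proof.
move=> mD DM mf fC; apply: measurable_bounded_integrable => //.
  apply: le_lt_trans (lebesgue_cube_lty n M); apply: le_measure; rewrite ?inE//.
  exact: measurable_cube.
by exists C; split => // [|c Cc x /fC fx]; [exact: num_real|exact: le_trans fx (ltW Cc)].
Qed.

Lemma bounded_integrable_rVT n (M C : R) (f : 'rV[R]_n -> R) :
  measurable_fun setT f -> (forall x, `|f x| <= C) ->
  (forall x, M < `|x| -> f x = 0) ->
  (lebesgue_rV R n).-integrable setT (EFin \o f).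
Proof.
move=> mf fC f0.
have := @bounded_integrable_rV n (cube M) M C f (@measurable_cube n M) (fun _ => id)
  (measurable_funTS mf) (fun x _ => fC x).
move/(integrable_mkcond _ (@measurable_cube n M)).1.
apply: eq_integrable => // x _ /=; rewrite /patch; case: ifPn => //.
rewrite notin_setE => Mx; rewrite f0//= ltNge; apply/negP => /norm_le_cube.
exact: Mx.
Qed.

Lemma norm_lt_near (V : normedModType R) (x : V) (M : R) : M < `|x| ->
  \forall y \near x, M < `|y|.
Proof. by move=> Mx; exact: (cvgr_gt _ (@norm_continuous _ _ x) _ Mx). Qed.

(** The fundamental theorem of calculus on an interval whose ends lie outside
    the support of h. *)
Lemma integral_derive_compact (h h' : R -> R) (M : R) :
  (forall t : R, is_derive t 1 h (h' t)) -> continuous h' ->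
  (forall t, M < `|t| -> h t = 0) -> (\int[lebesgue_measure]_t (h' t)%:E = 0)%E.
Proof.
move=> dh ch h0.
pose K : R := `|M| + 1.
have MK : M < K by rewrite /K (le_lt_trans (ler_norm _))// ltrDl.
have K0 : 0 < K by rewrite /K ltr_wpDl.
have h'0 t : M < `|t| -> h' t = 0.
  move=> Mt; have [_ <-] := dh t.
  rewrite -[RHS](@derive_cst _ _ _ (0 : R) t 1); apply: near_eq_derive.
  by apply: filterS (norm_lt_near Mt) => s /h0.
have ch1 : continuous h.
  move=> t; apply/differentiable_continuous/derivable1_diffP.
  by case: (dh t).
rewrite -[LHS](_ : (\int[lebesgue_measure]_(t in `[(- K)%R, K]) (h' t)%:E)%E = _).
  rewrite (@continuous_FTC2 _ h' h) ?gtrN//.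
  - by rewrite !h0 ?subee// ?normrN gtr0_norm.
  - exact: continuous_subspaceT.
  - split=> [t _|  |]; first by case: (dh t).
      by apply: cvg_at_right_filter; exact: ch1.
    by apply: cvg_at_left_filter; exact: ch1.
  - by move=> t _; rewrite derive1E; have [_ ->] := dh t.
rewrite integral_mkcond; apply: eq_integral => t _; rewrite /patch; case: ifPn => //.
rewrite notin_setE /= in_itv/= -ler_norml => /negP; rewrite -ltNge => Kt.
by rewrite h'0// (lt_trans MK).
Qed.

Lemma insert_rV_shift n (i : 'I_n.+1) (t s : R) (y : 'rV[R]_n) :
  insert_rV i (t + s, y) = t *: delta_mx ord0 i + insert_rV i (s, y).
Proof.
apply/rowP => j; rewrite !mxE eqxx/=; case: unliftP => [k ->|->] /=.
  by rewrite eq_sym (negbTE (neq_lift _ _)) mulr0 add0r.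
by rewrite eqxx mulr1.
Qed.

Lemma is_derive_insert n (i : 'I_n.+1) (g : 'rV[R]_n.+1 -> R) (y : 'rV[R]_n) (t : R) :
  derivable g (insert_rV i (t, y)) (delta_mx ord0 i) ->
  is_derive t 1 (fun s => g (insert_rV i (s, y))) (partial i g (insert_rV i (t, y))).
Proof.
move=> dg.
have E : (fun h : R => h^-1 *: (((fun s => g (insert_rV i (s, y))) \o shift t) (h *: 1)
   - g (insert_rV i (t, y)))) = (fun h : R => h^-1 *: ((g \o shift (insert_rV i (t, y)))
   (h *: delta_mx ord0 i) - g (insert_rV i (t, y)))).
  apply/funext => h /=; congr (_ *: (g _ - _)).
  by rewrite -insert_rV_shift [h *: 1]mulr1.
by split; rewrite /derivable/partial/derive E.
Qed.

Lemma continuous_insert n (i : 'I_n.+1) (y : 'rV[R]_n) :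
  continuous (fun t => insert_rV i (t, y)).
Proof.
move=> t; apply/cvgrPdist_lt => e e0; near=> s.
rewrite -[t](subrK s) insert_rV_shift addrK normrZ.
have d1 : `|delta_mx ord0 i : 'rV[R]_n.+1| <= 1.
  apply: norm_rV_le => // j; rewrite mxE eqxx/=.
  by case: eqP; rewrite ?normr1 ?normr0.
apply: (@le_lt_trans _ _ `|t - s|); first by rewrite ler_piMr.
by near: s; apply: cvgr_dist_lt.
Unshelve. all: by end_near. Qed.

Lemma partial_eq0 n (i : 'I_n) (g : 'rV[R]_n -> R) (x : 'rV[R]_n) :
  (\forall y \near x, g y = 0) -> partial i g x = 0.
Proof.
move=> g0; rewrite /partial -[RHS](@derive_cst _ _ _ (0 : R) x (delta_mx ord0 i)).
exact: near_eq_derive.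
Qed.

Lemma continuous_compact_bounded n (f : 'rV[R]_n -> R) (M : R) :
  continuous f -> (forall x, M < `|x| -> f x = 0) -> exists C, forall x, `|f x| <= C.
Proof.
move=> cf f0.
have cK : compact (@cube n M).
  by apply: rV_compact => i; exact: segment_compact.
have /compact_bounded[C [_ HC]] : compact (f @` cube M).
  by apply: continuous_compact => //; exact: continuous_subspaceT.
exists (`|C| + 1) => x; case: (leP `|x| M) => [xM|/f0 ->]; last first.
  by rewrite normr0 addr_ge0.
by apply: HC; [rewrite (le_lt_trans (ler_norm _))// ltrDl|exists x => //; exact: norm_le_cube].
Qed.

(** The divergence theorem for a compactly supported function, one component
    at a time: the integral along each line in direction i is already 0. *)
Lemma integral_partial n (i : 'I_n.+1) (g : 'rV[R]_n.+1 -> R) (M : R) :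
  (forall x, derivable g x (delta_mx ord0 i)) -> continuous (partial i g) ->
  (forall x, M < `|x| -> g x = 0) ->
  (\int[lebesgue_rV R n.+1]_x (partial i g x)%:E = 0)%E.
Proof.
move=> dg cg g0.
have pg0 x : M < `|x| -> partial i g x = 0.
  by move=> /norm_lt_near Mx; apply: partial_eq0; apply: filterS Mx => y /g0.
have [C gC] := continuous_compact_bounded cg pg0.
rewrite (integrable_rV_insert i); last first.
  apply: (@bounded_integrable_rVT _ M C) => //.
  by apply: continuous_measurable_rV => [|x _]; [exact: openT|exact: cg].
apply: integral0_eq => y _.
apply: (@integral_derive_compact (fun t => g (insert_rV i (t, y))) _ M).
- by move=> t; exact: is_derive_insert.
- move=> t; apply: (@continuous_comp _ _ _ (fun s => insert_rV i (s, y))).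
    exact: continuous_insert.
  exact: cg.
- move=> t Mt; apply: g0; rewrite (lt_le_trans Mt)//.
  by have := norm_coord_le (insert_rV i (t, y)) i; rewrite insert_rV_same.
Qed.

End ibp.

(** * A smooth bump function *)

Section bumpf.
Variable R : realType.

(** Letting P vary gives a family stable under differentiation, which makes the
    smoothness of exp (-1/t) an induction. *)
Definition flat (P : {poly R}) (t : R) : R :=
  if 0 < t then P.[t^-1] * expR (- t^-1) else 0.

(** exp (1/t) dominates every power of 1/t; dominating one power more than P
    needs leaves the factor |t|, from which continuity at 0 follows. *)
Lemma flat_bound (P : {poly R}) : exists2 C : R, 0 <= C & forall t, `|flat P t| <= C * `|t|.
Proof.
exists (\sum_(i < size P) `|P`_i| * (i.+1)`!%:R).
  by apply: sumr_ge0 => i _; rewrite mulr_ge0.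
move=> t; rewrite /flat; case: ifPn => [t0|_]; last first.
  by rewrite normr0 mulr_ge0// sumr_ge0// => i _; rewrite mulr_ge0.
rewrite horner_coef mulr_suml (gtr0_norm t0) mulr_suml.
apply: (le_trans (ler_norm_sum _ _ _)); apply: ler_sum => i _.
rewrite !normrM -!mulrA ler_wpM2l// (ger0_norm (expR_ge0 _)) normrX gtr0_norm ?invr_gt0//.
have s0 : 0 < t^-1 by rewrite invr_gt0.
have f0 : 0 < (i.+1)`!%:R :> R by rewrite ltr0n fact_gt0.
have E0 := expR_gt0 t^-1.
have : t^-1 ^+ i.+1 <= (i.+1)`!%:R * expR t^-1.
  rewrite mulrC -ler_pdivrMr// (le_trans _ (expR_ge1Dxn i (ltW s0)))//.
  by rewrite lerDr.
rewrite exprS -ler_pdivlMl// invrK => H.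
by rewrite expRN ler_pdivrMr// (le_trans H)// mulrCA mulrA.
Qed.

Lemma flat_cvg0 (P : {poly R}) : flat P t @[t --> (0:R)] --> (0:R).
Proof.
have [C C0 PC] := flat_bound P.
apply/cvgrPdist_le => e e0; near=> t.
rewrite sub0r normrN (le_trans (PC t))//.
have : `|t| <= e / (C + 1).
  rewrite -normrN -sub0r; near: t.
  by apply: (@cvgr_dist_le _ R^o) => //; rewrite divr_gt0// ltr_wpDl.
rewrite ler_pdivlMr ?ltr_wpDl// => H; rewrite mulrC (le_trans _ H)//.
by rewrite ler_wpM2l// lerDl.
Unshelve. all: by end_near. Qed.

(** Away from 0 this is the chain rule. At 0 the difference quotient is itself
    a flat function, namely that of 'X * P, and tends to 0. *)
Lemma is_derive_flat (P : {poly R}) (t : R) :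
  is_derive t 1 (flat P) (flat ('X^2 * (P - P^`())) t).
Proof.
have [t0|t0|<-] := ltgtP 0 t.
- have nE : \forall s \near t, P.[s^-1] * expR (- s^-1) = flat P s.
    near=> s; rewrite /flat ifT//; near: s; exact: lt_nbhsr.
  apply: (@near_eq_is_derive _ R^o R^o (fun s => P.[s^-1] * expR (- s^-1)) _ t 1 _ nE).
  have tn0 : t != 0 by rewrite gt_eqF.
  have dV : is_derive t 1 (fun s : R => s^-1) (- t ^- 2).
    by apply: is_derive_eq; [apply: is_deriveV|rewrite [_ *: _]mulr1].
  have dP : is_derive t 1 (fun s : R => P.[s^-1]) (P^`().[t^-1] * (- t ^- 2)).
    exact: (is_derive1_comp (is_derive_poly P t^-1) dV).
  have dE : is_derive t 1 (fun s : R => expR (- s^-1)) (expR (- t^-1) * (t ^- 2)).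
    have dN : is_derive t 1 (fun s : R => - s^-1) (t ^- 2).
      by apply: (is_derive_eq (is_deriveN dV)); rewrite opprK.
    exact: (@is_derive1_comp R expR (fun s : R => - s^-1) t _ _ (is_derive_expR _) dN).
  rewrite /flat t0; apply: is_derive_eq.
  rewrite !hornerE /GRing.scale/= exprVn; ring.
- have nE : \forall s \near t, 0 = flat P s.
    near=> s; rewrite /flat ifF//; apply/negbTE; rewrite -leNgt ltW//; near: s.
    exact: lt_nbhsl.
  apply: (@near_eq_is_derive _ R^o R^o (fun=> 0) _ t 1 _ nE).
  rewrite /flat ltNge (ltW t0)/=; exact: is_derive_cst.
- have f0 Q : flat Q 0 = 0 by rewrite /flat ltxx.
  rewrite f0.
  have H : (fun h : R => h^-1 *: ((flat P \o shift 0) (h *: 1) - flat P 0)) @ 0^' --> (0 : R).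
    have E : (fun h : R => h^-1 *: ((flat P \o shift 0) (h *: 1) - flat P 0)) = flat ('X * P).
      apply/funext => h /=; rewrite f0 subr0 addr0 [h *: 1]mulr1.
      rewrite /flat; case: ifPn => _; last by rewrite scaler0.
      by rewrite !hornerE /GRing.scale/= mulrA.
    by rewrite E; exact: cvg_within_filter (flat_cvg0 ('X * P)).
  by split; [apply/cvg_ex; exists 0|exact/cvg_lim].
Unshelve. all: by end_near. Qed.

Fixpoint derivable_upto (n : nat) (f : R -> R) : Prop :=
  if n is m.+1 then (forall t, derivable f t 1) /\ derivable_upto m (derive1 f) else True.

Lemma derivable_uptoS n f : derivable_upto n.+1 f -> derivable_upto n f.
Proof.
by elim: n f => [//|n IH] f [df /IH Dnf]; split.
Qed.

Lemma derivable_uptoD n f g : derivable_upto n f -> derivable_upto n g -> derivable_upto n (fun t => f t + g t).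
Proof.
elim: n f g => [//|n IH] f g [df Df] [dg Dg]; split; first by move=> t; exact: derivableD.
rewrite (_ : derive1 _ = (fun t => (derive1 f) t + (derive1 g) t)); first exact: IH.
by apply/funext => t; rewrite !derive1E deriveD.
Qed.

Lemma derivable_uptoM n f g : derivable_upto n f -> derivable_upto n g -> derivable_upto n (fun t => f t * g t).
Proof.
elim: n f g => [//|n IH] f g /[dup] /derivable_uptoS Df [df Df'] /[dup] /derivable_uptoS Dg [dg Dg']; split.
  by move=> t; exact: derivableM.
rewrite (_ : derive1 _ = (fun t => f t * (derive1 g) t + g t * (derive1 f) t)).
  by apply: derivable_uptoD; exact: IH.
by apply/funext => t; rewrite !derive1E deriveM.
Qed.

Lemma derivable_upto_affine n f (k s c : R) : derivable_upto n f -> derivable_upto n (fun t => k * f (s * t + c)).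
Proof.
elim: n f k => [//|n IH] f k [df Df].
have H (t : R) : is_derive t (1:R) (fun t : R => k * f (s * t + c)) (k * s * (derive1 f) (s * t + c)).
  have da : is_derive t (1:R) (fun t => s * t + c) s.
    by apply: is_derive_eq; rewrite addr0 [_ *: _]mulr1.
  have df1 : is_derive (s * t + c) (1:R) f ((derive1 f) (s * t + c)).
    by rewrite derive1E; exact/derivableP.
  have := @is_derive1_comp R f (fun t => s * t + c) t _ _ df1 da.
  move=> H; apply: (is_derive_eq (is_deriveZ k H)).
  by rewrite /GRing.scale/= mulrA mulrAC.
split; first by move=> t; case: (H t).
rewrite (_ : derive1 _ = (fun t => k * s * (derive1 f) (s * t + c))); first exact: IH.
by apply/funext => t; rewrite derive1E; case: (H t).
Qed.

Lemma derivable_upto_flat n P : derivable_upto n (flat P).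
Proof.
elim: n P => [//|n IH] P; split; first by move=> t; case: (is_derive_flat P t).
rewrite (_ : derive1 _ = flat ('X^2 * (P - P^`()))); first exact: IH.
by apply/funext => t; rewrite derive1E; case: (is_derive_flat P t).
Qed.

Lemma derivable_upto_derive1n f : (forall n, derivable_upto n f) -> forall n t, derivable (derive1n n f) t 1.
Proof.
move=> Df n; elim: n f Df => [|n IH] f Df t; first by case: (Df 1).
by rewrite derive1Sn; apply: IH => m; case: (Df m.+1).
Qed.

(** Smooth, and positive exactly on ]-d, d[. *)
Definition bumpf (d t : R) : R := flat 1 (d + t) * flat 1 (d - t).

Lemma bump_smooth d n t : derivable (derive1n n (bumpf d)) t 1.
Proof.
apply: derivable_upto_derive1n => m; apply: derivable_uptoM.
- rewrite (_ : (fun t => _) = fun t => 1 * flat 1 (1 * t + d)).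
    exact/derivable_upto_affine/derivable_upto_flat.
  by apply/funext => s; rewrite !mul1r addrC.
- rewrite (_ : (fun t => _) = fun t => 1 * flat 1 (-1 * t + d)).
    exact/derivable_upto_affine/derivable_upto_flat.
  by apply/funext => s; rewrite mul1r mulN1r addrC.
Qed.

Lemma bump_ge0 d t : 0 <= bumpf d t.
Proof.
by apply: mulr_ge0; rewrite /flat; case: ifP => // _; rewrite hornerC mul1r expR_ge0.
Qed.

Lemma bump_gt0 d t : `|t| < d -> 0 < bumpf d t.
Proof.
rewrite ltr_norml => /andP[t1 t2]; rewrite /bumpf /flat !ifT; [|lra|lra].
by rewrite !hornerC !mul1r mulr_gt0// expR_gt0.
Qed.

Lemma bump_eq0 d n t : d < `|t| -> (derive1n n (bumpf d)) t = 0.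
Proof.
elim: n t => [|n IH] t dt.
  rewrite derive1n0 /bumpf /flat; move: dt; rewrite ltr_normr => /orP[dt|dt].
    by rewrite [X in _ * X]ifF ?mulr0//; apply/negbTE; rewrite -leNgt; lra.
  by rewrite ifF ?mul0r//; apply/negbTE; rewrite -leNgt; lra.
rewrite derive1nS derive1E -[RHS](@derive_cst _ _ _ (0 : R) t 1).
by apply: near_eq_derive; apply: filterS (norm_lt_near dt) => s /IH.
Qed.

End bumpf.

(** * Gradients and Taylor's estimate *)

Lemma near_dist_le (R : realType) (V : normedModType R) (x : V) (e : R) : 0 < e ->
  \forall y \near x, `|x - y| <= e.
Proof.
by move=> e0; apply/nbhs_ballP; exists e => //= y; rewrite -ball_normE => /ltW.
Qed.

Section diff_rV.
Variables (R : realType) (n : nat).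
Implicit Types (f g : 'rV[R]_n -> R) (x h v : 'rV[R]_n).

Lemma dotv_is_linear (w : 'rV[R]_n) : linear (dotv w : _ -> R).
Proof.
move=> k a b; rewrite /dotv scaler_sumr -big_split/=.
by apply: eq_bigr => i _; rewrite !mxE /GRing.scale/=; ring.
Qed.

HB.instance Definition _ (w : 'rV[R]_n) :=
  @GRing.isLinear.Build R 'rV[R]_n R _ (dotv w) (dotv_is_linear w).

Lemma dotv_norm_le v h : `|dotv v h| <= n%:R * (`|v| * `|h|).
Proof.
apply: (le_trans (ler_norm_sum _ _ _)).
have -> : n%:R * (`|v| * `|h|) = \sum_(i < n) `|v| * `|h|.
  by rewrite sumr_const card_ord mulr_natl.
apply: ler_sum => i _.
by rewrite normrM ler_pM// norm_coord_le.
Qed.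

Lemma continuous_dotv (w : 'rV[R]_n) : continuous (dotv w).
Proof.
move=> x; apply/(@cvgrPdist_le _ _ _ (nbhs x) _ (dotv w)) => e e0.
have d0 : 0 < e / (n%:R * `|w| + 1) by rewrite divr_gt0// ltr_wpDl// mulr_ge0.
have nb := near_dist_le x d0; apply: filterS nb => y.
rewrite ler_pdivlMr ?ltr_wpDl ?mulr_ge0// => H.
rewrite -(linearB (dotv w))/= (le_trans (dotv_norm_le _ _))// mulrA mulrC.
by rewrite (le_trans _ H)// ler_wpM2l// lerDl.
Qed.

Lemma derive_grad f x v : differentiable f x -> 'D_v f x = dotv (grad f x) v.
Proof.
move=> df; rewrite deriveE// {1}[v]row_sum_delta linear_sum/=.
apply: eq_bigr => i _; rewrite linearZ /= /grad mxE /partial deriveE// mulrC.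
by [].
Qed.

(** A quadratic remainder is negligible with respect to |h|. This is how
    differentials are computed throughout, as it asks for no more than an
    inequality. *)
Lemma differentiable_quadratic f x w (C : R) :
  (forall h, `|f (h + x) - f x - dotv w h| <= C * `|h| ^+ 2) ->
  differentiable f x /\ grad f x = w.
Proof.
move=> H.
have E : f \o shift x = cst (f x) + (dotv w) +o_ (0 : 'rV[R]_n) id.
  apply/eqaddoP => _/posnumP[e].
  have d0 : 0 < e%:num / (`|C| + 1) by rewrite divr_gt0// ltr_wpDl.
  have nb := near_dist_le (0 : 'rV[R]_n) d0; apply: filterS nb => h.
  rewrite sub0r normrN ler_pdivlMr ?ltr_wpDl// mulrDr mulr1 => He.
  rewrite -[X in `|X|]/(f (h + x) - (f x + dotv w h)) opprD addrA (le_trans (H h))//.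
  rewrite expr2 mulrA ler_wpM2r// (le_trans _ He)// mulrC ler_wpDr// ler_wpM2l//.
  exact: ler_norm.
have dE := diff_unique (@continuous_dotv w) E.
have df : differentiable f x.
  by apply/diff_locallyP; rewrite dE; split => //; exact: continuous_dotv.
split => //; apply/rowP => i; rewrite mxE /partial deriveE// dE.
rewrite /= /dotv (bigD1 i)//= mxE !eqxx mulr1 big1 ?addr0// => j ji.
by rewrite mxE (negbTE ji) andbF mulr0.
Qed.

Lemma is_derive_line f x h (t : R) : differentiable f (t *: h + x) ->
  is_derive t 1 (fun s : R => f (s *: h + x)) (dotv (grad f (t *: h + x)) h).
Proof.
move=> df; rewrite -derive_grad//.
have E : (fun k : R => k^-1 *: (((fun s => f (s *: h + x)) \o shift t) (k *: (1:R))
   - f (t *: h + x))) = (fun k : R => k^-1 *: ((f \o shift (t *: h + x))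
   (k *: h) - f (t *: h + x))).
  apply/funext => k /=; congr (_ *: (f _ - _)).
  by rewrite [k *: (1:R)]mulr1 scalerDl addrA.
by split; rewrite /derivable/derive E//; apply: diff_derivable.
Qed.

Lemma MVT_rV f x h : (forall t : R, 0 <= t <= 1 -> differentiable f (t *: h + x)) ->
  exists2 t : R, 0 < t < 1 & f (h + x) - f x = dotv (grad f (t *: h + x)) h.
Proof.
move=> df.
have [||t] := @MVT R (fun s : R => f (s *: h + x))
   (fun t => dotv (grad f (t *: h + x)) h) 0 1 ltr01.
- move=> t; rewrite in_itv/= => /andP[t0 t1]; apply: is_derive_line; apply: df.
  by rewrite !ltW.
- apply: continuous_in_subspaceT => t; rewrite inE/= in_itv/= => t01.
  apply/differentiable_continuous/derivable1_diffP.
  by case: (is_derive_line (df t t01)).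
- rewrite in_itv/= => t01; rewrite scale1r scale0r add0r subr0 mulr1 => ->.
  by exists t.
Qed.

Lemma grad_norm_le f x (B : R) : 0 <= B -> (forall i, `|partial i f x| <= B) ->
  `|grad f x| <= B.
Proof. by move=> B0 H; apply: norm_rV_le => // i; rewrite mxE. Qed.

(** The mean value theorem twice: for f between x and h + x, then for each
    partial derivative. *)
Lemma taylor2 f (B : R) : 0 <= B -> (forall x, differentiable f x) ->
  (forall i x, differentiable (partial i f) x) ->
  (forall i j x, `|partial j (partial i f) x| <= B) ->
  forall x h, `|f (h + x) - f x - dotv (grad f x) h| <= n%:R * n%:R * B * `|h| ^+ 2.
Proof.
move=> B0 df ddf dB x h.
have [t /andP[t0 t1] ->] := @MVT_rV f x h (fun _ _ => df _).
have -> : dotv (grad f (t *: h + x)) h - dotv (grad f x) h =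
    dotv (grad f (t *: h + x) - grad f x) h.
  by rewrite /dotv -sumrB; apply: eq_bigr => i _; rewrite !mxE; ring.
rewrite (le_trans (dotv_norm_le _ _))// expr2 -!mulrA ler_wpM2l// !mulrA ler_wpM2r//.
apply: norm_rV_le => [|i]; first by rewrite !mulr_ge0.
rewrite !mxE; have [s _ ->] := @MVT_rV (partial i f) x (t *: h) (fun _ _ => ddf i _).
rewrite (le_trans (dotv_norm_le _ _))// -!mulrA ler_wpM2l// ler_pM//.
  exact: grad_norm_le.
by rewrite normrZ gtr0_norm// ler_piMl// ltW.
Qed.

End diff_rV.

(** * Convolution with a smooth kernel *)

Section kernel.
Variables (R : realType) (n : nat).

Lemma differentiable_prod (I : Type) (s : seq I) (f : I -> 'rV[R]_n -> R) x :
  (forall i, differentiable (f i) x) -> differentiable (fun y => \prod_(i <- s) f i y) x.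
Proof.
move=> df; elim: s => [|i s IH].
  under eq_fun do rewrite big_nil; exact: differentiable_cst.
under eq_fun do rewrite big_cons; exact: differentiableM.
Qed.

(** The index m records how often the kernel is differentiated in each
    coordinate. The family is stable under partial derivatives, so the
    smoothness of a convolution with a member of it reduces to its
    differentiability. *)
Definition ker (d : R) (m : 'I_n -> nat) (x : 'rV[R]_n) : R :=
  \prod_(i < n) derive1n (m i) (bumpf d) (x ord0 i).

Lemma differentiable_ker d m x : differentiable (ker d m) x.
Proof.
apply: differentiable_prod => i.
apply: (@differentiable_comp _ _ _ _ (fun y : 'rV[R]_n => y ord0 i)).
  exact: differentiable_coord.
by apply/derivable1_diffP; exact: bump_smooth.
Qed.

Lemma partial_ker d m i :
  partial i (ker d m) = ker d (fun j => if j == i then (m j).+1 else m j).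
Proof.
apply/funext => x; rewrite /partial.
pose c := \prod_(j < n | j != i) derive1n (m j) (bumpf d) (x ord0 j).
have E : (fun h : R => h^-1 *: ((ker d m \o shift x) (h *: delta_mx ord0 i) - ker d m x)) =
   (fun h : R => h^-1 *: (((fun t => c *: derive1n (m i) (bumpf d) t) \o shift (x ord0 i))
     (h *: (1 : R)) - c *: derive1n (m i) (bumpf d) (x ord0 i))).
  apply/funext => h /=; congr (_ *: _); rewrite /ker (bigD1 i)//= [in X in _ - X](bigD1 i)//=.
  rewrite -/c !mxE !eqxx/= mulrC [_ * c]mulrC; congr (_ * _ - _).
  by apply: eq_bigr => j ji; rewrite !mxE (negbTE ji) andbF mulr0 add0r.
rewrite /derive E -/(derive (fun t => c *: derive1n (m i) (bumpf d) t) (x ord0 i) 1).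
rewrite deriveZ; last exact: bump_smooth.
rewrite /ker (bigD1 i)//= eqxx derive1nS derive1E [RHS]mulrC; congr (_ * _).
by apply: eq_bigr => j /negbTE ->.
Qed.

Lemma ker_eq0 d m x : 0 < d -> d < `|x| -> ker d m x = 0.
Proof.
move=> d0 dx.
have [i dxi] : exists i, d < `|x ord0 i|.
  apply: contrapT => /forallNP H; move: dx; apply/negP; rewrite -leNgt.
  by apply: norm_rV_le => [|i]; [exact: ltW|rewrite leNgt; exact/negP].
by rewrite /ker (bigD1 i)//= bump_eq0// mul0r.
Qed.

Lemma continuous_ker d m : continuous (ker d m).
Proof. by move=> x; apply/differentiable_continuous/differentiable_ker. Qed.

Lemma ker_bounded d m : 0 < d -> exists C, forall x, `|ker d m x| <= C.
Proof.
move=> d0; apply: (@continuous_compact_bounded _ _ _ d); first exact: continuous_ker.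
by move=> x; exact: ker_eq0.
Qed.

Lemma ker_ge0 d x : 0 <= ker d (fun=> 0%N) x.
Proof. by apply: prodr_ge0 => i _; exact: bump_ge0. Qed.

End kernel.

Lemma integrableBR d (T : measurableType d) (R : realType)
    (mu : {measure set T -> \bar R}) (D : set T) (f g : T -> R) : measurable D ->
  mu.-integrable D (EFin \o f) -> mu.-integrable D (EFin \o g) ->
  mu.-integrable D (EFin \o (fun x => f x - g x)).
Proof. by move=> mD fi gi; exact: (integrableB mD fi gi). Qed.

Section Rintegral_sum.
Context d (T : measurableType d) (R : realType) (mu : {measure set T -> \bar R}).
Variables (D : set T) (mD : measurable D) (n : nat) (f : 'I_n -> T -> R).
Hypothesis fi : forall i, mu.-integrable D (EFin \o f i).

Lemma integrable_sumR : mu.-integrable D (EFin \o (fun x => \sum_(i < n) f i x)).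
Proof.
rewrite (_ : _ \o _ = fun y => (\sum_(i < n) (EFin \o f i) y)%E).
  by apply: integrable_sum => //= i _; exact: fi.
by apply/funext => y /=; rewrite sumEFin.
Qed.

Lemma Rintegral_sum :
  (\int[mu]_(x in D) \sum_(i < n) f i x = \sum_(i < n) \int[mu]_(x in D) f i x)%R.
Proof.
rewrite /Rintegral -[LHS]/(fine (\int[mu]_(x in D) ((\sum_(i < n) f i x)%R)%:E)%E).
under eq_integral do rewrite -sumEFin.
rewrite (@integral_sum _ _ _ mu D mD _ (fun i x => (f i x)%:E))//=.
rewrite -sum_fine//= => i _; exact: integrable_fin_num (fi i).
Qed.
End Rintegral_sum.

Section convolution.
Variables (R : realType) (n : nat).
Local Notation mu := (lebesgue_rV R n).

Definition convol (psi K : 'rV[R]_n -> R) (x : 'rV[R]_n) : R :=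
  (\int[mu]_y (psi y * K (x - y)))%R.

Variables (psi : 'rV[R]_n -> R) (M C : R).
Hypotheses (mpsi : measurable_fun setT psi) (psiC : forall x, `|psi x| <= C)
  (psi0 : forall x, M < `|x| -> psi x = 0).

Lemma conv_integrable (K : 'rV[R]_n -> R) (B : R) x : measurable_fun setT K -> (forall z, `|K z| <= B) ->
  mu.-integrable setT (EFin \o (fun y => psi y * K (x - y))).
Proof.
move=> mK KB; apply: (@bounded_integrable_rVT _ _ M (C * B)).
- apply: measurable_funM => //.
  exact: (measurableT_comp mK (measurable_reflect x)).
- by move=> y; rewrite normrM ler_pM.
- by move=> y My; rewrite psi0// mul0r.
Qed.

Lemma norm_psi_integrable : mu.-integrable setT (EFin \o (fun y => `|psi y|)).
Proof.
apply: (@bounded_integrable_rVT _ _ M C); first exact: measurableT_comp.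
  by move=> x; rewrite normr_id.
by move=> x /psi0 ->; rewrite normr0.
Qed.

(** Integrating the second order Taylor estimate of K against psi gives a
    quadratic remainder for the convolution. *)
Lemma conv_differentiable (K : 'rV[R]_n -> R) (B : R) : continuous K -> (forall x, `|K x| <= B) ->
  (forall x, differentiable K x) ->
  (forall i, continuous (partial i K)) -> (forall i x, `|partial i K x| <= B) ->
  (forall i x, differentiable (partial i K) x) ->
  (forall i j x, `|partial j (partial i K) x| <= B) ->
  forall x, differentiable (convol psi K) x /\
    forall i, partial i (convol psi K) x = convol psi (partial i K) x.
Proof.
move=> cK KB dK cK1 K1B dK1 K2B x.
have mK : measurable_fun setT K.
  by apply: continuous_measurable_rV => [|y _]; [exact: openT|exact: cK].
have mK1 i : measurable_fun setT (partial i K).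
  by apply: continuous_measurable_rV => [|y _]; [exact: openT|exact: cK1].
have B0 : 0 <= B by exact: le_trans (normr_ge0 _) (KB 0).
pose w := \row_i convol psi (partial i K) x.
pose I := (\int[mu]_y `|psi y|)%R.
have [] := @differentiable_quadratic R n (convol psi K) x w (n%:R * n%:R * B * I).
  move=> h.
  have i1 z := conv_integrable z mK KB.
  have i2 i := conv_integrable x (mK1 i) (K1B i).
  have i3 i := integrableZr measurableT (h ord0 i) (i2 i).
  have iS := integrable_sumR measurableT i3.
  have -> : dotv w h = (\int[mu]_y \sum_(i < n) psi y * partial i K (x - y) * h ord0 i)%R.
    rewrite Rintegral_sum//; apply: eq_bigr => i _.
    by rewrite mxE RintegralZr//; exact: i2.
  rewrite /convol -RintegralB// -RintegralB//; last exact: integrableBR.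
  have ig := integrableBR measurableT (integrableBR measurableT (i1 (h + x)) (i1 x)) iS.
  have iC : mu.-integrable setT (EFin \o (fun y => `|psi y| * (n%:R * n%:R * B * `|h| ^+ 2))).
    apply: (integrableZr measurableT _ (f := EFin \o (fun y => `|psi y|))).
    exact: norm_psi_integrable.
  rewrite (le_trans (le_normr_Rintegral _ ig))//.
  rewrite [leRHS](_ : _ = \int[mu]_y (`|psi y| * (n%:R * n%:R * B * `|h| ^+ 2)))%R; last first.
    rewrite RintegralZr//; last exact: norm_psi_integrable.
    by rewrite -/I; ring.
  apply: le_Rintegral => //.
    exact: (integrable_abse ig).
  move=> y _; rewrite -!mulrBr.
  have -> : \sum_(i < n) psi y * partial i K (x - y) * h ord0 i =
      psi y * dotv (grad K (x - y)) h.
    by rewrite /dotv mulr_sumr; apply: eq_bigr => i _; rewrite mxE mulrA.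
  rewrite -mulrBr normrM ler_wpM2l//.
  by have := taylor2 B0 dK dK1 K2B (x - y) h; rewrite addrA.
move=> dF gF; split => // i.
by have := congr1 (fun v : 'rV[R]_n => v ord0 i) gF; rewrite !mxE.
Qed.
End convolution.

(** * Positivity of integrals and uniform continuity *)

Section positivity.
Variables (R : realType) (n : nat).
Local Notation mu := (lebesgue_rV R n).

(** A positive value persists on a small cube, which has positive measure. *)
Lemma integral0_continuous (U : set 'rV[R]_n) (f : 'rV[R]_n -> R) :
  open U -> {in U, continuous f} -> (forall x, U x -> 0 <= f x) ->
  (\int[mu]_(x in U) (f x)%:E = 0)%E -> forall x, U x -> f x = 0.
Proof.
move=> oU cf f0 If x Ux; apply/eqP; rewrite eq_le f0// andbT leNgt; apply/negP => fx0.
have nU : \forall y \near x, U y /\ f x / 2 < f y.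
  apply: filterI; first exact: open_nbhs_nbhs.
  apply: (cvgr_gt _ (cf x (mem_set Ux))).
  by rewrite ltr_pdivrMr// ltr_pMr// ltr1n.
have /nbhs_ballP[r /= r0 rU] := nU.
have r20 : 0 < r / 2 by rewrite divr_gt0.
have BU y : cube_at x (r / 2) y -> U y /\ f x / 2 < f y.
  move=> /(cube_atP _ _ (ltW r20)) H; apply: rU; rewrite -ball_normE /ball_/=.
  by rewrite (le_lt_trans H)// ltr_pdivrMr// ltr_pMr// ltr1n.
have mf : measurable_fun U f by exact: continuous_measurable_rV.
have mU : measurable U by exact: open_measurable_rV.
have mB := measurable_cube_at x (r / 2).
have : (\int[mu]_(y in cube_at x (r / 2)) (f x / 2)%:E <= 0)%E.
  rewrite -If (@le_trans _ _ (\int[mu]_(y in cube_at x (r / 2)) (f y)%:E)%E)//.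
    apply: ge0_le_integral => //.
    - by move=> y _; rewrite lee_fin divr_ge0// ltW.
    - by apply/measurable_EFinP; apply: measurable_funS mf => //; move=> y /BU[].
    - by move=> y /BU[_ H]; rewrite lee_fin ltW.
  apply: ge0_subset_integral => //.
  - exact/measurable_EFinP.
  - by move=> y /BU[].
rewrite integral_cst// [X in (_ * X)%E]lebesgue_cube_at; last exact: ltW.
rewrite -EFinM lee_fin.
by apply/negP; rewrite -ltNge mulr_gt0// ?divr_gt0// exprn_gt0// mulr_gt0.
Qed.

End positivity.

(** Heine's theorem on a cube one unit larger than the support: a point
    outside this cube and its neighbours at distance at most 1 lie where all
    the functions vanish. *)
Lemma uniform_continuity_rV (R : realType) n m (f : 'I_m -> 'rV[R]_n -> R) (M e : R) :
  (forall i, continuous (f i)) -> (forall i x, M < `|x| -> f i x = 0) -> 0 < e ->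
  exists2 d : R, 0 < d & forall x y, `|x - y| <= d -> forall i, `|f i x - f i y| <= e.
Proof.
move=> cf f0 e0.
pose P (d : R) (x : 'rV[R]_n) := forall y, `|x - y| <= d -> forall i, `|f i x - f i y| <= e.
have cK : compact (@cube R n (M + 1)).
  by apply: rV_compact => i; exact: segment_compact.
have : \forall d \near (0 : R)^'+, cube (M + 1) `<=` P d.
  have /compact_near_coveringP/(_ R (0 : R)^'+ P) := cK; apply => x _.
  have /nbhs_ballP[r /= r0 rH] : \forall y \near x, forall i, `|f i x - f i y| <= e / 2.
    apply: (@filter_forall _ _ (fun i y => `|f i x - f i y| <= e / 2) (nbhs x)) => i.
    have e20 : 0 < e / 2 by rewrite divr_gt0.
    exact: (@cvgr_dist_le _ R^o _ (nbhs x) _ (f i) (f i x) (cf i x) _ e20).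
  have r20 : 0 < r / 2 by rewrite divr_gt0.
  exists ([set x' | `|x - x'| <= r / 2], [set d | d < r / 2]).
    by split; [exact: (near_dist_le x r20)|exact: (nbhs_right_lt r20)].
  move=> [x' d] [/= xx' dr] y xy i.
  have H1 : `|f i x - f i x'| <= e / 2.
    by apply: rH; rewrite -ball_normE /= (le_lt_trans xx')//; lra.
  have H2 : `|f i x - f i y| <= e / 2.
    by apply: rH; rewrite -ball_normE /= (le_lt_trans (ler_distD x' _ _))//; lra.
  by rewrite (le_trans (ler_distD (f i x) _ _))// distrC; lra.
move=> H; near (0 : R)^'+ => d.
exists (Num.min d 1); first by rewrite lt_min ltr01 andbT; near: d; exact: nbhs_right_gt.
move=> x y; rewrite le_min => /andP[xyd xy1] i.
have [xM|Mx] := leP `|x| (M + 1).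
  have : cube (M + 1) `<=` P d by near: d.
  by move=> /(_ x); apply => //; exact: norm_le_cube.
rewrite !f0 ?subrr ?normr0 ?ltW//; last by rewrite (lt_trans _ Mx)// ltrDl.
have H1 := ler_normD (x - y) y; rewrite subrK in H1.
by rewrite -(ltrD2r 1) (lt_le_trans Mx)// (le_trans H1)// addrC lerD2l.
Unshelve. all: by end_near. Qed.

(** * Mollification of test functions *)

Section mollify.
Variables (R : realType) (n : nat).
Local Notation mu := (lebesgue_rV R n.+1).
Local Notation V := 'rV[R]_n.+1.

Lemma derive_reflect (K : V -> R) (x y v : V) : differentiable K (x - y) ->
  derivable (fun z => K (x - z)) y v /\
  'D_v (fun z => K (x - z)) y = - 'D_v K (x - y).
Proof.
move=> dK.
have dr : differentiable (fun z : V => x - z) y by exact: differentiableB.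
have dKr : differentiable (fun z => K (x - z)) y by exact: (differentiable_comp dr dK).
split; first exact: diff_derivable.
rewrite deriveE// (diff_comp dr dK) /= -[X in 'd K _ X]deriveE//.
rewrite deriveB; [|exact: derivable_cst|exact: derivable_id].
by rewrite derive_cst derive_id sub0r linearN -deriveE.
Qed.

(** The integral does not depend on x by reflection invariance of the measure,
    and it is positive because the kernel is positive at 0. *)
Lemma ker_mass (d : R) : 0 < d ->
  exists2 c : R, 0 < c & forall x : V, (\int[mu]_y ker d (fun=> 0%N) (x - y))%R = c.
Proof.
move=> d0; set k := ker d (fun=> 0%N).
have mk : measurable_fun setT k.
  by apply: continuous_measurable_rV => [|x _]; [exact: openT|exact: continuous_ker].
have [C kC] := @ker_bounded R n.+1 d (fun=> 0%N) d0.
have ik : mu.-integrable setT (EFin \o k).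
  by apply: (@bounded_integrable_rVT _ _ d C) => // x; exact: ker_eq0.
exists (\int[mu]_y k y)%R => [|x]; last first.
  congr fine; apply: (@ge0_integral_rV_reflect R n.+1 x (EFin \o k)).
    exact/measurable_EFinP.
  by move=> y; rewrite lee_fin ker_ge0.
rewrite lt_neqAle Rintegral_ge0 ?andbT; last by move=> x _; exact: ker_ge0.
apply/eqP => I0.
have : k 0 = 0.
  apply: (@integral0_continuous R n.+1 setT k) => //.
  - exact: openT.
  - by move=> x _; exact: continuous_ker.
  - by move=> x _; exact: ker_ge0.
  - by rewrite -[LHS]fineK ?(integrable_fin_num measurableT ik)// -[X in X%:E]I0.
apply/eqP; rewrite gt_eqF//; apply: prodr_gt0 => i _; rewrite derive1n0 mxE.
by apply: bump_gt0; rewrite normr0.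
Qed.

Variables (psi : V -> R) (M : R).
Hypotheses (dpsi : forall x, differentiable psi x)
  (cpsi : forall i, continuous (partial i psi))
  (psi0 : forall x, M < `|x| -> psi x = 0).

Let psi'0 i x : M < `|x| -> partial i psi x = 0.
Proof. by move=> Mx; apply: partial_eq0; apply: filterS (norm_lt_near Mx) => y /psi0. Qed.

Let cpsi0 : continuous psi.
Proof. by move=> x; exact/differentiable_continuous. Qed.

Let psi_bounded : exists C, forall x, `|psi x| <= C.
Proof. exact: continuous_compact_bounded psi0. Qed.

Let mpsi : measurable_fun setT psi.
Proof. by apply: continuous_measurable_rV => [|x _]; [exact: openT|exact: cpsi0]. Qed.

(** The difference of the two sides is the integral of a partial derivative of
    the compactly supported function y |-> psi y * K (x - y). *)
Lemma conv_ibp (K : V -> R) : (forall x, differentiable K x) ->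
  (forall i x, differentiable (partial i K) x) -> (exists B, forall x, `|K x| <= B) ->
  (forall i, exists B, forall x, `|partial i K x| <= B) ->
  forall i x, convol (partial i psi) K x = convol psi (partial i K) x.
Proof.
move=> dK dK1 [B KB] K1B i x.
have cK i' : continuous (partial i' K) by move=> y; exact/differentiable_continuous.
have cK0 : continuous K by move=> y; exact/differentiable_continuous.
have dr (y : V) : differentiable (fun y : V => x - y) y by exact: differentiableB.
pose g y := psi y * K (x - y).
have gE y : partial i g y = partial i psi y * K (x - y) - psi y * partial i K (x - y).
  have [d1 d2] := derive_reflect (delta_mx ord0 i) (dK (x - y)).
  rewrite /partial deriveM//; last exact: diff_derivable.
  by rewrite d2 addrC scalerN; congr (_ - _); exact: mulrC.
have cg : continuous (partial i g).
  rewrite (_ : partial i g = fun y => partial i psi y * K (x - y)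
      - psi y * partial i K (x - y)); last exact/funext.
  move=> y.
  have c1 : {for y, continuous (fun y : V => K (x - y))}.
    by apply/differentiable_continuous; exact: (differentiable_comp (dr y) (dK _)).
  have c2 : {for y, continuous (fun y : V => partial i K (x - y))}.
    by apply/differentiable_continuous; exact: (differentiable_comp (dr y) (dK1 i _)).
  exact: (continuousB (continuousM (@cpsi i y) c1) (continuousM (@cpsi0 y) c2)).
have dg y : derivable g y (delta_mx ord0 i).
  by apply: derivableM; [exact: diff_derivable|
    have [] := derive_reflect (delta_mx ord0 i) (dK (x - y))].
have g0 y : M < `|y| -> g y = 0 by move=> My; rewrite /g psi0// mul0r.
have := integral_partial dg cg g0.
have [C psiC] := psi_bounded; have [C1 psi1C] := continuous_compact_bounded (@cpsi i) (@psi'0 i).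
have [B1 KB1] := K1B i.
have mK : measurable_fun setT K.
  by apply: continuous_measurable_rV => [|y _]; [exact: openT|exact: cK0].
have mK1 : measurable_fun setT (partial i K).
  by apply: continuous_measurable_rV => [|y _]; [exact: openT|exact: cK].
have mpsi1 : measurable_fun setT (partial i psi).
  by apply: continuous_measurable_rV => [|y _]; [exact: openT|exact: cpsi].
have i1 := conv_integrable mpsi1 psi1C (@psi'0 i) x mK KB.
have i2 := conv_integrable mpsi psiC psi0 x mK1 KB1.
under eq_integral do rewrite gE.
move=> /(congr1 fine); rewrite -[LHS]/(Rintegral _ _ _) RintegralB//= => /eqP.
by rewrite subr_eq0 => /eqP.
Qed.

End mollify.

Lemma fin_bound (R : realType) (I : finType) (T : Type) (f : I -> T -> R) :
  (forall i, exists B, forall x, `|f i x| <= B) -> exists B, forall i x, `|f i x| <= B.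
Proof.
move=> /choice[b fb]; exists (\sum_i `|b i|) => i x.
by rewrite (le_trans (fb i x))// (bigD1 i)//= ler_wpDr ?sumr_ge0// ler_norm.
Qed.

Lemma differentiable_conv_ker (R : realType) (n : nat) (psi : 'rV[R]_n -> R) (M C d : R) :
  measurable_fun setT psi -> (forall x, `|psi x| <= C) ->
  (forall x, M < `|x| -> psi x = 0) -> 0 < d ->
  forall m x, differentiable (convol psi (ker d m)) x /\
    forall i, partial i (convol psi (ker d m)) x = convol psi (partial i (ker d m)) x.
Proof.
move=> mpsi psiC psi0 d0 m.
have [B1 HB1] := @ker_bounded R n d m d0.
have [B2 HB2] : exists B, forall i x, `|partial i (ker d m) x| <= B.
  by apply: fin_bound => i; rewrite partial_ker; exact: ker_bounded.
have [B3 HB3] : exists B, forall (ij : 'I_n * 'I_n) x,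
    `|partial ij.2 (partial ij.1 (ker d m)) x| <= B.
  by apply: fin_bound => i; rewrite !partial_ker; exact: ker_bounded.
have H (b : R) : b = B1 \/ b = B2 \/ b = B3 -> b <= `|B1| + `|B2| + `|B3|.
  have := ler_norm B1; have := ler_norm B2; have := ler_norm B3.
  have := normr_ge0 B1; have := normr_ge0 B2; have := normr_ge0 B3.
  by move=> ? ? ? ? ? ? [->|[->|->]]; lra.
apply: (@conv_differentiable R n psi M C mpsi psiC psi0 _ (`|B1| + `|B2| + `|B3|)).
- exact: continuous_ker.
- by move=> x; rewrite (le_trans (HB1 x))//; apply: H; left.
- by move=> x; exact: differentiable_ker.
- by move=> i; rewrite partial_ker; exact: continuous_ker.
- by move=> i x; rewrite (le_trans (HB2 i x))//; apply: H; right; left.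
- by move=> i x; rewrite partial_ker; exact: differentiable_ker.
- by move=> i j x; rewrite (le_trans (HB3 (i, j) x))//; apply: H; right; right.
Qed.

Section mollify.
Variables (R : realType) (n : nat).
Local Notation mu := (lebesgue_rV R n.+1).
Local Notation V := 'rV[R]_n.+1.
Variables (psi : V -> R) (M : R).
Hypotheses (dpsi : forall x, differentiable psi x)
  (cpsi : forall i, continuous (partial i psi))
  (psi0 : forall x, M < `|x| -> psi x = 0).

Let psi'0 i x : M < `|x| -> partial i psi x = 0.
Proof. by move=> Mx; apply: partial_eq0; apply: filterS (norm_lt_near Mx) => y /psi0. Qed.

Let cpsi0 : continuous psi.
Proof. by move=> x; exact/differentiable_continuous. Qed.

Let mpsi : measurable_fun setT psi.
Proof. by apply: continuous_measurable_rV => [|x _]; [exact: openT|exact: cpsi0]. Qed.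

Lemma smooth_conv (c d : R) m : 0 < d ->
  smooth_on setT (fun x => c * convol psi (ker d m) x).
Proof.
move=> d0 s x _.
have [C psiC] := continuous_compact_bounded cpsi0 psi0.
have H := differentiable_conv_ker mpsi psiC psi0 d0.
have [m' ->] : exists m', foldr (@partial R n.+1) (fun x => c * convol psi (ker d m) x) s =
    (fun x => c * convol psi (ker d m') x).
  elim: s => [|i s [m' IH]]; first by exists m.
  exists (fun j => if j == i then (m' j).+1 else m' j); rewrite /= IH.
  apply/funext => y; have [dF pF] := H m' y.
  rewrite -[c * _]/(c *: _) -partial_ker -pF /partial.
  by rewrite -(deriveZ c (diff_derivable dF)).
by apply: differentiableZ; exact: (H m' x).1.
Qed.

(** The approximation is the convolution of psi with a kernel of mass 1
    supported in a ball so small that the partial derivatives of psi vary by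
    at most e over it. The sets S and S' keep its support inside U. *)
Lemma mollify (S S' U : set V) (d0 e : R) :
  (forall x, psi x != 0 -> S x) -> compact S' -> S' `<=` U -> 0 < d0 ->
  (forall x y, S y -> `|x - y| <= d0 -> S' x) -> 0 < e ->
  exists2 phi, test_function U phi & forall i x, `|partial i phi x - partial i psi x| <= e.
Proof.
move=> psiS cS' S'U d00 SS' e0.
have [d1 d10 unif] := uniform_continuity_rV cpsi psi'0 e0.
pose d := Num.min d0 d1.
have d_gt0 : 0 < d by rewrite lt_min d00.
have [c c0 mass] := @ker_mass R n d d_gt0.
set k := ker d (fun=> 0%N) in mass.
have [C psiC] := continuous_compact_bounded cpsi0 psi0.
exists (fun x => c^-1 * convol psi k x).
  have phiS' : [set x | c^-1 * convol psi k x != 0] `<=` S'.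
    move=> x /= H; apply: contrapT => nS'; move/negP : H; apply; apply/eqP.
    rewrite /convol [X in _ * X](_ : _ = 0) ?mulr0//.
    rewrite /Rintegral integral0_eq// => y _; congr EFin.
    have [->|/psiS Sy] := eqVneq (psi y) 0; first by rewrite mul0r.
    rewrite /k ker_eq0 ?mulr0// ltNge; apply/negP => xy; apply: nS'; apply: SS' Sy _.
    by rewrite (le_trans xy)// ge_min lexx.
  have clS' : closure [set x | c^-1 * convol psi k x != 0] `<=` S'.
    move=> x; have := compact_closed (@norm_hausdorff _ _) cS'.
    by move=> /closure_id => ->; exact: closureS.
  split; first exact: smooth_conv.
  - by apply: (subclosed_compact _ cS') => //; exact: closed_closure.
  - exact: subset_trans S'U.
move=> i x.
have [dF pF] := differentiable_conv_ker mpsi psiC psi0 d_gt0 (fun=> 0%N) x.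
have [B1 HB1] := @ker_bounded R n.+1 d (fun=> 0%N) d_gt0.
have mk : measurable_fun setT k.
  by apply: continuous_measurable_rV => [|y _]; [exact: openT|exact: continuous_ker].
have -> : partial i (fun x => c^-1 * convol psi k x) x = c^-1 * convol (partial i psi) k x.
  rewrite (conv_ibp dpsi cpsi psi0).
  - by rewrite -pF /partial -[RHS](deriveZ c^-1 (diff_derivable dF)).
  - by move=> y; exact: differentiable_ker.
  - by move=> j y; rewrite partial_ker; exact: differentiable_ker.
  - by exists B1.
  - by move=> j; rewrite partial_ker; exact: ker_bounded.
have [C1 psi1C] := continuous_compact_bounded (@cpsi i) (@psi'0 i).
have mpsi1 : measurable_fun setT (partial i psi).
  by apply: continuous_measurable_rV => [|y _]; [exact: openT|exact: cpsi].
have i1 := conv_integrable mpsi1 psi1C (@psi'0 i) x mk HB1.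
have ik : mu.-integrable setT (EFin \o (fun y => k (x - y))).
  apply: (@bounded_integrable_rVT _ _ (`|x| + d) B1) => [|//|y xdy].
    exact: (measurableT_comp mk (measurable_reflect x)).
  by apply: ker_eq0 => //; have := lerB_dist y x; rewrite distrC; lra.
have -> : partial i psi x = c^-1 * (\int[mu]_y (partial i psi x * k (x - y)))%R.
  by rewrite RintegralZl// mass mulrC mulfK ?gt_eqF.
rewrite -mulrBr normrM gtr0_norm ?invr_gt0// ler_pdivrMl// mulrC.
have ic : mu.-integrable setT (EFin \o (fun y => partial i psi x * k (x - y))).
  exact: (integrableZl measurableT _ ik).
rewrite /convol -RintegralB//.
have iB := integrableBR measurableT i1 ic.
rewrite (le_trans (le_normr_Rintegral _ iB))// -(mass x) -RintegralZl//.
apply: le_Rintegral => //.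
- exact: (integrable_abse iB).
- exact: (integrableZl measurableT _ ik).
move=> y _; rewrite -mulrBl normrM [`|k _|]ger0_norm ?ker_ge0//.
have [xy|xy] := leP `|x - y| d.
  rewrite ler_wpM2r ?ker_ge0// distrC; apply: unif.
  by rewrite (le_trans xy)// ge_min lexx orbT.
by rewrite /k ker_eq0// !mulr0.
Qed.

(** The equation passes to the limit along C^1 approximations of psi by test
    functions, since H is bounded and U has finite measure. *)
Lemma weak_zero_C1 (S S' U : set V) (d0 : R) (H : 'I_n.+1 -> V -> R) (C L : R) :
  (forall x, psi x != 0 -> S x) -> compact S' -> S' `<=` U -> 0 < d0 ->
  (forall x y, S y -> `|x - y| <= d0 -> S' x) ->
  open U -> U `<=` cube L -> (forall i, {in U, continuous (H i)}) ->
  (forall i x, U x -> `|H i x| <= C) ->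
  (forall phi, test_function U phi ->
    (\int[mu]_(x in U) (\sum_i H i x * partial i phi x)%:E = 0)%E) ->
  (\int[mu]_(x in U) (\sum_i H i x * partial i psi x)%:E = 0)%E.
Proof.
move=> psiS cS' S'U d00 SS' oU UL cH HC weak.
have mU : measurable U by exact: open_measurable_rV.
have int0 (g : 'I_n.+1 -> V -> R) (B : R) : (forall i, {in U, continuous (g i)}) ->
    (forall i x, U x -> `|g i x| <= B) ->
    mu.-integrable U (EFin \o (fun x => \sum_i H i x * g i x)).
  move=> cg gB; apply: integrable_sumR => // i.
  apply: (@bounded_integrable_rV _ _ U L (C * B)) => //.
    by apply: measurable_funM; apply: continuous_measurable_rV.
  by move=> x Ux; rewrite normrM ler_pM// ?HC ?gB.
have [B psiB] : exists B, forall i x, `|partial i psi x| <= B.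
  apply: fin_bound => i; exact: (continuous_compact_bounded (@cpsi i) (@psi'0 i)).
have ipsi := int0 (fun i => partial i psi) B (fun i x _ => @cpsi i x) (fun i x _ => psiB i x).
have Ufin : (mu U < +oo)%E.
  apply: le_lt_trans (lebesgue_cube_lty _ L); apply: le_measure; rewrite ?inE//.
  exact: measurable_cube.
rewrite -[LHS]fineK; last exact: (integrable_fin_num mU ipsi).
congr EFin; apply/eqP; rewrite -normr_le0; apply/ler_addgt0Pl => e e0; rewrite addr0.
(* replacing the partial derivatives of psi by those of phi, which are within e
   / K of them, changes the integral by at most e; the summands 1 keep K
   positive *)
pose K := n.+1%:R * (`|C| + 1) * (fine (mu U) + 1).
have K0 : 0 < K.
  by rewrite /K !mulr_gt0// ?ltr_wpDl// fine_ge0.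
have [phi tphi Hphi] := mollify psiS cS' S'U d00 SS' (divr_gt0 e0 K0).
have cphi i : continuous (partial i phi).
  have [sphi _ _] := tphi => x; apply/differentiable_continuous.
  by have := sphi [:: i] x (mem_set I).
have iphi := int0 (fun i => partial i phi) (e / K + B) (fun i x _ => @cphi i x).
have {}iphi : mu.-integrable U (EFin \o (fun x => \sum_i H i x * partial i phi x)).
  apply: iphi => i x _; have := Hphi i x; have := psiB i x.
  have := lerB_dist (partial i phi x) (partial i psi x); lra.
have -> : fine (\int[mu]_(x in U) (\sum_i H i x * partial i psi x)%:E)%E =
   (\int[mu]_(x in U) (\sum_i H i x * partial i psi x - \sum_i H i x * partial i phi x))%R.
  rewrite RintegralB// [X in _ - X](_ : _ = 0) ?subr0//.
  by rewrite /Rintegral weak.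
have iB := integrableBR mU ipsi iphi.
rewrite (le_trans (le_normr_Rintegral mU iB))//.
apply: (@le_trans _ _ (\int[mu]_(x in U) (n.+1%:R * (`|C| * (e / K))))%R).
  apply: le_Rintegral => //; first exact: (integrable_abse iB).
    by apply: (@bounded_integrable_rV _ _ U L (n.+1%:R * (`|C| * (e / K)))) => // x _;
      rewrite ger0_norm// mulr_ge0// mulr_ge0// divr_ge0 ?ltW.
  move=> x Ux; rewrite -sumrB (le_trans (ler_norm_sum _ _ _))//.
  have -> : n.+1%:R * (`|C| * (e / K)) = \sum_(i < n.+1) (`|C| * (e / K)).
    by rewrite sumr_const card_ord mulr_natl.
  apply: ler_sum => i _; rewrite -mulrBr normrM ler_pM//.
    by rewrite (le_trans (HC i x Ux))// ler_norm.
  by rewrite distrC Hphi.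
rewrite Rintegral_cst//.
have m0 : 0 <= fine (mu U) by rewrite fine_ge0.
have -> : n.+1%:R * (`|C| * (e / K)) * fine (mu U) = n.+1%:R * `|C| * fine (mu U) * e / K.
  by ring.
rewrite ler_pdivrMr// mulrC ler_wpM2l ?(ltW e0)// /K -!mulrA ler_wpM2l//.
by rewrite ler_pM// lerDl.
Qed.
End mollify.

(** * The Euclidean norm *)

Section enorm.
Variables (R : realType) (n : nat).
Implicit Types (x y v w : 'rV[R]_n).

Lemma dotvC v w : dotv v w = dotv w v.
Proof. by apply: eq_bigr => i _; rewrite mulrC. Qed.

Lemma dotvDr v w z : dotv v (w + z) = dotv v w + dotv v z.
Proof. by rewrite (linearD (dotv v)). Qed.

Lemma dotvZr v k w : dotv v (k *: w) = k * dotv v w.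
Proof. by rewrite (linearZ_LR (dotv v)). Qed.

Lemma dotvDl v w z : dotv (v + w) z = dotv v z + dotv w z.
Proof. by rewrite dotvC dotvDr !(dotvC z). Qed.

Lemma dotvZl v k w : dotv (k *: v) w = k * dotv v w.
Proof. by rewrite dotvC dotvZr dotvC. Qed.

Lemma dotvNr v w : dotv v (- w) = - dotv v w.
Proof. by rewrite -scaleN1r dotvZr mulN1r. Qed.

Lemma dotvNl v w : dotv (- v) w = - dotv v w.
Proof. by rewrite dotvC dotvNr dotvC. Qed.

Lemma dotvv_ge0 v : 0 <= dotv v v.
Proof. by apply: sumr_ge0 => i _; rewrite -expr2 sqr_ge0. Qed.

Lemma enorm_ge0 v : 0 <= enorm v. Proof. exact: sqrtr_ge0. Qed.

Lemma enorm_sqr v : enorm v ^+ 2 = dotv v v.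
Proof. by rewrite sqr_sqrtr// dotvv_ge0. Qed.

Lemma coord_enorm v i : `|v ord0 i| <= enorm v.
Proof.
rewrite -[`|_|]sqrtr_sqr ler_sqrt ?dotvv_ge0//.
by rewrite /dotv (bigD1 i)//= -expr2 lerDl sumr_ge0// => j _; rewrite -expr2 sqr_ge0.
Qed.

Lemma norm_le_enorm v : `|v| <= enorm v.
Proof. by apply: norm_rV_le => [|i]; [exact: enorm_ge0|exact: coord_enorm]. Qed.

Lemma enorm_le_norm v : enorm v <= n%:R * `|v|.
Proof.
rewrite -[leRHS]ger0_norm ?mulr_ge0// -sqrtr_sqr ler_sqrt ?sqr_ge0//.
have H : dotv v v <= n%:R * `|v| ^+ 2.
  have -> : n%:R * `|v| ^+ 2 = \sum_(i < n) `|v| ^+ 2 by rewrite sumr_const card_ord mulr_natl.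
  apply: ler_sum => i _; rewrite -expr2 -real_normK ?num_real// lerXn2r ?nnegrE//.
  exact: norm_coord_le.
rewrite (le_trans H)// exprMn ler_wpM2r ?sqr_ge0//.
by rewrite -natrX ler_nat; case: (n) => // k; rewrite leq_pmulr.
Qed.

Lemma enorm_eq0 v : (enorm v == 0) = (v == 0).
Proof.
apply/eqP/eqP => [v0|->]; last first.
  by rewrite /enorm /dotv big1 ?sqrtr0// => i _; rewrite mxE mul0r.
by apply/eqP; rewrite -normr_le0 -v0 norm_le_enorm.
Qed.

Lemma enorm0 : enorm (0 : 'rV[R]_n) = 0. Proof. by apply/eqP; rewrite enorm_eq0. Qed.

Lemma enorm_gt0 v : (0 < enorm v) = (v != 0).
Proof. by rewrite lt_neqAle enorm_ge0 andbT eq_sym enorm_eq0. Qed.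

Lemma enormZ k v : enorm (k *: v) = `|k| * enorm v.
Proof.
by rewrite /enorm dotvZl dotvZr mulrA -expr2 sqrtrM ?sqr_ge0// sqrtr_sqr.
Qed.

Lemma enormN v : enorm (- v) = enorm v.
Proof. by rewrite -scaleN1r enormZ normrN1 mul1r. Qed.

(** Cauchy-Schwarz: the squared norm of |w|^2 v - (v . w) w is nonnegative. *)
Lemma dotv_le_enorm v w : dotv v w <= enorm v * enorm w.
Proof.
have [->|w0] := eqVneq w 0.
  by rewrite enorm0 mulr0 -[0 as X in dotv v X](scale0r (0 : 'rV[R]_n)) dotvZr mul0r.
have ww : 0 < dotv w w by rewrite -enorm_sqr exprn_gt0// enorm_gt0.
have : 0 <= dotv (dotv w w *: v - dotv v w *: w) (dotv w w *: v - dotv v w *: w).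
  exact: dotvv_ge0.
rewrite dotvDl !dotvDr !dotvNl !dotvNr !dotvZl !dotvZr (dotvC w v).
rewrite [X in 0 <= X](_ : _ = dotv w w * (dotv v v * dotv w w - dotv v w ^+ 2)); last by ring.
rewrite pmulr_rge0// subr_ge0 -!enorm_sqr -exprMn => H.
rewrite (le_trans (ler_norm _))// -[leRHS]ger0_norm ?mulr_ge0 ?enorm_ge0//.
by rewrite -(@ler_pXn2r _ 2)// ?nnegrE// !real_normK ?num_real.
Qed.

Lemma enormD v w : enorm (v + w) <= enorm v + enorm w.
Proof.
rewrite -(@ler_pXn2r _ 2)// ?nnegrE ?addr_ge0 ?enorm_ge0//.
rewrite sqrrD !enorm_sqr dotvDl !dotvDr (dotvC w v).
have := dotv_le_enorm v w; rewrite -mulr_natr; lra.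
Qed.

Lemma enormB_ge v w : `|enorm v - enorm w| <= enorm (v - w).
Proof.
have := enormD (v - w) w; rewrite subrK => H1.
have := enormD (w - v) v; rewrite subrK -opprB enormN => H2.
rewrite ler_norml; apply/andP; split; lra.
Qed.

Lemma continuous_enorm : continuous (@enorm R n).
Proof.
move=> x; apply/(@cvgrPdist_le _ R^o _ (nbhs x) _ (@enorm R n)) => e e0.
have d0 : 0 < e / (n%:R + 1) by rewrite divr_gt0// ltr_wpDl.
have nb := near_dist_le x d0; apply: filterS nb => y.
rewrite ler_pdivlMr ?ltr_wpDl// => H.
rewrite (le_trans (enormB_ge _ _))// (le_trans (enorm_le_norm _))//.
by rewrite mulrC (le_trans _ H)// ler_wpM2l// lerDl.
Qed.

Lemma differentiable_dotvv x : differentiable (fun y => dotv y y) x /\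
  grad (fun y => dotv y y) x = 2 *: x.
Proof.
apply: (@differentiable_quadratic R n _ x (2 *: x) n%:R) => h.
rewrite dotvDl !dotvDr dotvZl (dotvC h x).
rewrite [X in `|X|](_ : _ = dotv h h); last by ring.
by rewrite (le_trans (dotv_norm_le _ _))// expr2.
Qed.

Lemma differentiable_enorm x : x != 0 -> differentiable (@enorm R n) x /\
  grad (@enorm R n) x = (enorm x)^-1 *: x.
Proof.
move=> x0; have dx0 : 0 < dotv x x by rewrite -enorm_sqr exprn_gt0// enorm_gt0.
have [d1 g1] := differentiable_dotvv x.
have ds : is_derive (dotv x x) 1 (@Num.sqrt R) (2 * Num.sqrt (dotv x x))^-1.
  exact: is_derive1_sqrt.
have d2 : differentiable (@Num.sqrt R) (dotv x x).
  by apply/derivable1_diffP; case: ds.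
have d3 : differentiable (@enorm R n) x by exact: (differentiable_comp d1 d2).
split => //; apply/rowP => i; rewrite mxE /partial deriveE// (diff_comp d1 d2)/=.
rewrite -(deriveE (delta_mx ord0 i) d1) derive_grad// g1 dotvZl.
have -> : dotv x (delta_mx ord0 i) = x ord0 i.
  rewrite /dotv (bigD1 i)//= mxE !eqxx mulr1 big1 ?addr0// => j ji.
  by rewrite mxE (negbTE ji) andbF mulr0.
rewrite deriv1E; last by case: ds.
rewrite derive1E; case: ds => _ ->; rewrite mxE /GRing.scale/= -/(enorm x).
by rewrite invfM mulrACA mulfV ?mul1r// mulrC.
Qed.

Lemma partial_compR (g : R -> R) (f : 'rV[R]_n -> R) x (g' : R) :
  differentiable f x -> is_derive (f x) 1 g g' ->
  differentiable (g \o f) x /\ grad (g \o f) x = g' *: grad f x.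
Proof.
move=> df dg; have d2 : differentiable g (f x) by apply/derivable1_diffP; case: dg.
have d3 := differentiable_comp df d2; split => //.
apply/rowP => i; rewrite !mxE /partial deriveE// (diff_comp df d2)/=.
rewrite deriv1E; last by case: dg.
by rewrite derive1E; case: dg => _ ->; rewrite /GRing.scale/= mulrC deriveE.
Qed.

End enorm.

(** * The radial profile in an annulus *)

Section annulus.
Variables (R : realType) (n : nat) (a b : R).
Local Notation Omega := (@annulus R n a b).

Lemma open_annulus : open Omega.
Proof.
rewrite (_ : Omega = @enorm R n @^-1` `]a, b[%classic).
  apply: open_comp => [x _|]; [exact: continuous_enorm|exact: interval_open].
by apply/seteqP; split => x /=; rewrite in_itv.
Qed.

Lemma closed_shell : closed [set x : 'rV[R]_n | a <= enorm x <= b].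
Proof.
rewrite (_ : [set x | _] = @enorm R n @^-1` `[a, b]%classic).
  apply: preimage_closed => [x _|]; [exact: continuous_enorm|exact: interval_closed].
by apply/seteqP; split => x /=; rewrite in_itv.
Qed.

Lemma shell_cube : [set x : 'rV[R]_n | a <= enorm x <= b] `<=` cube b.
Proof. by move=> x /= /andP[_ xb]; apply: norm_le_cube; rewrite (le_trans (norm_le_enorm x)). Qed.

Lemma compact_shell : compact [set x : 'rV[R]_n | a <= enorm x <= b].
Proof.
apply: (subclosed_compact closed_shell _ shell_cube).
by apply: rV_compact => i; exact: segment_compact.
Qed.

Lemma annulus_cube : Omega `<=` cube b.
Proof. by move=> x /andP[/ltW ax /ltW xb]; apply: shell_cube; rewrite /= ax. Qed.

Lemma closure_annulus : closure Omega `<=` [set x | a <= enorm x <= b].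
Proof.
rewrite [X in _ `<=` X](closure_id _).1; last exact: closed_shell.
by apply: closureS => x /andP[/ltW ax /ltW xb]; rewrite /= ax.
Qed.

(** The points of the closed segment are limits, along the ray, of points of
    the annulus. *)
Lemma ray_closure (e : 'rV[R]_n) t : enorm e = 1 -> 0 <= a -> a < b -> a <= t <= b ->
  closure Omega (t *: e).
Proof.
move=> e1 a0 ab /andP[at_ tb] B nB.
have cB : \forall s \near t, B (s *: e) by exact: (scalel_continuous nB).
have E s : 0 < s -> enorm (s *: e) = s by move=> s0; rewrite enormZ e1 mulr1 gtr0_norm.
have [tltb|blet] := ltP t b.
  have : \forall s \near t^'+, B (s *: e) /\ t < s < b.
    near=> s; split; first by near: s; exact: cvg_within.
    by apply/andP; split; near: s; [exact: nbhs_right_gt|exact: nbhs_right_lt].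
  move=> /filter_ex[s [Bs /andP[ts sb]]]; exists (s *: e); split => //.
  by rewrite /annulus /= E ?(le_lt_trans at_ ts) ?sb// (le_lt_trans (le_trans a0 at_)).
have tb' : t = b by apply/eqP; rewrite eq_le tb.
have : \forall s \near t^'-, B (s *: e) /\ a < s < b.
  near=> s; split; first by near: s; exact: cvg_within.
  apply/andP; split; near: s; first by apply: nbhs_left_gt; rewrite tb'.
  by rewrite -tb'; exact: nbhs_left_lt.
move=> /filter_ex[s [Bs /andP[as_ sb]]]; exists (s *: e); split => //.
by rewrite /annulus /= E ?as_// (le_lt_trans a0 as_).
Unshelve. all: by end_near. Qed.
End annulus.

Section sigpow.
Variables (R : realType) (theta : R).
Hypothesis theta0 : 0 < theta.

Lemma continuous_norm_powR (r : R) : 0 < r -> continuous (fun s : R => `|s| `^ r).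
Proof.
move=> r0 s; have [->|s0] := eqVneq s 0.
  rewrite /continuous_at normr0 powR0 ?gt_eqF//.
  apply/cvgrPdist_lt => e e0; near=> t; rewrite sub0r normrN ger0_norm ?powR_ge0//.
  have te : `|t| < e `^ r^-1.
    by rewrite -normrN -sub0r; near: t; apply: cvgr_dist_lt => //; exact: powR_gt0.
  rewrite -[ltRHS]powRr1 ?ltW// -(mulVf (lt0r_neq0 r0)) powRrM.
  by apply: gt0_ltr_powR => //; rewrite nnegrE// powR_ge0.
apply: (@continuous_comp _ _ _ (@Num.norm R R) (fun s => s `^ r)).
  exact: (@norm_continuous R R^o).
apply/differentiable_continuous/derivable1_diffP; apply: derivable_powR.
by rewrite in_itv/= normr_gt0 s0.
Unshelve. all: by end_near. Qed.

(** When 1 + theta = 1/(p-1) this is the inverse of s |-> |s|^(p-2) s. *)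
Definition sigpow (s : R) : R := s * `|s| `^ theta.

Lemma continuous_sigpow : continuous sigpow.
Proof.
move=> s; have c1 : {for s, continuous (id : R -> R)} by exact: cvg_id.
exact: (continuousM c1 (@continuous_norm_powR theta theta0 s)).
Qed.

Lemma sigpow_gt0 s : 0 < s -> 0 < sigpow s.
Proof. by move=> s0; rewrite mulr_gt0// powR_gt0// normr_gt0 gt_eqF. Qed.

Lemma sigpow_lt0 s : s < 0 -> sigpow s < 0.
Proof. by move=> s0; rewrite nmulr_rlt0// powR_gt0// normr_gt0 lt_eqF. Qed.

Lemma norm_sigpow s : `|sigpow s| = `|s| `^ (1 + theta).
Proof.
rewrite normrM [X in _ * X]ger0_norm ?powR_ge0// powRD ?powRr1//.
by rewrite gt_eqF// addr_gt0.
Qed.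
End sigpow.

Lemma continuous_in_itv (R : realType) (g : R -> R) (a b : R) :
  (forall t, a <= t <= b -> {for t, continuous g}) -> {within `[a, b], continuous g}.
Proof.
move=> cg; apply: continuous_in_subspaceT => t; rewrite inE/= in_itv/=; exact: cg.
Qed.

Lemma continuous_itv_integrable (R : realType) (g : R -> R) (a b : R) :
  (forall t, a <= t <= b -> {for t, continuous g}) ->
  (@lebesgue_measure R).-integrable `[a, b] (EFin \o g).
Proof.
by move=> cg; apply: continuous_compact_integrable;
  [exact: segment_compact|exact: continuous_in_itv].
Qed.

Lemma is_derive_primitive (R : realType) (g : R -> R) (a b : R) :
  (forall t, a <= t <= b -> {for t, continuous g}) ->
  forall t, a < t < b ->
  is_derive t 1 (fun x => \int[lebesgue_measure]_(s in `[a, x]) g s)%R (g t).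
Proof.
move=> cg t /andP[at_ tb].
have [d1 d2] := continuous_FTC1_closed tb (continuous_itv_integrable cg) at_
  (cg t (introT andP (conj (ltW at_) (ltW tb)))).
split; first exact: d1.
by rewrite -derive1E; exact: d2.
Qed.

Section profile.
Variables (R : realType) (n : nat) (theta a b : R).
Hypotheses (theta0 : 0 < theta) (ab : 0 < a < b).
Local Notation N := (n.+1%:R : R).

(** The radial component, at distance s from the origin, of the radial field of
    divergence -1 that vanishes at distance r. *)
Definition flux (r s : R) : R := (r ^+ n.+1 - s ^+ n.+1) / (N * s ^+ n).

Let a0 : 0 < a. Proof. by case/andP: ab. Qed.
Let ab' : a < b. Proof. by case/andP: ab. Qed.

Lemma flux_gt0 r s : 0 < s < r -> 0 < flux r s.
Proof.
move=> /andP[s0 sr]; rewrite divr_gt0 ?mulr_gt0 ?exprn_gt0// subr_gt0.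
by rewrite ltrXn2r ?ltW// (lt_trans s0).
Qed.

Lemma flux_lt0 r s : 0 < r < s -> flux r s < 0.
Proof.
move=> /andP[r0 rs]; have s0 := lt_trans r0 rs.
rewrite pmulr_llt0 ?invr_gt0 ?mulr_gt0 ?exprn_gt0// subr_lt0.
by rewrite ltrXn2r ?ltW.
Qed.

Lemma continuous_flux r s : 0 < s -> {for s, continuous (flux r)}.
Proof.
move=> s0.
have cX k : {for s, continuous (fun s : R => s ^+ k)} by exact: exprn_continuous.
have c1 : {for s, continuous (fun s : R => r ^+ n.+1 - s ^+ n.+1)}.
  exact: (continuousB (@cst_continuous _ _ (r ^+ n.+1) s) (cX n.+1)).
have c2 : {for s, continuous (fun s : R => N * s ^+ n)}.
  exact: (continuousM (@cst_continuous _ _ N s) (cX n)).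
have c3 : {for s, continuous (fun s : R => (N * s ^+ n)^-1)}.
  by apply: continuousV => //; rewrite gt_eqF// mulr_gt0// exprn_gt0.
exact: (continuousM c1 c3).
Qed.

Lemma continuous_flux1 r s : {for r, continuous (flux ^~ s)}.
Proof.
have cX k : {for r, continuous (fun s : R => s ^+ k)} by exact: exprn_continuous.
have c1 : {for r, continuous (fun r : R => r ^+ n.+1 - s ^+ n.+1)}.
  exact: (continuousB (cX n.+1) (@cst_continuous _ _ (s ^+ n.+1) r)).
exact: (continuousM c1 (@cst_continuous _ _ (N * s ^+ n)^-1 r)).
Qed.

(** The radial derivative whose p-Laplacian flux is [flux]. *)
Definition slope (r s : R) : R := sigpow theta (flux r s).

Lemma continuous_slope r s : 0 < s -> {for s, continuous (slope r)}.
Proof.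
move=> s0; apply: (continuous_comp (continuous_flux s0)).
exact: continuous_sigpow.
Qed.

Lemma continuous_slope1 r s : {for r, continuous (slope ^~ s)}.
Proof.
have c1 : {for r, continuous (flux ^~ s)} by exact: continuous_flux1.
apply: (continuous_comp c1); exact: continuous_sigpow.
Qed.

(** Starting at a / 2 rather than at a keeps both ends of [a, b] in the open
    interval where [prim r] is differentiable. *)
Definition prim (r t : R) : R := (\int[lebesgue_measure]_(s in `[(a / 2)%R, t]) slope r s)%R.

Let a20 : 0 < a / 2. Proof. by rewrite divr_gt0. Qed.
Let a2a : a / 2 < a. Proof. by rewrite ltr_pdivrMr// ltr_pMr// ltr1n. Qed.

Lemma is_derive_prim r t : a / 2 < t -> is_derive t 1 (prim r) (slope r t).
Proof.
move=> at_; apply: (@is_derive_primitive _ _ _ (t + 1)); last by rewrite at_/= ltrDl ltr01.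
by move=> s /andP[as_ _]; apply: continuous_slope; rewrite (lt_le_trans _ as_).
Qed.

Lemma continuous_prim r t : a / 2 < t -> {for t, continuous (prim r)}.
Proof.
move=> at_; apply/differentiable_continuous/derivable1_diffP.
by case: (is_derive_prim r at_).
Qed.

Lemma slope_bound r s : 0 <= r <= b + 1 -> a / 2 <= s <= b + 1 ->
  `|slope r s| <= ((b + 1) ^+ n.+1 / (N * (a / 2) ^+ n)) `^ (1 + theta).
Proof.
move=> /andP[r0 rb] /andP[as_ sb]; rewrite norm_sigpow//.
have s0 : 0 < s by rewrite (lt_le_trans _ as_).
have b10 : 0 <= b + 1 by rewrite addr_ge0// ltW// (lt_trans a0).
apply: ge0_ler_powR; rewrite ?nnegrE ?addr_ge0 ?(ltW theta0)//.
  by rewrite divr_ge0 ?exprn_ge0// mulr_ge0// exprn_ge0// ltW.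
rewrite normrM [X in _ * X]ger0_norm ?invr_ge0 ?mulr_ge0 ?exprn_ge0 ?(ltW s0)//.
apply: ler_pM => //; first by rewrite invr_ge0 mulr_ge0// exprn_ge0// ltW.
  have H x : 0 <= x <= b + 1 -> 0 <= x ^+ n.+1 <= (b + 1) ^+ n.+1.
    by move=> /andP[x0 xb]; rewrite exprn_ge0//= lerXn2r.
  have /andP[h1 h2] := H r (introT andP (conj r0 rb)).
  have /andP[h3 h4] := H s (introT andP (conj (ltW s0) sb)).
  rewrite ler_norml; apply/andP; split; lra.
rewrite lef_pV2 ?posrE ?mulr_gt0 ?exprn_gt0//.
by rewrite ler_wpM2l// lerXn2r// ?nnegrE ltW.
Qed.

(** Continuity in r of an integral whose integrand is dominated uniformly in
    r. *)
Lemma continuous_prim1 r t : 0 < r < b + 1 -> t <= b + 1 ->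
  {for r, continuous (prim ^~ t)}.
Proof.
move=> r_in tb.
apply: (@continuity_under_integral R _ _ (@lebesgue_measure R) slope `[a / 2, t]
  _ 0 (b + 1) _ _ (cst (((b + 1) ^+ n.+1 / (N * (a / 2) ^+ n)) `^ (1 + theta)))).
- exact: measurable_itv.
- move=> x _; apply: continuous_itv_integrable => s /andP[as_ _].
  by apply: continuous_slope; rewrite (lt_le_trans _ as_).
- by apply: aeW => s _ x _; exact: continuous_slope1.
- by apply: continuous_itv_integrable => s _; exact: cst_continuous.
- move=> x; rewrite /= in_itv/= => /andP[x0 xb]; apply: aeW => s; rewrite /= in_itv/=.
  by move=> /andP[s1 s2]; apply: slope_bound; rewrite ?s1 ?(le_trans s2)// !ltW.
- by rewrite inE/= in_itv/=.
Qed.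

Let prim_lt r (s t : R) : a / 2 < s -> s < t ->
  (forall x, s < x < t -> 0 < slope r x) -> prim r s < prim r t.
Proof.
move=> as_ st sl.
have d x : s <= x <= t -> is_derive x 1 (prim r) (slope r x).
  by move=> /andP[sx _]; apply: is_derive_prim; rewrite (lt_le_trans as_).
apply: (@gtr0_derive1_lt_cc _ _ s t) => //.
- by move=> x; rewrite in_itv/= => /andP[/ltW ? /ltW ?]; case: (d x _); first exact/andP.
- move=> x; rewrite in_itv/= => sxt; rewrite derive1E.
  have /andP[/ltW s1 /ltW s2] := sxt.
  by case: (d x _) => [|_ ->]; [exact/andP|exact: sl].
- apply: continuous_in_itv => x /andP[sx _].
  by apply: continuous_prim; rewrite (lt_le_trans as_).
- by rewrite in_itv/= lexx ltW.
- by rewrite in_itv/= lexx ltW.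
Qed.

Let prim_gt r (s t : R) : a / 2 < s -> s < t ->
  (forall x, s < x < t -> slope r x < 0) -> prim r t < prim r s.
Proof.
move=> as_ st sl.
have d x : s <= x <= t -> is_derive x 1 (prim r) (slope r x).
  by move=> /andP[sx _]; apply: is_derive_prim; rewrite (lt_le_trans as_).
apply: (@ltr0_derive1_lt_cc _ _ s t) => //.
- by move=> x; rewrite in_itv/= => /andP[/ltW ? /ltW ?]; case: (d x _); first exact/andP.
- move=> x; rewrite in_itv/= => sxt; rewrite derive1E.
  have /andP[/ltW s1 /ltW s2] := sxt.
  by case: (d x _) => [|_ ->]; [exact/andP|exact: sl].
- apply: continuous_in_itv => x /andP[sx _].
  by apply: continuous_prim; rewrite (lt_le_trans as_).
- by rewrite in_itv/= lexx ltW.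
- by rewrite in_itv/= lexx ltW.
Qed.

Lemma slope_gt0 r s : 0 < s < r -> 0 < slope r s.
Proof. by move=> H; apply: sigpow_gt0 => //; exact: flux_gt0. Qed.

Lemma slope_lt0 r s : 0 < r < s -> slope r s < 0.
Proof. by move=> H; apply: sigpow_lt0 => //; exact: flux_lt0. Qed.

(** The increment of [prim r] from a to b depends continuously on r. It is
    negative for r = a, where the slope is negative on ]a, b], and positive
    for r = b, where the slope is positive on [a, b[. *)
Lemma exists_crit : exists2 r0, a < r0 < b & prim r0 b = prim r0 a.
Proof.
pose Phi r := prim r b - prim r a.
have b1 : b <= b + 1 by rewrite lerDl.
have cPhi : {within `[a, b], continuous Phi}.
  apply: continuous_in_itv => r /andP[ar rb].
  have r01 : 0 < r < b + 1 by rewrite (lt_le_trans a0)//= (le_lt_trans rb)// ltrDl.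
  by apply: (continuousB (continuous_prim1 r01 b1)); apply: continuous_prim1 => //;
    rewrite (le_trans (ltW ab')).
have Pa : Phi a < 0.
  rewrite subr_lt0; apply: prim_gt => // x /andP[ax _]; apply: slope_lt0.
  by rewrite a0.
have Pb : 0 < Phi b.
  rewrite subr_gt0; apply: prim_lt => // x /andP[ax xb]; apply: slope_gt0.
  by rewrite xb (lt_trans a0).
(* from here on Phi is only known through its values at a, b and its zeros *)
have PhiE r : Phi r = 0 -> prim r b = prim r a.
  by move=> H; apply/eqP; rewrite -subr_eq0; apply/eqP.
clearbody Phi.
have [|r] := IVT (v := 0) (ltW ab') cPhi.
  by rewrite ge_min le_max (ltW Pa) (ltW Pb) orbT.
rewrite in_itv/= => /andP[ar rb] P0; exists r; last exact: PhiE.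
rewrite !lt_neqAle ar rb !andbT; apply/andP; split; apply/eqP => E.
  by move: Pa; rewrite E P0 ltxx.
by move: Pb; rewrite -E P0 ltxx.
Qed.

Definition profile (r t : R) : R := prim r t - prim r a.

(** The profile increases before r, decreases after r and vanishes at a and at
    b. *)
Lemma profile_gt0 r t : a < r < b -> prim r b = prim r a -> a < t < b ->
  0 < profile r t.
Proof.
move=> /andP[ar rb] E /andP[at_ tb]; rewrite subr_gt0.
have [tr|rt] := leP t r.
  apply: prim_lt => // x /andP[ax xt]; apply: slope_gt0.
  by rewrite (lt_trans a0)//= (lt_le_trans xt).
rewrite -E; apply: prim_gt => //; first exact: lt_trans at_.
by move=> x /andP[tx xb]; apply: slope_lt0; rewrite (lt_trans a0)//= (lt_trans rt).
Qed.

Lemma is_derive_profile r t : a / 2 < t -> is_derive t 1 (profile r) (slope r t).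
Proof.
move=> /(is_derive_prim r) d.
by apply: is_derive_eq; rewrite subr0.
Qed.

End profile.

(** * A radial field of divergence -1 *)

Lemma near_continuous (T U : topologicalType) (f g : T -> U) x :
  (\forall y \near x, f y = g y) -> {for x, continuous f} -> {for x, continuous g}.
Proof.
move=> fg cf; suff : g @ x --> g x by [].
have <- : f x = g x := nbhs_singleton fg.
exact: cvg_trans (near_eq_cvg fg) cf.
Qed.

Lemma differentiable_expr (R : realType) n (f : 'rV[R]_n -> R) k x :
  differentiable f x -> differentiable (fun y => f y ^+ k) x.
Proof.
move=> df; elim: k => [|k IH]; first exact: differentiable_cst.
by under eq_fun do rewrite exprS; exact: differentiableM.
Qed.

Section field.
Variables (R : realType) (n : nat) (r : R).
Local Notation N := (n.+1%:R : R).
Local Notation V := 'rV[R]_n.+1.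
Local Notation mu := (lebesgue_rV R n.+1).

(** The radial field of component [flux r] is this factor times x, which
    avoids dividing by |x|. *)
Definition fluxdiv (s : R) : R := N^-1 * (r ^+ n.+1 * (s ^+ n.+1)^-1 - 1).

Lemma fluxdivE s : s != 0 -> flux n r s = fluxdiv s * s.
Proof.
move=> s0; rewrite /flux /fluxdiv !exprS; field.
by rewrite expf_neq0 ?s0 ?pnatr_eq0//= addrC natr1 pnatr_eq0.
Qed.

Lemma is_derive_fluxdiv (s : R) : s != 0 ->
  is_derive s 1 fluxdiv (- (r ^+ n.+1 / s ^+ n.+2)).
Proof.
move=> s0.
have sn0 k : s ^+ k != 0 by rewrite expf_neq0.
have d1 : is_derive s (1:R) (fun s : R => s ^+ n.+1) (n.+1%:R * s ^+ n).
  have := exp_derive n.+1 s (1:R); have := @exprn_derivable R n.+1 s (1:R).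
  by move=> d1 d2; split => //; rewrite d2 /= [_ *: _]mulr1.
have d2 := @is_deriveV R (fun s : R => s ^+ n.+1) s _ 1 (sn0 n.+1) d1.
have d3 : is_derive s (1:R) (fun s : R => r ^+ n.+1 * (s ^+ n.+1)^-1 - 1)
    (r ^+ n.+1 * (- (s ^+ n.+1) ^- 2 * (n.+1%:R * s ^+ n))).
  have := is_deriveB (is_deriveZ (r ^+ n.+1) d2) (is_derive_cst (1 : R) s (1 : R)).
  by rewrite subr0.
apply: (is_derive_eq (is_deriveZ N^-1 d3)).
rewrite /GRing.scale/= !exprS; field.
by rewrite sn0 s0 addrC natr1 pnatr_eq0.
Qed.

Definition field (i : 'I_n.+1) (x : V) : R := fluxdiv (enorm x) * x ord0 i.

Let D i (x : V) : R :=
  fluxdiv (enorm x) + x ord0 i ^+ 2 * (- (r ^+ n.+1 / enorm x ^+ n.+2) * (enorm x)^-1).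

Let sumD x : x != 0 -> \sum_i D i x = -1.
Proof.
move=> x0; rewrite big_split/= sumr_const card_ord -mulr_suml.
have -> : \sum_(i < n.+1) x ord0 i ^+ 2 = enorm x ^+ 2.
  by rewrite enorm_sqr; apply: eq_bigr => i _; rewrite expr2.
have e0 : enorm x != 0 by rewrite enorm_eq0.
have en0 k : enorm x ^+ k != 0 by rewrite expf_neq0.
rewrite /fluxdiv -mulr_natl !exprS; field.
by rewrite e0 en0 addrC natr1 pnatr_eq0.
Qed.

Lemma differentiable_fluxdiv (x : V) : x != 0 ->
  differentiable (fun y : V => fluxdiv (enorm y)) x /\
  forall i, partial i (fun y : V => fluxdiv (enorm y)) x =
    - (r ^+ n.+1 / enorm x ^+ n.+2) * ((enorm x)^-1 * x ord0 i).
Proof.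
move=> x0; have e0 : enorm x != 0 by rewrite enorm_eq0.
have [d1 g1] := differentiable_enorm x0.
have [d2 g2] := partial_compR d1 (is_derive_fluxdiv e0).
split => // i; have := congr1 (fun v : V => v ord0 i) g2.
by rewrite g1 !mxE.
Qed.

Lemma differentiable_field i (x : V) : x != 0 -> differentiable (field i) x.
Proof.
move=> x0; apply: differentiableM; last exact: differentiable_coord.
exact: (differentiable_fluxdiv x0).1.
Qed.

Let partial_field i (x : V) : x != 0 -> partial i (field i) x = D i x.
Proof.
move=> x0; have [d1 p1] := differentiable_fluxdiv x0.
have dc : differentiable (fun y : V => y ord0 i) x by exact: differentiable_coord.
have pc : 'D_(delta_mx ord0 i) (fun y : V => y ord0 i) x = 1.
  have [] := @differentiable_quadratic R n.+1 (fun y : V => y ord0 i) x (delta_mx ord0 i) 0.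
    move=> h; rewrite mul0r !mxE addrK.
    rewrite (_ : dotv _ _ = h ord0 i) ?subrr ?normr0//.
    rewrite /dotv (bigD1 i)//= mxE !eqxx mul1r big1 ?addr0// => j ji.
    by rewrite mxE (negbTE ji) andbF mul0r.
  move=> _ /(congr1 (fun v : V => v ord0 i)); rewrite !mxE !eqxx; exact.
rewrite /partial /field deriveM; [|exact: diff_derivable|exact: diff_derivable].
rewrite pc -/(partial i (fun y : V => fluxdiv (enorm y)) x) p1 /D /GRing.scale/=.
by rewrite mulr1; congr (_ + _); ring.
Qed.

Let continuous_fluxdiv (x : V) : x != 0 -> {for x, continuous (fun y : V => fluxdiv (enorm y))}.
Proof. by move=> x0; apply/differentiable_continuous; exact: (differentiable_fluxdiv x0).1. Qed.

Lemma continuous_field i (x : V) : x != 0 -> {for x, continuous (field i)}.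
Proof. by move=> x0; apply/differentiable_continuous; exact: differentiable_field. Qed.

Let continuous_D i (x : V) : x != 0 -> {for x, continuous (D i)}.
Proof.
move=> x0; have e0 : enorm x != 0 by rewrite enorm_eq0.
have ce : {for x, continuous (@enorm R n.+1)} by exact: continuous_enorm.
have c1 : {for x, continuous (fun y : V => y ord0 i ^+ 2)}.
  by apply/differentiable_continuous; apply: differentiable_expr; exact: differentiable_coord.
have c2 : {for x, continuous (fun y : V => - (r ^+ n.+1 / enorm y ^+ n.+2) * (enorm y)^-1)}.
  have d1 := (differentiable_enorm x0).1.
  apply/differentiable_continuous; apply: differentiableM; last exact: differentiableV.
  apply: differentiableN; apply: differentiableM; first exact: differentiable_cst.
  apply: differentiableV; last by rewrite expf_neq0.
  exact: differentiable_expr.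
exact: (continuousD (continuous_fluxdiv x0) (continuousM c1 c2)).
Qed.

(** The field times phi is a C^1 field with compact support, so its divergence
    has integral 0; and the divergence of the field alone is -1 ([sumD]). *)
Lemma field_weak (a b : R) (phi : V -> R) : 0 < a -> test_function (annulus a b) phi ->
  (\int[mu]_(x in annulus a b) (\sum_i field i x * partial i phi x)%:E =
   \int[mu]_(x in annulus a b) (phi x)%:E)%E.
Proof.
move=> a0 [sphi cphi supp].
set U := annulus a b in supp *.
have U0 x : U x -> x != 0.
  by move=> /andP[ax _]; rewrite -enorm_gt0 (lt_trans a0).
have oU : open U by exact: open_annulus.
have dphi x : differentiable phi x by exact: (sphi [::] x (mem_set I)).
have dpphi i x : differentiable (partial i phi) x by exact: (sphi [:: i] x (mem_set I)).
have cphi0 : continuous phi by move=> x; exact/differentiable_continuous.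
have cpphi i : continuous (partial i phi) by move=> x; exact/differentiable_continuous.
have nsupp x : ~ U x -> \forall y \near x, phi y = 0.
  move=> nU; have oC : open (~` closure [set x | phi x != 0]).
    exact/closed_openC/closed_closure.
  have : nbhs x (~` closure [set x | phi x != 0]).
    by apply: open_nbhs_nbhs; split => // /supp.
  apply: filterS => y ny; apply/eqP; apply: contrapT => /negP py; apply: ny.
  exact: subset_closure.
pose g i x := field i x * phi x.
have ng i x : ~ U x -> \forall y \near x, (0 : R) = g i y.
  by move=> /nsupp; apply: filterS => y py; rewrite /g py mulr0.
have pgE i x : U x -> partial i (g i) x = D i x * phi x + field i x * partial i phi x.
  move=> /U0 x0; rewrite /partial /g deriveM; last 2 first.
    by apply: diff_derivable; exact: differentiable_field.
    exact: diff_derivable.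
  rewrite -/(partial i (field i) x) partial_field// addrC [RHS]/=; congr (_ + _).
  exact: mulrC.
have pg0 i x : ~ U x -> partial i (g i) x = 0.
  by move=> /(ng i) H; apply: partial_eq0; apply: filterS H => y ->.
have dg i x : derivable (g i) x (delta_mx ord0 i).
  have [Ux|/(ng i) nUx] := pselect (U x).
    apply: diff_derivable; apply: differentiableM => //; apply: differentiable_field.
    exact: U0.
  by apply: (near_eq_derivable nUx); exact: derivable_cst.
have cpg i : continuous (partial i (g i)).
  move=> x; have [Ux|nUx] := pselect (U x).
    apply: (@near_continuous _ _ (fun x => D i x * phi x + field i x * partial i phi x)).
      have nU : nbhs x U by exact: open_nbhs_nbhs.
      by apply: filterS nU => y /pgE ->.
    exact: (continuousD (continuousM (continuous_D (U0 _ Ux)) (@cphi0 x))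
      (continuousM (continuous_field (U0 _ Ux)) (@cpphi i x))).
  apply: (@near_continuous _ _ (cst 0)); last exact: cst_continuous.
  have nn := near_join (nsupp x nUx).
  apply: filterS nn => y ny; rewrite partial_eq0//.
  by apply: filterS ny => z pz; rewrite /g pz mulr0.
have g0 i x : b < `|x| -> g i x = 0.
  move=> bx; have nU : ~ U x.
    move=> /andP[_]; have := norm_le_enorm x; move=> H1 H2.
    by move: (lt_le_trans bx H1); rewrite ltNge (ltW H2).
  by rewrite -(nbhs_singleton (ng i x nU)).
have Ig i := integral_partial (dg i) (cpg i) (g0 i).
have pg0b i x : b < `|x| -> partial i (g i) x = 0.
  by move=> /norm_lt_near H; apply: partial_eq0; apply: filterS H => y /g0.
have ig i : mu.-integrable setT (EFin \o partial i (g i)).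
  have [C gC] := continuous_compact_bounded (cpg i) (pg0b i).
  apply: (@bounded_integrable_rVT _ _ b C) => // [|x /pg0b //].
  by apply: continuous_measurable_rV => [|x _]; [exact: openT|exact: cpg].
have mU : measurable U by exact: open_measurable_rV.
have H : (\int[mu]_(x in U) (\sum_i partial i (g i) x) = 0)%R.
  rewrite Rintegral_mkcond.
  rewrite (_ : _ \_ _ = fun x => \sum_i partial i (g i) x).
    by rewrite Rintegral_sum// big1// => i _; rewrite /Rintegral Ig.
  apply/funext => x; rewrite /patch; case: ifPn => //; rewrite notin_setE => nU.
  by rewrite big1// => i _; rewrite pg0.
have iphi : mu.-integrable U (EFin \o phi).
  have phi0 x : b < `|x| -> phi x = 0.
    move=> bx; apply: nbhs_singleton (nsupp x _) => /andP[_ xb].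
    by move: (lt_le_trans bx (norm_le_enorm x)); rewrite ltNge (ltW xb).
  have [C pC] := continuous_compact_bounded cphi0 phi0.
  apply: (@bounded_integrable_rV _ _ U b C) => //; first exact: annulus_cube.
  by apply: continuous_measurable_rV => // x _; exact: cphi0.
have iS : mu.-integrable U (EFin \o (fun x => \sum_i partial i (g i) x)).
  by apply: integrable_sumR => // i; exact: (integrableS measurableT mU _ (ig i)).
have SE x : U x -> \sum_i field i x * partial i phi x =
    \sum_i partial i (g i) x + phi x.
  move=> Ux; rewrite (eq_bigr _ (fun i _ => pgE i x Ux)) big_split/= -mulr_suml.
  by rewrite sumD ?U0// mulN1r addrAC addNr add0r.
transitivity ((\int[mu]_(x in U) (\sum_i partial i (g i) x)%:E +
   \int[mu]_(x in U) (phi x)%:E)%E).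
  rewrite -(integralD mU iS iphi); apply: eq_integral => x /set_mem Ux.
  by rewrite SE.
rewrite -[X in (X + _ = _)%E](fineK (integrable_fin_num mU iS)).
by rewrite [fine _]H add0e.
Qed.

End field.

(** * The flux of the p-Laplacian and a truncation *)

Section plaplace.
Variables (R : realType) (n : nat) (p : R).
Hypothesis p12 : 1 < p < 2.
Implicit Types xi eta : 'rV[R]_n.

(** The p-Laplacian of f is the divergence of [pflux] of its gradient. *)
Definition pflux xi : 'rV[R]_n := enorm xi `^ (p - 2) *: xi.

Let p1 : 1 < p. Proof. by case/andP: p12. Qed.
Let p2 : p < 2. Proof. by case/andP: p12. Qed.

Lemma enorm_pflux xi : enorm (pflux xi) = enorm xi `^ (p - 1).
Proof.
rewrite enormZ ger0_norm ?powR_ge0//.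
rewrite mulrC (_ : p - 2 = p - 1 - 1); last by ring.
by rewrite mulr_powRB1 ?enorm_ge0// subr_gt0.
Qed.

(** By Cauchy-Schwarz the product is at least (s^(p-1) - t^(p-1)) (s - t),
    where s and t are the norms of xi and eta. This is nonnegative, and
    vanishes only if s = t; the original product is then a multiple of s^2 -
    xi . eta, so that its vanishing gives xi = eta. *)
Lemma pflux_monotone xi eta : 0 <= dotv (pflux xi - pflux eta) (xi - eta) /\
  (dotv (pflux xi - pflux eta) (xi - eta) = 0 -> xi = eta).
Proof.
set s := enorm xi; set t := enorm eta.
have s0 : 0 <= s by exact: enorm_ge0.
have t0 : 0 <= t by exact: enorm_ge0.
have pp : 0 < p - 1 by rewrite subr_gt0.
have E z : 0 <= z -> z `^ (p - 2) * z = z `^ (p - 1).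
  move=> z0; rewrite mulrC (_ : p - 2 = p - 1 - 1); last by ring.
  by rewrite mulr_powRB1.
have dE : dotv (pflux xi - pflux eta) (xi - eta) =
    s `^ (p - 1) * s + t `^ (p - 1) * t - (s `^ (p - 2) + t `^ (p - 2)) * dotv xi eta.
  rewrite dotvDl !dotvDr !dotvNl !dotvNr /pflux !dotvZl (dotvC eta xi).
  by rewrite -!enorm_sqr -/s -/t -(E s)// -(E t)//; ring.
have CS := dotv_le_enorm xi eta; rewrite -/s -/t in CS.
have cc : 0 <= s `^ (p - 2) + t `^ (p - 2) by rewrite addr_ge0// powR_ge0.
have H : (s `^ (p - 1) - t `^ (p - 1)) * (s - t) <=
    dotv (pflux xi - pflux eta) (xi - eta).
  rewrite dE; have := ler_wpM2l cc CS; have := E s s0; have := E t t0.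
  have -> : (s `^ (p - 2) + t `^ (p - 2)) * (s * t) =
    s `^ (p - 2) * s * t + t `^ (p - 2) * t * s by ring.
  by move=> -> ->; lra.
have M : 0 <= (s `^ (p - 1) - t `^ (p - 1)) * (s - t).
  have [st|ts] := leP s t.
    by rewrite mulr_le0// subr_le0// ge0_ler_powR// ltW.
  by rewrite mulr_ge0// subr_ge0 ?ltW// gt0_ltr_powR.
split; first exact: le_trans H.
move=> D0; rewrite D0 in H.
have st : s = t.
  apply/eqP; rewrite eq_le !leNgt; apply/andP; split; apply/negP => lt.
    have : 0 < (s `^ (p - 1) - t `^ (p - 1)) * (s - t).
      by rewrite mulr_gt0// subr_gt0// gt0_ltr_powR.
    by rewrite ltNge H.
  have : 0 < (s `^ (p - 1) - t `^ (p - 1)) * (s - t).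
    by rewrite nmulr_rgt0 subr_lt0// gt0_ltr_powR.
  by rewrite ltNge H.
move: D0; rewrite dE -st -!E//.
have [s00|sn0] := eqVneq s 0.
  move=> _; have /eqP -> : xi == 0 by rewrite -enorm_eq0 -/s s00.
  by apply/esym/eqP; rewrite -enorm_eq0 -/t -st s00.
have sp : 0 < s by rewrite lt_neqAle eq_sym sn0.
have P0 : s `^ (p - 2) != 0 by rewrite gt_eqF// powR_gt0.
move=> D0.
have {}D0 : s ^+ 2 = dotv xi eta.
  apply: (mulfI P0); apply/eqP; rewrite -subr_eq0; apply/eqP.
  by apply: (@mulfI _ 2) => //; rewrite mulr0 -[RHS]D0; ring.
apply/eqP; rewrite -subr_eq0 -enorm_eq0 -sqrf_eq0 enorm_sqr.
rewrite dotvDl !dotvDr !dotvNl !dotvNr (dotvC eta xi) -!enorm_sqr -/s -/t -D0 st.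
by apply/eqP; ring.
Qed.

(** The factor |xi|^(p-2) is unbounded near 0, but the norm of [pflux xi] is
    |xi|^(p-1), which tends to 0. *)
Lemma continuous_pflux i : continuous (fun xi => pflux xi ord0 i).
Proof.
move=> xi; have pp : 0 < p - 1 by rewrite subr_gt0.
have cp : continuous (fun xi : 'rV[R]_n => enorm xi `^ (p - 1)).
  move=> z; have ce : {for z, continuous (@enorm R n)} by exact: continuous_enorm.
  have := continuous_comp ce (@continuous_norm_powR R (p - 1) pp (enorm z)).
  rewrite (_ : _ \o _ = fun xi : 'rV[R]_n => enorm xi `^ (p - 1)) //.
  by apply/funext => y /=; rewrite ger0_norm ?enorm_ge0.
have [->|xi0] := eqVneq xi 0.
  have E0 : enorm (0 : 'rV[R]_n) `^ (p - 1) = 0 by rewrite enorm0 powR0 ?gt_eqF.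
  suff : (fun z => pflux z ord0 i) @ (0 : 'rV[R]_n) --> pflux 0 ord0 i by [].
  rewrite /pflux scaler0 mxE.
  apply/(@cvgrPdist_le _ R^o _ (nbhs (0 : 'rV[R]_n)) _ (fun z => pflux z ord0 i)) => e e0.
  have nb : \forall y \near (0 : 'rV[R]_n), `|enorm (0 : 'rV[R]_n) `^ (p - 1) -
      enorm y `^ (p - 1)| <= e.
    exact: (@cvgr_dist_le _ R^o _ (nbhs (0 : 'rV[R]_n)) _ _ _ (cp 0) e e0).
  apply: filterS nb => y; rewrite E0 !sub0r !normrN => H.
  rewrite (le_trans (coord_enorm _ _))// enorm_pflux (le_trans _ H)//.
  exact: ler_norm.
have ce : {for xi, continuous (@enorm R n)} by exact: continuous_enorm.
have c2 : {for enorm xi, continuous (fun s : R => s `^ (p - 2))}.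
  apply/differentiable_continuous/derivable1_diffP; apply: derivable_powR.
  by rewrite in_itv/= enorm_gt0 xi0.
have c3 : {for xi, continuous (fun z : 'rV[R]_n => z ord0 i)}.
  by apply/differentiable_continuous; exact: differentiable_coord.
have := continuousM (continuous_comp ce c2) c3.
rewrite (_ : _ \* _ = fun xi : 'rV[R]_n => pflux xi ord0 i) //.
by apply/funext => y /=; rewrite mxE.
Qed.

End plaplace.

Section truncation.
Variable R : realType.
Implicit Types (t e : R).

Definition pos2 t : R := Num.max 0 t ^+ 2.

Lemma is_derive_pos2 t : is_derive t 1 pos2 (2 * Num.max 0 t).
Proof.
have [t0|t0|t0] := ltgtP 0 t.
- have nE : \forall s \near t, s ^+ 2 = pos2 s.
    near=> s; rewrite /pos2 max_r// ltW//; near: s; exact: lt_nbhsr.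
  apply: (@near_eq_is_derive _ R^o R^o _ _ _ _ _ nE).
  split; first exact: exprn_derivable.
  by rewrite exp_derive /= [_ *: 1]mulr1 expr1.
- have nE : \forall s \near t, 0 = pos2 s.
    by near=> s; rewrite /pos2 max_l ?expr0n// ltW//; near: s; exact: lt_nbhsl.
  apply: (@near_eq_is_derive _ R^o R^o (fun=> 0) _ _ _ _ nE).
  by rewrite mulr0; exact: is_derive_cst.
- rewrite mulr0 -t0.
  have H : (fun h : R => h^-1 *: ((pos2 \o shift 0) (h *: 1) - pos2 0)) @ 0^' --> (0 : R).
    apply: (@cvg_within_filter _ _ _ (nbhs (0 : R))).
    apply/cvgrPdist_le => e e0; near=> h.
    rewrite sub0r normrN /= addr0 [h *: 1]mulr1 /pos2 maxxx expr0n/= subr0.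
    have he : `|h| <= e.
      by rewrite -normrN -sub0r; near: h; apply: cvgr_dist_le.
    have [h0|h0] := leP h 0; first by rewrite expr0n/= scaler0 normr0 ltW.
    by rewrite /GRing.scale/= expr2 mulrA mulVf ?mul1r// gt_eqF.
  by split; [apply/cvg_ex; exists 0|exact/cvg_lim].
Unshelve. all: by end_near. Qed.

(** An odd function of t that is 0 on [-e, e] and C^1 with positive derivative
    outside. The positive part of |t| - e would have the same zeros but is not
    C^1. *)
Definition trunc e t : R := t * pos2 (t ^+ 2 - e ^+ 2).
Definition dtrunc e t : R :=
  pos2 (t ^+ 2 - e ^+ 2) + 4 * t ^+ 2 * Num.max 0 (t ^+ 2 - e ^+ 2).

Lemma is_derive_trunc e t : is_derive t 1 (trunc e) (dtrunc e t).
Proof.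
have d1 : is_derive t (1 : R) (fun t => t ^+ 2 - e ^+ 2) (2 * t).
  have dX : is_derive t (1 : R) (fun t : R => t ^+ 2) (2 * t).
    split; first exact: exprn_derivable.
    by rewrite exp_derive /= [_ *: 1]mulr1 expr1.
  have := is_deriveB dX (is_derive_cst (e ^+ 2) t (1 : R)).
  by rewrite subr0.
have d2 := @is_derive1_comp R pos2 (fun t => t ^+ 2 - e ^+ 2) t _ _ (is_derive_pos2 _) d1.
apply: (is_derive_eq (is_deriveM (is_derive_id t (1 : R)) d2)).
by rewrite /dtrunc /GRing.scale/=; ring.
Qed.

Lemma dtrunc_ge0 e t : 0 <= dtrunc e t.
Proof.
rewrite addr_ge0//; first exact: sqr_ge0.
by apply: mulr_ge0; rewrite ?le_max ?lexx// mulr_ge0// sqr_ge0.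
Qed.

Lemma dtrunc_gt0 e t : 0 <= e -> e < `|t| -> 0 < dtrunc e t.
Proof.
move=> e0 et; have H : 0 < t ^+ 2 - e ^+ 2.
  by rewrite subr_gt0 -(@real_normK _ t)// ?num_real// ltrXn2r.
rewrite ltr_pwDl//; last first.
  by apply: mulr_ge0; rewrite ?le_max ?lexx// mulr_ge0// sqr_ge0.
by rewrite /pos2 max_r ?(ltW H)// exprn_gt0.
Qed.

Lemma trunc_eq0 e t : 0 <= e -> `|t| <= e -> trunc e t = 0.
Proof.
move=> e0 te; rewrite /trunc /pos2 max_l ?expr0n ?mulr0//.
by rewrite subr_le0 -(@real_normK _ t)// ?num_real// lerXn2r.
Qed.

Lemma continuous_dtrunc e : continuous (dtrunc e).
Proof.
have cX : continuous (fun t : R => t ^+ 2 - e ^+ 2).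
  move=> t; have c1 : {for t, continuous (fun t : R => t ^+ 2)} by exact: exprn_continuous.
  exact: (continuousB c1 (@cst_continuous _ _ (e ^+ 2) t)).
have cm : continuous (fun t : R => Num.max 0 (t ^+ 2 - e ^+ 2)).
  by move=> t; exact: (continuous_max (@cst_continuous _ _ (0 : R) t) (cX t)).
move=> t; have c1 : {for t, continuous (fun t : R => t ^+ 2)} by exact: exprn_continuous.
have c4 := continuousM (@cst_continuous _ _ (4 : R) t) c1.
exact: (continuousD (continuousM (cm t) (cm t)) (continuousM c4 (cm t))).
Qed.

End truncation.

(** * Functions vanishing on the boundary of the annulus *)

Section rays.
Variables (R : realType) (n : nat) (a b : R) (v : 'rV[R]_n -> R).
Local Notation V := 'rV[R]_n.
Local Notation Omega := (@annulus R n a b).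
Hypotheses (ab : 0 < a < b) (cv : {within closure Omega, continuous v})
  (dv : {in Omega, forall x, differentiable v x})
  (v0 : forall x, (closure Omega `\` Omega) x -> v x = 0).

Let a0 : 0 < a. Proof. by case/andP: ab. Qed.
Let ab' : a < b. Proof. by case/andP: ab. Qed.

Lemma annulus_dir (x : V) : Omega x ->
  exists2 e, enorm e = 1 & x = enorm x *: e.
Proof.
move=> /andP[ax _]; have x0 : enorm x != 0 by rewrite gt_eqF// (lt_trans a0).
exists ((enorm x)^-1 *: x); last by rewrite scalerA mulfV// scale1r.
by rewrite enormZ ger0_norm ?invr_ge0 ?enorm_ge0// mulVf.
Qed.

Lemma annulus_ray (e : V) t : enorm e = 1 -> a < t < b -> Omega (t *: e).
Proof.
move=> e1 /andP[at_ tb]; have t0 : 0 < t by rewrite (lt_trans a0).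
by rewrite /annulus /= enormZ e1 mulr1 gtr0_norm// at_.
Qed.

Section ray.
Variables (e : V).
Hypothesis e1 : enorm e = 1.
Let l (t : R) := v (t *: e).

Lemma ray_continuous : {within `[a, b], continuous l}.
Proof.
apply/subspace_continuousP => t; rewrite /= in_itv/= => tab.
have clt := ray_closure e1 (ltW a0) ab' tab.
move/subspace_continuousP : (cv) => /(_ _ clt) ct.
apply: (cvg_comp (G := within (closure Omega) (nbhs (t *: e))) _ _ _ ct).
move=> B nB; have nB' : \forall s \near t, closure Omega (s *: e) -> B (s *: e).
  exact: (scalel_continuous nB).
apply: filterS nB' => s H sab; apply: H.
apply: ray_closure => //; exact: ltW.
Qed.

Lemma ray_ends : l a = 0 /\ l b = 0.
Proof.
have E t : a <= t -> enorm (t *: e) = t.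
  by move=> at_; rewrite enormZ e1 mulr1 ger0_norm// (le_trans (ltW a0)).
split; apply: v0; split.
- apply: ray_closure => //; [exact: ltW|].
  by rewrite lexx (ltW ab').
- by rewrite /annulus /= E// ltxx.
- apply: ray_closure => //; [exact: ltW|].
  by rewrite lexx (ltW ab').
- by rewrite /annulus /= E ?ltxx ?andbF// ltW.
Qed.

Lemma ray_is_derive t : a < t < b -> is_derive t 1 l (dotv (grad v (t *: e)) e).
Proof.
move=> tab; have H := @is_derive_line R n v 0 e t.
rewrite addr0 in H; have {}H := H (dv (mem_set (annulus_ray e1 tab))).
by have -> : l = (fun s => v (s *: e + 0)) by apply/funext => s; rewrite addr0.
Qed.
End ray.

(** The mean value theorem along the ray through x, from either end, where v
    is 0. *)
Lemma ray_bound (L : R) : (forall x, Omega x -> enorm (grad v x) <= L) ->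
  forall x, Omega x -> `|v x| <= L * (enorm x - a) /\ `|v x| <= L * (b - enorm x).
Proof.
move=> vL x Ox; have /andP[ax xb] := Ox; have [e e1 xE] := annulus_dir Ox.
have [la lb] := ray_ends e1; have cl := ray_continuous e1.
have dl t : a < t < b -> `|dotv (grad v (t *: e)) e| <= L.
  move=> tab; have H := vL _ (annulus_ray e1 tab).
  have h1 := dotv_le_enorm (grad v (t *: e)) e.
  have h2 := dotv_le_enorm (- grad v (t *: e)) e.
  rewrite e1 mulr1 ?enormN ?dotvNl in h1 h2.
  by rewrite ler_norml; apply/andP; split; lra.
rewrite xE in ax xb *; rewrite enormZ e1 mulr1 ger0_norm ?enorm_ge0// in ax xb *.
set t := enorm x in ax xb *; split.
- have [||c] := @MVT R (fun t => v (t *: e)) (fun t => dotv (grad v (t *: e)) e) a t ax.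
  + move=> s; rewrite in_itv/= => /andP[as_ st]; apply: ray_is_derive => //.
    by rewrite as_ (lt_trans st).
  + by apply: continuous_subspaceW cl; apply: subset_itvl; rewrite bnd_simp ltW.
  + rewrite in_itv/= => /andP[ac ct]; rewrite la subr0 => ->.
    rewrite normrM (gtr0_norm (_ : 0 < t - a)) ?subr_gt0// ler_wpM2r ?subr_ge0 ?(ltW ax)//.
    by apply: dl; rewrite ac (lt_trans ct).
- have [||c] := @MVT R (fun t => v (t *: e)) (fun t => dotv (grad v (t *: e)) e) t b xb.
  + move=> s; rewrite in_itv/= => /andP[as_ st]; apply: ray_is_derive => //.
    by rewrite st (lt_trans ax).
  + by apply: continuous_subspaceW cl; apply: subset_itvr; rewrite bnd_simp ltW.
  + rewrite in_itv/= => /andP[ac ct]; rewrite lb sub0r => /(congr1 Num.norm).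
    rewrite normrN => ->.
    rewrite normrM (gtr0_norm (_ : 0 < b - t)) ?subr_gt0// ler_wpM2r ?subr_ge0 ?(ltW xb)//.
    by apply: dl; rewrite ct (lt_trans ax).
Qed.

(** The derivative of v^2 along every ray is 2 v (Dv, e), which is 0 whether
    or not v is. *)
Lemma ray_zero : (forall x, Omega x -> v x != 0 -> grad v x = 0) ->
  forall x, Omega x -> v x = 0.
Proof.
move=> gv x Ox; have /andP[ax xb] := Ox; have [e e1 xE] := annulus_dir Ox.
have [la lb] := ray_ends e1; have cl := ray_continuous e1.
rewrite xE; set t := enorm x in ax xb *.
have [||c] := @MVT R (fun t => v (t *: e) ^+ 2) (fun=> 0) a t ax.
- move=> s; rewrite in_itv/= => /andP[as_ st].
  have sab : a < s < b by rewrite as_ (lt_trans st).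
  have dl := ray_is_derive e1 sab.
  have := is_deriveM dl dl.
  rewrite (_ : _ *: _ + _ = 0); first exact.
  have [->|/(gv _ (annulus_ray e1 sab)) ->] := eqVneq (v (s *: e)) 0.
    by rewrite !scale0r addr0.
  by rewrite /dotv big1 ?scaler0 ?addr0// => i _; rewrite mxE mul0r.
- have cl' : {within `[a, t], continuous (fun t => v (t *: e))}.
    by apply: continuous_subspaceW cl; apply: subset_itvl; rewrite bnd_simp ltW.
  by move=> s; exact: (continuousM (cl' s) (cl' s)).
- by move=> _; rewrite la mul0r expr0n subr0 => /eqP; rewrite sqrf_eq0 => /eqP.
Qed.

End rays.

(** * The comparison argument *)

Lemma near_and_imp (R : realType) (V : normedModType R) (x : V) (P Q S : V -> Prop) :
  (\forall y \near x, P y) -> (\forall y \near x, Q y) ->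
  (forall y, P y -> Q y -> S y) -> \forall y \near x, S y.
Proof. by move=> nP nQ H; apply: filterS2 nP nQ. Qed.

Lemma near_eq_differentiable (R : realType) n (f g : 'rV[R]_n -> R) (x : 'rV[R]_n) :
  (\forall y \near x, f y = g y) -> differentiable f x -> differentiable g x.
Proof.
move=> fg df; have cdf := diff_continuous df; have E := diff_locally df.
have fgx : f x = g x := nbhs_singleton fg.
have E' : g \o shift x = cst (g x) + 'd f x +o_ (0 : 'rV[R]_n) id.
  apply/eqaddoP => e e0; have /eqaddoP/(_ e e0) H := E.
  move/nbhs_ballP : fg => [r /= r0 fg].
  have nb := near_dist_le (0 : 'rV[R]_n) (divr_gt0 r0 (ltr0Sn _ 1)).
  have {}H : \forall h \near (0 : 'rV[R]_n),
    `|f (h + x) - (f x + 'd f x h)| <= e * `|h| by exact: H.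
  suff : \forall h \near (0 : 'rV[R]_n),
    `|g (h + x) - (g x + 'd f x h)| <= e * `|h| by [].
  apply: (near_and_imp nb H) => h; rewrite sub0r normrN => hr.
  rewrite -fgx -fg// -ball_normE /ball_/= opprD addrCA subrr addr0 normrN.
  by rewrite (le_lt_trans hr)// ltr_pdivrMr// ltr_pMr// ltr1n.
have dE := diff_unique cdf E'.
by apply/diff_locallyP; rewrite dE.
Qed.

Lemma continuous_sumR (R : realType) (T : topologicalType) (I : Type) (s : seq I)
    (f : I -> T -> R) (y : T) :
  (forall i, {for y, continuous (f i)}) ->
  {for y, continuous (fun x => \sum_(i <- s) f i x)}.
Proof.
move=> cf; elim: s => [|i s IH].
  rewrite (_ : (fun x => _) = cst 0); first exact: cst_continuous.
  by apply/funext => x; rewrite big_nil.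
rewrite (_ : (fun x => _) = f i \+ (fun x => \sum_(j <- s) f j x)).
  exact: (continuousD (cf i) IH).
by apply/funext => x; rewrite big_cons.
Qed.

Section comparison.
Variables (R : realType) (n : nat) (a b C L : R).
Local Notation V := 'rV[R]_n.+1.
Local Notation Omega := (@annulus R n.+1 a b).
Local Notation mu := (lebesgue_rV R n.+1).
Variables (v : V -> R) (H : 'I_n.+1 -> V -> R).
Hypotheses (ab : 0 < a < b) (cv : {within closure Omega, continuous v})
  (dv : {in Omega, forall x, differentiable v x})
  (v0 : forall x, (closure Omega `\` Omega) x -> v x = 0)
  (cpv : forall i, {in Omega, continuous (partial i v)})
  (vL : forall x, Omega x -> enorm (grad v x) <= L)
  (cH : forall i, {in Omega, continuous (H i)})
  (HC : forall i x, Omega x -> `|H i x| <= C)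
  (weak : forall phi, test_function Omega phi ->
    (\int[mu]_(x in Omega) (\sum_i H i x * partial i phi x)%:E = 0)%E)
  (H_ge0 : forall x, Omega x -> 0 <= \sum_i H i x * partial i v x)
  (H_eq0 : forall x, Omega x -> \sum_i H i x * partial i v x = 0 -> grad v x = 0).

Let a0 : 0 < a. Proof. by case/andP: ab. Qed.
Let oO : open Omega. Proof. exact: open_annulus. Qed.

Section level.
Variable e : R.
Hypothesis e0 : 0 < e.
(* the test function; its support lies in S, because |v| > e forces x to be at
   distance at least d from the boundary *)
Let psi : V -> R := fun y => if `[< Omega y >] then trunc e (v y) else 0.
Let d := e / (`|L| + 1).
Let S : set V := [set x | a + d <= enorm x <= b - d].

Let L0 : 0 < `|L| + 1. Proof. by rewrite ltr_wpDl. Qed.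
Let d0 : 0 < d. Proof. by rewrite divr_gt0. Qed.

Let psiS x : psi x != 0 -> S x.
Proof.
rewrite /psi; case: asboolP => [Ox|_]; last by rewrite eqxx.
have [xe|xe] := leP `|v x| e; first by rewrite trunc_eq0 ?eqxx// ltW.
move=> _; have [h1 h2] := ray_bound ab cv dv v0 vL Ox; have /andP[/ltW ax /ltW xb] := Ox.
have k t : 0 <= t -> `|v x| <= L * t -> d <= t.
  move=> t0 H1; rewrite ler_pdivrMr// (le_trans (ltW xe))// (le_trans H1)//.
  rewrite mulrC ler_wpM2l// (le_trans (ler_norm _))// lerDl.
  exact: ler01.
have k1 := k (enorm x - a); have k2 := k (b - enorm x); rewrite !subr_ge0 in k1 k2.
by rewrite /S /=; apply/andP; split; [have := k1 ax h1|have := k2 xb h2]; lra.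
Qed.

Let SO : S `<=` Omega.
Proof. by move=> x /andP[h1 h2]; have := d0; rewrite /annulus /= => h3; apply/andP; split; lra. Qed.

Let psi_out x : ~ Omega x -> \forall y \near x, psi y = 0.
Proof.
move=> nO; have oC : open (~` S) by exact/closed_openC/closed_shell.
have nC : nbhs x (~` S) by apply: open_nbhs_nbhs; split => // /SO.
apply: filterS nC => y nS; apply/eqP; apply: contrapT => /negP /psiS; exact: nS.
Qed.

Let psi_in x : Omega x -> \forall y \near x, trunc e (v y) = psi y.
Proof.
move=> Ox; have nO : nbhs x Omega by exact: open_nbhs_nbhs.
by apply: filterS nO => y Oy; rewrite /psi; case: asboolP.
Qed.

Let dtv x : Omega x -> differentiable (trunc e \o v) x /\
  grad (trunc e \o v) x = dtrunc e (v x) *: grad v x.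
Proof.
by move=> Ox; exact: (partial_compR (dv (mem_set Ox)) (is_derive_trunc e (v x))).
Qed.

Let dpsi x : differentiable psi x.
Proof.
have [Ox|/psi_out nO] := pselect (Omega x).
  exact: (near_eq_differentiable (psi_in Ox) (dtv Ox).1).
apply: (@near_eq_differentiable _ _ (cst 0)); last exact: differentiable_cst.
by apply: filterS nO => y ->.
Qed.

Let ppsi i x : Omega x -> partial i psi x = dtrunc e (v x) * partial i v x.
Proof.
move=> Ox; have := congr1 (fun w : V => w ord0 i) (dtv Ox).2; rewrite !mxE => <-.
by apply/esym; apply: near_eq_derive; exact: psi_in.
Qed.

Let cdv x : Omega x -> {for x, continuous (fun y => dtrunc e (v y))}.
Proof.
move=> Ox; have c1 : {for x, continuous v}.
  by apply/differentiable_continuous; exact: (dv (mem_set Ox)).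
exact: (continuous_comp c1 (@continuous_dtrunc R e (v x))).
Qed.

Let cpsi i : continuous (partial i psi).
Proof.
move=> x; have [Ox|/psi_out nO] := pselect (Omega x).
  apply: (@near_continuous _ _ (fun x => dtrunc e (v x) * partial i v x)).
    have nOx : nbhs x Omega by exact: open_nbhs_nbhs.
    by apply: filterS nOx => y /ppsi ->.
  exact: (continuousM (cdv Ox) (@cpv i x (mem_set Ox))).
apply: (@near_continuous _ _ (cst 0)); last exact: cst_continuous.
by have nn := near_join nO; apply: filterS nn => y ny; rewrite partial_eq0.
Qed.

Let psi0 x : b < `|x| -> psi x = 0.
Proof.
move=> bx; rewrite /psi; case: asboolP => // /andP[_ xb].
by move: (lt_le_trans bx (norm_le_enorm x)); rewrite ltNge (ltW xb).
Qed.

(** Testing the equation of H with [trunc e v], which is supported at distance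
    at least d from the boundary, shows that the nonnegative function [dtrunc
    e (v x)] times (H, Dv) has integral 0; and [dtrunc e (v x)] is positive
    where |v x| > e. *)
Lemma level_grad0 x : Omega x -> e < `|v x| -> grad v x = 0.
Proof.
move=> Ox ex; apply: H_eq0 => //.
pose S' : set V := [set x | a + d / 2 <= enorm x <= b - d / 2].
have d20 : 0 < d / 2 by rewrite divr_gt0.
have SS' x' y : S y -> `|x' - y| <= d / 2 / n.+1%:R -> S' x'.
  move=> /andP[y1 y2]; rewrite ler_pdivlMr// => xy.
  have H1 : enorm (x' - y) <= d / 2.
    by rewrite (le_trans (enorm_le_norm _))// mulrC.
  have := enormB_ge x' y; rewrite ler_norml => /andP[H2 H3].
  by rewrite /S' /=; apply/andP; split; lra.
have S'O : S' `<=` Omega.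
  by move=> y /andP[h1 h2]; rewrite /annulus /=; apply/andP; split; lra.
have I0 := weak_zero_C1 dpsi cpsi psi0 psiS (@compact_shell _ _ _ _) S'O
  (divr_gt0 d20 (ltr0Sn _ n)) SS' oO (@annulus_cube _ _ a b) cH HC weak.
have := @integral0_continuous R n.+1 Omega
  (fun x => dtrunc e (v x) * \sum_i H i x * partial i v x) oO.
have cS y : Omega y -> {for y, continuous (fun x => \sum_i H i x * partial i v x)}.
  move=> Oy; have c1 i : {for y, continuous (fun x => H i x * partial i v x)}.
    exact: (continuousM (@cH i y (mem_set Oy)) (@cpv i y (mem_set Oy))).
  exact: continuous_sumR.
move=> /(_ _ _ _ x Ox) H1; apply/eqP.
have : dtrunc e (v x) * (\sum_i H i x * partial i v x) = 0.
  apply: H1.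
  - by move=> y /set_mem Oy; exact: (continuousM (cdv Oy) (cS y Oy)).
  - by move=> y Oy; rewrite mulr_ge0 ?dtrunc_ge0// H_ge0.
  - rewrite -I0; apply: eq_integral => y /set_mem Oy; congr EFin.
    by rewrite mulr_sumr; apply: eq_bigr => i _; rewrite ppsi// mulrCA.
by move/eqP; rewrite mulf_eq0 gt_eqF// dtrunc_gt0// ltW.
Qed.

End level.

Theorem comparison_eq0 x : Omega x -> v x = 0.
Proof.
apply: (ray_zero ab cv dv v0) => y Oy vy0.
have vy : 0 < `|v y| by rewrite normr_gt0.
apply: (@level_grad0 (`|v y| / 2)) => //; first by rewrite divr_gt0.
by rewrite ltr_pdivrMr// ltr_pMr// ltr1n.
Qed.

End comparison.

(** * The solution is radial *)

Lemma continuous_at_within (T U : topologicalType) (A B : set T) (f : T -> U) x :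
  {within A, continuous f} -> open B -> B `<=` A -> B x -> {for x, continuous f}.
Proof.
move=> cf oB BA Bx; have cB := continuous_subspaceW BA cf.
by move: cB; rewrite continuous_open_subspace// => /(_ x (mem_set Bx)).
Qed.

Lemma enorm_dir (R : realType) n (x : 'rV[R]_n) : enorm x != 0 ->
  enorm ((enorm x)^-1 *: x) = 1.
Proof. by move=> x0; rewrite enormZ ger0_norm ?invr_ge0 ?enorm_ge0// mulVf. Qed.

Section radial.
Variables (R : realType) (n : nat) (p a b r0 : R).
Local Notation V := 'rV[R]_n.+1.
Local Notation Omega := (@annulus R n.+1 a b).
Local Notation mu := (lebesgue_rV R n.+1).
Local Notation theta := ((2 - p) / (p - 1)).
Hypotheses (p12 : 1 < p < 2) (ab : 0 < a < b).

Let p1 : 0 < p - 1. Proof. by case/andP: p12; rewrite subr_gt0. Qed.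
Let p2 : 0 < 2 - p. Proof. by case/andP: p12; rewrite subr_gt0. Qed.
Let a0 : 0 < a. Proof. by case/andP: ab. Qed.
Let ab' : a < b. Proof. by case/andP: ab. Qed.
Let oO : open Omega. Proof. exact: open_annulus. Qed.

Lemma theta_gt0 : 0 < theta. Proof. exact: divr_gt0. Qed.

Lemma theta_inv : 1 + theta = (p - 1)^-1.
Proof. by field; rewrite gt_eqF. Qed.

Definition radial_sol (x : V) : R := profile n theta a r0 (enorm x).

Let a2a : a / 2 < a. Proof. by rewrite ltr_pdivrMr// ltr_pMr// ltr1n. Qed.

Lemma radial_differentiable x : a <= enorm x -> differentiable radial_sol x /\
  grad radial_sol x = slope n theta r0 (enorm x) *: ((enorm x)^-1 *: x).
Proof.
move=> ax; have x0 : x != 0 by rewrite -enorm_gt0 (lt_le_trans a0).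
have [d1 g1] := differentiable_enorm x0.
have d2 := is_derive_profile n theta_gt0 ab r0 (lt_le_trans a2a ax).
by have := partial_compR d1 d2; rewrite g1.
Qed.

Lemma enorm_grad_radial x : a <= enorm x ->
  enorm (grad radial_sol x) = `|flux n r0 (enorm x)| `^ (p - 1)^-1.
Proof.
move=> ax; have [_ ->] := radial_differentiable ax.
have x0 : enorm x != 0 by rewrite gt_eqF// (lt_le_trans a0).
by rewrite enormZ enorm_dir// mulr1 norm_sigpow ?theta_inv// theta_gt0.
Qed.

(** [slope] was obtained from [flux] by inverting [pflux]. *)
Lemma pflux_radial i x : a <= enorm x ->
  pflux p (grad radial_sol x) ord0 i = field r0 i x.
Proof.
move=> ax; have x0 : enorm x != 0 by rewrite gt_eqF// (lt_le_trans a0).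
rewrite mxE enorm_grad_radial// (radial_differentiable ax).2 !mxE /slope /sigpow /field.
have -> : flux n r0 (enorm x) = fluxdiv n r0 (enorm x) * enorm x by exact: fluxdivE.
set f := fluxdiv n r0 (enorm x) * enorm x.
have [f0|f0] := eqVneq f 0.
  have -> : fluxdiv n r0 (enorm x) = 0.
    by move/eqP: f0; rewrite mulf_eq0 (negbTE x0) orbF => /eqP.
  by rewrite f0 !mul0r mulr0.
(* the exponents (p-2)/(p-1) and theta are opposite *)
have P1 : `|f| `^ (p - 1)^-1 `^ (p - 2) * `|f| `^ theta = 1.
  rewrite -powRrM -powRD; last by rewrite normr_eq0 f0 implybT.
  by rewrite (_ : (p - 1)^-1 * (p - 2) + theta = 0) ?powRr0//; field; rewrite gt_eqF.
rewrite (_ : _ * _ = `|f| `^ (p - 1)^-1 `^ (p - 2) * `|f| `^ theta *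
  (f / enorm x * x ord0 i)); last by ring.
by rewrite P1 mul1r /f mulfK.
Qed.

Hypotheses (r0ab : a < r0 < b) (r0E : prim n theta a r0 b = prim n theta a r0 a).

Lemma radial_boundary x : (closure Omega `\` Omega) x -> radial_sol x = 0.
Proof.
move=> [/closure_annulus/andP[ax xb] nO].
have [xa|xa] := eqVneq (enorm x) a; first by rewrite /radial_sol /profile xa subrr.
have [xb'|xb'] := eqVneq (enorm x) b; first by rewrite /radial_sol /profile xb' r0E subrr.
by case: nO; rewrite /annulus /= !lt_neqAle ax xb xb' eq_sym xa.
Qed.

Variable u : V -> R.
Hypotheses (C1u : C1_closure Omega u) (weak_u : weak_solution p Omega u)
  (u0 : forall x, (closure Omega `\` Omega) x -> u x = 0).

Let cvgradu x : Omega x -> {for x, continuous (grad u)}.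
Proof.
move=> Ox; have [_ _ [G cG uG]] := C1u.
have cGx := continuous_at_within cG oO (@subset_closure _ Omega) Ox.
apply: near_continuous cGx.
have nO : nbhs x Omega by exact: open_nbhs_nbhs.
by apply: filterS nO => y Oy; rewrite uG// inE.
Qed.

Let bgradu : exists2 B, 0 <= B & forall x, Omega x -> enorm (grad u x) <= B.
Proof.
have [_ _ [G cG uG]] := C1u.
have cO : compact (closure Omega).
  apply: (subclosed_compact _ (@compact_shell R n.+1 a b)); first exact: closed_closure.
  exact: closure_annulus.
have /compact_bounded[B [_ HB]] : compact (G @` closure Omega).
  exact: continuous_compact.
exists (n.+1%:R * (`|B| + 1)) => [|x Ox]; first by rewrite mulr_ge0// addr_ge0.
rewrite (le_trans (enorm_le_norm _))// ler_wpM2l//; apply: (HB (`|B| + 1)).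
  by rewrite (le_lt_trans (ler_norm _))// ltrDl.
by exists x; [exact: subset_closure|rewrite uG// inE].
Qed.

Let bgradw : exists2 B, 0 <= B & forall x, Omega x -> enorm (grad radial_sol x) <= B.
Proof.
eexists; last first.
  move=> x /andP[ax xb]; have [_ ->] := radial_differentiable (ltW ax).
  have x0 : enorm x != 0 by rewrite gt_eqF// (lt_trans a0).
  rewrite enormZ enorm_dir// mulr1; apply: (slope_bound n theta_gt0 ab).
    have /andP[ar rb] := r0ab; rewrite (ltW (lt_trans a0 ar))/=.
    by rewrite (le_trans (ltW rb))// lerDl.
  by rewrite ltW ?(lt_trans a2a)//= (le_trans (ltW xb))// lerDl.
exact: powR_ge0.
Qed.

Let v (x : V) : R := u x - radial_sol x.

Let gradv x : Omega x -> grad v x = grad u x - grad radial_sol x.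
Proof.
move=> Ox; have [_ du _] := C1u; have /andP[/ltW ax _] := Ox.
apply/rowP => i; rewrite !mxE /partial /v -[RHS]deriveB//.
  exact: (diff_derivable (du _ (mem_set Ox))).
exact: (diff_derivable (radial_differentiable ax).1).
Qed.

Let pgradw i x : Omega x -> {for x, continuous (partial i radial_sol)}.
Proof.
move=> Ox; have /andP[ax _] := Ox; have x0 : x != 0 by rewrite -enorm_gt0 (lt_trans a0).
have ce : {for x, continuous (@enorm R n.+1)} by exact: continuous_enorm.
have ex0 : 0 < enorm x by rewrite (lt_trans a0).
have c1 := continuous_comp ce (@continuous_slope R n theta theta_gt0 r0 _ ex0).
have c2 : {for x, continuous (fun y : V => (enorm y)^-1)}.
  by apply: continuousV => //; rewrite gt_eqF.
have c3 : {for x, continuous (fun z : V => z ord0 i)}.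
  by apply/differentiable_continuous; exact: differentiable_coord.
apply: near_continuous (continuousM c1 (continuousM c2 c3)).
have nO : nbhs x Omega by exact: open_nbhs_nbhs.
apply: filterS nO => y /andP[/ltW ay _].
by have := congr1 (fun w : V => w ord0 i) (radial_differentiable ay).2; rewrite !mxE.
Qed.

Let H (i : 'I_n.+1) (x : V) : R := pflux p (grad u x) ord0 i - field r0 i x.

Let cpfluxu i x : Omega x -> {for x, continuous (fun x => pflux p (grad u x) ord0 i)}.
Proof.
move=> Ox; have := continuous_comp (cvgradu Ox) (@continuous_pflux R n.+1 p p12 i (grad u x)).
exact.
Qed.

Let HsumE x : Omega x -> \sum_i H i x * partial i v x =
  dotv (pflux p (grad u x) - pflux p (grad radial_sol x)) (grad u x - grad radial_sol x).
Proof.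
move=> Ox; have /andP[/ltW ax _] := Ox; rewrite -gradv//; apply: eq_bigr => i _.
have E : partial i v x = grad v x ord0 i by rewrite mxE.
rewrite E /H -(pflux_radial i ax); congr (_ * _).
by rewrite [in RHS]mxE [X in _ = _ + X]mxE.
Qed.

(** The difference of u and the radial solution satisfies the hypotheses of
    [comparison_eq0], H being the difference of their fluxes: this field is
    weakly divergence free as both fluxes have divergence -1, and monotonicity
    gives the two conditions on (H, Dv). The bounds on the gradients come from
    regularity up to the boundary. *)
Theorem unique_radial x : Omega x -> u x = radial_sol x.
Proof.
have [cu du _] := C1u.
have [Bu Bu0 HBu] := bgradu; have [Bw Bw0 HBw] := bgradw.
have powB (B z : R) : 0 <= z -> z <= B -> z `^ (p - 1) <= B `^ (p - 1).
  move=> z0 zB; apply: (ge0_ler_powR (ltW p1)) => //; rewrite nnegrE//.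
  exact: le_trans zB.
have bu i y : Omega y -> `|pflux p (grad u y) ord0 i| <= Bu `^ (p - 1).
  move=> Oy; rewrite (le_trans (coord_enorm _ _))// enorm_pflux//.
  by apply: powB; [exact: enorm_ge0|exact: HBu].
have bw i y : Omega y -> `|field r0 i y| <= Bw `^ (p - 1).
  move=> Oy; have /andP[/ltW ay _] := Oy.
  rewrite -pflux_radial// (le_trans (coord_enorm _ _))// enorm_pflux//.
  by apply: powB; [exact: enorm_ge0|exact: HBw].
have cfield i y : Omega y -> {for y, continuous (field r0 i)}.
  by move=> /andP[ay _]; apply: continuous_field; rewrite -enorm_gt0 (lt_trans a0).
have cv : {within closure Omega, continuous v}.
  have cw : {within closure Omega, continuous radial_sol}.
    apply: continuous_in_subspaceT => y /set_mem/closure_annulus/andP[ay _].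
    by apply/differentiable_continuous; exact: (radial_differentiable ay).1.
  by move=> y; exact: (continuousB (cu y) (cw y)).
have dv : {in Omega, forall x, differentiable v x}.
  move=> y Oy; apply: differentiableB; first exact: du.
  by move/set_mem : Oy => /andP[/ltW ay _]; exact: (radial_differentiable ay).1.
have v0 y : (closure Omega `\` Omega) y -> v y = 0.
  by move=> Oy; rewrite /v u0// radial_boundary// subrr.
move=> Ox; apply/eqP; rewrite -subr_eq0; apply/eqP.
apply: (@comparison_eq0 R n a b (Bu `^ (p - 1) + Bw `^ (p - 1)) (Bu + Bw) v H) => //.
- move=> i y /set_mem Oy.
  have c1 : {for y, continuous (partial i u)}.
    have c0 : {for grad u y, continuous (fun z : V => z ord0 i)}.
      by apply/differentiable_continuous; exact: differentiable_coord.
    have := continuous_comp (cvgradu Oy) c0.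
    by rewrite (_ : _ \o _ = partial i u)//; apply/funext => z /=; rewrite mxE.
  apply: near_continuous (continuousB c1 (@pgradw i y Oy)).
  have nO : nbhs y Omega by exact: open_nbhs_nbhs.
  apply: filterS nO => z /gradv /(congr1 (fun w : V => w ord0 i)).
  by rewrite !mxE => ->.
- move=> y Oy; rewrite gradv// (le_trans (enormD _ _))// enormN.
  by apply: lerD; [exact: HBu|exact: HBw].
- by move=> i y /set_mem Oy; exact: (continuousB (@cpfluxu i y Oy) (@cfield i y Oy)).
- move=> i y Oy; rewrite (le_trans (ler_normB _ _))// lerD//; first exact: bu.
  exact: bw.
- move=> phi tphi; have [sphi _ supp] := tphi.
  have mO : measurable Omega by exact: open_measurable_rV.
  have cpphi i : continuous (partial i phi).
    by move=> y; apply/differentiable_continuous; exact: (sphi [:: i] y (mem_set I)).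
  have pphi0 i y : b < `|y| -> partial i phi y = 0.
    move=> My; apply: partial_eq0; apply: filterS (norm_lt_near My) => z Mz.
    apply/eqP; apply: contrapT => /negP pz.
    have /supp/andP[_ zb] := @subset_closure _ [set x | phi x != 0] z pz.
    by move: (lt_le_trans Mz (norm_le_enorm z)); rewrite ltNge (ltW zb).
  have [B HB] : exists B, forall i y, `|partial i phi y| <= B.
    by apply: fin_bound => i; exact: (continuous_compact_bounded (cpphi i) (pphi0 i)).
  have intg (K : 'I_n.+1 -> V -> R) (C : R) : (forall i y, Omega y -> {for y, continuous (K i)}) ->
      (forall i y, Omega y -> `|K i y| <= C) ->
      mu.-integrable Omega (EFin \o (fun y => \sum_i K i y * partial i phi y)).
    move=> cK KC; apply: integrable_sumR => // i.
    apply: (@bounded_integrable_rV _ _ Omega b (C * B)) => //; first exact: annulus_cube.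
      apply: measurable_funM; apply: continuous_measurable_rV => //.
      by move=> y /set_mem; exact: cK.
    by move=> y Oy; rewrite normrM ler_pM// KC.
  have i1 := intg _ _ cpfluxu bu; have i2 := intg _ _ cfield bw.
  transitivity (\int[mu]_(y in Omega) ((\sum_i pflux p (grad u y) ord0 i * partial i phi y)%:E
     - (\sum_i field r0 i y * partial i phi y)%:E))%E.
    apply: eq_integral => y _; rewrite -EFinB -sumrB; congr EFin.
    by apply: eq_bigr => i _; rewrite mulrBl.
  rewrite (integralB mO i1 i2) [X in (_ - X)%E](field_weak r0 a0 tphi).
  rewrite -(weak_u tphi) [X in (X - _)%E](_ : _ =
     \int[mu]_(y in Omega) (enorm (grad u y) `^ (p - 2) * dotv (grad u y) (grad phi y))%:E)%E.
    rewrite subee// (weak_u tphi) -(field_weak r0 a0 tphi).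
    exact: (integrable_fin_num mO i2).
  apply: eq_integral => y _; congr EFin; rewrite /dotv mulr_sumr.
  by apply: eq_bigr => i _; rewrite !mxE mulrA.
- by move=> y Oy; rewrite HsumE//; exact: (pflux_monotone p12 _ _).1.
- by move=> y Oy; rewrite HsumE// gradv// => /(pflux_monotone p12 _ _).2 ->; rewrite subrr.
Qed.

End radial.

(** * Integrals of |z|^-theta on the line *)

Section ipow.
Variables (R : realType) (theta : R).
Hypothesis theta0 : 0 < theta.
Local Notation leb := (@lebesgue_measure R).
Local Open Scope ereal_scope.

(** The value +oo at 0 matches that of [weight] at critical points. *)
Definition ipow (z : R) : \bar R := if z == 0%R then +oo else (`|z| `^ (- theta))%:E.

Lemma ipow_ge0 z : 0 <= ipow z.
Proof. by rewrite /ipow; case: eqP => // _; rewrite lee_fin powR_ge0. Qed.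

Lemma ipowN z : ipow (- z)%R = ipow z.
Proof. by rewrite /ipow oppr_eq0 normrN. Qed.

Lemma le_ipow z w : (`|z| <= `|w|)%R -> ipow w <= ipow z.
Proof.
move=> zw; rewrite /ipow; have [_|z0] := eqVneq z 0%R; first by rewrite leey.
have wz0 : (0 < `|z|)%R by rewrite normr_gt0.
have w0 := lt_le_trans wz0 zw.
rewrite ifF; last by apply/negbTE; rewrite -normr_gt0.
rewrite lee_fin !powRN lef_pV2 ?posrE ?powR_gt0//.
by apply: (ge0_ler_powR (ltW theta0)) => //; rewrite nnegrE ltW.
Qed.

Lemma ipowM (c z : R) : (0 < c)%R -> ipow (c * z)%R = (c `^ (- theta))%:E * ipow z.
Proof.
move=> c0; rewrite /ipow mulf_eq0 (gt_eqF c0)/=; case: eqP => [_|_].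
  by rewrite gt0_muley// lte_fin powR_gt0.
by rewrite -EFinM normrM (gtr0_norm c0) powRM// ltW.
Qed.

Lemma measurable_ipow : measurable_fun [set: R] ipow.
Proof.
apply: measurable_fun_ifT => //.
  apply: (measurable_fun_bool true).
  rewrite (_ : _ @^-1` _ = [set 0%R]) ?setTI//.
  by apply/seteqP; split => [_ /eqP ->//|_ -> /=]; rewrite eqxx.
by apply/measurable_EFinP; apply: (@measurableT_comp _ _ _ _ _ _ (fun z : R => (z `^ (- theta))%R)).
Qed.

Let is_derive_pow (s : R) : (0 < s)%R -> theta != 1%R ->
  is_derive s 1%R (fun s : R => s `^ (1 - theta) / (1 - theta))%R (s `^ (- theta))%R.
Proof.
move=> s0 t1; have d := @is_derive1_powR R (1 - theta) s s0.
have := is_deriveZ (1 - theta)^-1%R d.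
rewrite (_ : (1 - theta)^-1 *: _ = s `^ (- theta))%R; last first.
  rewrite /GRing.scale/= mulrA mulVf ?mul1r; last by rewrite subr_eq0 eq_sym.
  by congr powR; ring.
rewrite (_ : (fun s : R => _) = ((1 - theta)^-1 \*: (fun s : R => s `^ (1 - theta)))%R) //.
by apply/funext => x /=; rewrite mulrC.
Qed.

Let continuous_pow (k : R) (s : R) : (0 < s)%R -> {for s, continuous (fun s : R => s `^ k)%R}.
Proof.
move=> s0; apply/differentiable_continuous/derivable1_diffP; apply: derivable_powR.
by rewrite in_itv/= s0.
Qed.

Let integral_pow (x l : R) (f F : R -> R) : (0 < x < l)%R ->
  (forall s : R, (0 < s)%R -> {for s, continuous f}) ->
  (forall s : R, (0 < s)%R -> is_derive s 1%R F (f s)) ->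
  \int[leb]_(s in `[x, l]) (f s)%:E = (F l)%:E - (F x)%:E.
Proof.
move=> /andP[x0 xl] cf dF.
have cF s : (0 < s)%R -> {for s, continuous F}.
  by move=> s0; apply/differentiable_continuous/derivable1_diffP; case: (dF s s0).
apply: continuous_FTC2 => //.
- apply: continuous_in_subspaceT => t; rewrite inE/= in_itv/= => /andP[xt _].
  by apply: cf; rewrite (lt_le_trans x0).
- split.
  + by move=> s; rewrite in_itv/= => /andP[xs _]; case: (dF s (lt_trans x0 xs)).
  + by apply: cvg_at_right_filter; exact: cF.
  + by apply: cvg_at_left_filter; exact: cF (lt_trans x0 xl).
- move=> s; rewrite in_itv/= => /andP[xs _]; rewrite derive1E.
  by case: (dF s (lt_trans x0 xs)).
Qed.

(* increasing closed intervals with union ]0, l], on which s^-theta is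
   continuous *)
Let F (l : R) (k : nat) : set R := `[(l / k.+1%:R)%R, l].

Let bigcupF l : (0 < l)%R -> \bigcup_k F l k = `]0%R, l]%classic.
Proof.
move=> l0; apply/seteqP; split => [s [k _]|s]; rewrite /F/= !in_itv/=.
  by move=> /andP[ls ->]; rewrite (lt_le_trans _ ls)// divr_gt0.
move=> /andP[s0 sl]; exists (Num.truncn (l / s)%R) => //; rewrite /= in_itv/= sl andbT.
rewrite ler_pdivrMr// mulrC -ler_pdivrMr//.
by apply: ltW; exact: truncnS_gt.
Qed.

(** The integral over ]0, l] is the limit of those over [l / k, l], each
    bounded by the value at l of the primitive. *)
Lemma ipow_half_le (l : R) : (theta < 1)%R -> (0 < l)%R ->
  \int[leb]_(s in `]0%R, l]) ipow s <= (l `^ (1 - theta) / (1 - theta))%:E.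
Proof.
move=> t1 l0; rewrite -bigcupF//.
have ndF : nondecreasing_seq (F l).
  move=> i j ij; rewrite subsetEset => s; rewrite /F/= !in_itv/= => /andP[ls ->].
  rewrite andbT (le_trans _ ls)// ler_wpM2l ?(ltW l0)//.
  by rewrite lef_pV2 ?posrE// ler_nat.
have cv : \int[leb]_(x in F l i) ipow x @[i --> \oo] -->
    \int[leb]_(x in \bigcup_i F l i) ipow x.
  apply: ge0_nondecreasing_set_cvg_integral => //.
  - by move=> i; exact: measurable_itv.
  - by move=> i; exact: (measurable_funTS measurable_ipow).
  - by move=> i x _; exact: ipow_ge0.
rewrite -(cvg_lim _ cv)//; apply: lime_le; first by apply/cvg_ex; eexists; exact: cv.
near=> k.
have k0 : (0 < k)%N by near: k; exact: nbhs_infty_gt.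
have lk : (0 < l / k.+1%:R < l)%R.
  by rewrite divr_gt0//= ltr_pdivrMr// ltr_pMr// ltr1n.
rewrite (_ : \int[leb]_(s in F l k) ipow s = \int[leb]_(s in F l k) (s `^ (- theta))%:E).
  have tn1 : theta != 1%R by rewrite lt_eqF.
  rewrite [leLHS](integral_pow lk (@continuous_pow (- theta)%R)
    (fun s s0 => is_derive_pow s0 tn1)).
  by rewrite -EFinB lee_fin gerBl// divr_ge0 ?powR_ge0// subr_ge0 ltW.
apply: eq_integral => s; rewrite inE /F/= in_itv/= => /andP[ls _].
have s0 : (0 < s)%R by rewrite (lt_le_trans _ ls)// divr_gt0.
by rewrite /ipow gt_eqF// gtr0_norm.
Unshelve. all: by end_near. Qed.

(** Near 0 the integrand is at least 1/s, whose primitive ln is unbounded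
    there. *)
Lemma ipow_half_oo (l : R) : (1 <= theta)%R -> (0 < l)%R ->
  \int[leb]_(s in `]0%R, l]) ipow s = +oo.
Proof.
move=> t1 l0; apply/eqyP => A A0; pose m := Num.min l 1%R.
have m0 : (0 < m)%R by rewrite lt_min l0 ltr01.
(* x is such that the integral of 1/s over [x, m] is A; m <= 1 ensures that 1/s
   is at most s^-theta there *)
pose x := (m * expR (- A))%R.
have xm : (0 < x < m)%R.
  by rewrite mulr_gt0 ?expR_gt0//= gtr_pMr// expR_lt1 oppr_lt0.
have /andP[x0 xm'] := xm.
apply: (@le_trans _ _ (\int[leb]_(s in `[x, m]) (s^-1)%:E)).
  have cV (s : R) : (0 < s)%R -> {for s, continuous (fun s : R => s^-1)%R}.
    by move=> s0; apply: continuousV; [rewrite gt_eqF|exact: cvg_id].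
  rewrite [leRHS](integral_pow xm cV (fun s s0 => is_derive1_ln s0)).
  by rewrite -EFinB lee_fin lnM ?posrE ?expR_gt0// expRK; lra.
apply: (@le_trans _ _ (\int[leb]_(s in `[x, m]) ipow s)).
  apply: ge0_le_integral => //.
  - by move=> s; rewrite /= in_itv/= => /andP[xs _]; rewrite lee_fin invr_ge0 (le_trans (ltW x0)).
  - apply/measurable_EFinP; apply: subspace_continuous_measurable_fun => //.
    apply: continuous_in_subspaceT => s; rewrite inE/= in_itv/= => /andP[xs _].
    by apply: continuousV; [rewrite gt_eqF// (lt_le_trans x0)|exact: cvg_id].
  - exact: (measurable_funTS measurable_ipow).
  - move=> s; rewrite /= in_itv/= => /andP[xs sm].
    have s0 : (0 < s)%R by rewrite (lt_le_trans x0).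
    rewrite /ipow gt_eqF// lee_fin gtr0_norm// powRN lef_pV2 ?posrE ?powR_gt0//.
    by apply: ge1r_powR => //; rewrite s0 (le_trans sm)// ge_min lexx orbT.
apply: ge0_subset_integral => //.
- exact: (measurable_funTS measurable_ipow).
- by move=> s _; exact: ipow_ge0.
- move=> s; rewrite /= !in_itv/= => /andP[xs sm].
  by rewrite (lt_le_trans x0)//= (le_trans sm)// ge_min lexx.
Qed.

Lemma ipow_sym (l : R) : (0 < l)%R ->
  \int[leb]_(s in `[(- l)%R, l]) ipow s = 2%:E * \int[leb]_(s in `]0%R, l]) ipow s.
Proof.
move=> l0; rewrite -(@integral_setD1 _ _ 0%R) => [|//|]; last 2 first.
  by apply: measurableD.
  exact: (measurable_funTS measurable_ipow).
rewrite (_ : `[(- l)%R, l] `\ 0%R = `[(- l)%R, 0%R[ `|` `]0%R, l]); last first.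
  apply/seteqP; split => s /=; rewrite !in_itv/=.
    move=> [/andP[h1 h2] /eqP h3]; have [h4|h4|h4] := ltgtP s 0%R.
    - by left; rewrite h1.
    - by right; rewrite h2.
    - by rewrite h4 eqxx in h3.
  move=> [/andP[h1 h2]|/andP[h1 h2]]; split; try (apply/andP; split; lra).
    by move=> h; rewrite h ltxx in h2.
  by move=> h; rewrite h ltxx in h1.
rewrite ge0_integral_setU//=; last 3 first.
- exact: (measurable_funTS measurable_ipow).
- by move=> s _; exact: ipow_ge0.
- apply/disj_setPS => s [] /=; rewrite !in_itv/= => /andP[_ h1] /andP[h2 _].
  by move: (lt_trans h1 h2); rewrite ltxx.
have -> : \int[leb]_(s in `[(- l)%R, 0%R[) ipow s = \int[leb]_(s in `]0%R, l]) ipow s.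
  rewrite (@ge0_integral_reflect R 0%R _ ipow)//; last 2 first.
    exact: (measurable_funTS measurable_ipow).
    by move=> s _; exact: ipow_ge0.
  rewrite (_ : _ @^-1` _ = `]0%R, l]%classic); last first.
    by apply/seteqP; split => s /=; rewrite !in_itv/= => /andP[h1 h2]; apply/andP; split; lra.
  by apply: eq_integral => s _; rewrite sub0r ipowN.
by rewrite -mule2n mule_natl.
Qed.

Lemma ipow_shift (t0 l : R) :
  \int[leb]_(t in `[(t0 - l)%R, (t0 + l)%R]) ipow (t - t0)%R =
  \int[leb]_(s in `[(- l)%R, l]) ipow s.
Proof.
rewrite [RHS](@ge0_integral_reflect R t0 _ ipow)//; last 2 first.
  exact: (measurable_funTS measurable_ipow).
  by move=> s _; exact: ipow_ge0.
rewrite (_ : _ @^-1` _ = `[(t0 - l)%R, (t0 + l)%R]%classic); last first.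
  by apply/seteqP; split => s /=; rewrite !in_itv/= => /andP[h1 h2]; apply/andP; split; lra.
by apply: eq_integral => s _; rewrite -ipowN opprB.
Qed.

Lemma measurable_ipow_shift (D : set R) (t0 : R) :
  measurable_fun D (fun t => ipow (t - t0)%R).
Proof.
apply: measurable_funTS; apply: (measurableT_comp measurable_ipow).
exact: measurable_funB.
Qed.

(** The part of the interval within l of t0 is contained in a translate of
    [-l, l]; on the rest the integrand is at most l^-theta. The bound is
    uniform in t0, which is needed because the roots of t^2 - tau vary with
    the line. *)
Lemma ipow_interval_le (al t0 l : R) : (theta < 1)%R -> (0 < l)%R ->
  \int[leb]_(t in `[(al - l)%R, (al + l)%R]) ipow (t - t0)%R <=
  ((2 / (1 - theta) + 2) * l `^ (1 - theta))%:E.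
Proof.
move=> t1 l0.
pose J : set R := `[(al - l)%R, (al + l)%R]%classic.
pose K : set R := `[(t0 - l)%R, (t0 + l)%R]%classic.
rewrite -[X in X <= _]/(\int[leb]_(t in J) ipow (t - t0)%R).
have mJ : measurable J by exact: measurable_itv.
have mK : measurable K by exact: measurable_itv.
have JE : J = (J `&` K) `|` (J `\` K) by rewrite setUIDK.
rewrite JE ge0_integral_setU//; last 5 first.
- exact: measurableI.
- exact: measurableD.
- exact: measurable_ipow_shift.
- by move=> s _; exact: ipow_ge0.
- by apply/disj_setPS => s [[_ h1] [_ h2]].
rewrite mulrDl EFinD; apply: leeD.
  apply: (@le_trans _ _ (\int[leb]_(t in K) ipow (t - t0)%R)).
    apply: ge0_subset_integral => //; first exact: measurableI.
    - exact: measurable_ipow_shift.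
    - by move=> s _; exact: ipow_ge0.
  rewrite -[leLHS]/(\int[leb]_(t in `[(t0 - l)%R, (t0 + l)%R]) ipow (t - t0)%R).
  rewrite [leLHS]ipow_shift [leLHS]ipow_sym// (_ : (2 / (1 - theta) * l `^ (1 - theta))%:E =
    2%:E * (l `^ (1 - theta) / (1 - theta))%:E); last first.
    by rewrite -EFinM; congr EFin; ring.
  by rewrite lee_pmul2l// ipow_half_le.
apply: (@le_trans _ _ (\int[leb]_(t in J `\` K) (l `^ (- theta))%:E)).
  apply: ge0_le_integral => //.
  - exact: measurableD.
  - by move=> s _; exact: ipow_ge0.
  - exact: measurable_ipow_shift.
  - move=> s [_ Ks]; have ls : (l <= `|s - t0|)%R.
      rewrite leNgt; apply/negP => h; apply: Ks; move: h; rewrite ltr_norml /K/= in_itv/=.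
      by move=> /andP[h1 h2]; apply/andP; split; lra.
    have := @le_ipow l (s - t0)%R; rewrite gtr0_norm// => /(_ ls) h.
    by rewrite (le_trans h)// /ipow gt_eqF// gtr0_norm.
rewrite integral_cst//; last exact: measurableD.
apply: (@le_trans _ _ ((l `^ (- theta))%:E * leb J)).
  rewrite lee_wpmul2l// ?lee_fin ?powR_ge0//; apply: le_measure; rewrite ?inE//.
  exact: measurableD.
rewrite /J lebesgue_measure_itv/= lte_fin ifT; last by lra.
rewrite -EFinD -EFinM lee_fin (_ : al + l - (al - l) = 2 * l)%R; last by ring.
rewrite mulrCA ler_wpM2l// mulrC powRD ?powRr1 ?(ltW l0)//.
by rewrite (gt_eqF l0) implybT.
Qed.

End ipow.

(** * Integrals of the singular weight around a sphere *)

Section slices.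
Variables (R : realType) (n : nat).
Local Notation V := 'rV[R]_n.+1.
Local Notation mu := (lebesgue_rV R n.+1).
Local Notation leb := (@lebesgue_measure R).
Local Open Scope ereal_scope.

Let measurable_slice (i : 'I_n.+1) (f : V -> \bar R) :
  measurable_fun setT f -> (forall x, 0 <= f x) ->
  measurable_fun setT (fun y => \int[leb]_t f (insert_rV i (t, y))).
Proof.
move=> mf f0.
apply: (@measurable_fun_fubini_tonelli_G _ _ _ _ _ leb (f \o insert_rV i)).
  exact: (measurableT_comp mf (measurable_insert_rV i)).
by move=> ty; exact: f0.
Qed.

Let slice_ge0 (i : 'I_n.+1) (f : V -> \bar R) : (forall x, 0 <= f x) ->
  forall y, 0 <= \int[leb]_t f (insert_rV i (t, y)).
Proof. by move=> f0 y; apply: integral_ge0. Qed.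

Lemma slice_integral_le (i : 'I_n.+1) (f : V -> \bar R) (Q : set 'rV[R]_n) (M : \bar R) :
  measurable_fun setT f -> (forall x, 0 <= f x) -> measurable Q ->
  (forall y, Q y -> \int[leb]_t f (insert_rV i (t, y)) <= M) ->
  (forall t y, ~ Q y -> f (insert_rV i (t, y)) = 0) ->
  \int[mu]_x f x <= M * lebesgue_rV R n Q.
Proof.
move=> mf f0 mQ fM fQ; rewrite (ge0_integral_rV_insert i)// -integral_cst//.
rewrite [leRHS]integral_mkcond.
have ms := measurable_slice i mf f0.
have E : (fun y => \int[leb]_t f (insert_rV i (t, y))) =
    (fun y => \int[leb]_t f (insert_rV i (t, y))) \_ Q.
  apply/funext => y; rewrite patchE; case: ifPn => // /negP nQ.
  by apply: integral0_eq => t _; apply: fQ => Qy; apply: nQ; rewrite inE.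
rewrite E -!integral_mkcond.
have [Q0|/set0P[y0 Qy0]] := eqVneq Q set0; first by rewrite Q0 !integral_set0.
apply: ge0_le_integral => //.
- by move=> y _; exact: slice_ge0.
- exact: measurable_funTS.
Qed.

Lemma slice_integral_oo (i : 'I_n.+1) (f : V -> \bar R) (Q : set 'rV[R]_n) :
  measurable_fun setT f -> (forall x, 0 <= f x) -> measurable Q ->
  0 < lebesgue_rV R n Q ->
  (forall y, Q y -> \int[leb]_t f (insert_rV i (t, y)) = +oo) ->
  \int[mu]_x f x = +oo.
Proof.
move=> mf f0 mQ Q0 fQ; rewrite (ge0_integral_rV_insert i)//.
apply/eqP; rewrite eq_le leey/=.
have ms := measurable_slice i mf f0.
apply: (@le_trans _ _ (\int[lebesgue_rV R n]_(y in Q) \int[leb]_t f (insert_rV i (t, y)))).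
  rewrite (eq_integral (cst +oo)); last by move=> y; rewrite inE => /fQ.
  by rewrite integral_cst// gt0_mulye.
apply: ge0_subset_integral => //.
by move=> y _; exact: slice_ge0.
Qed.

Definition drop_rV (i : 'I_n.+1) (x : V) : 'rV[R]_n := \row_j x ord0 (lift i j).

Lemma insert_dropK i (x : V) : insert_rV i (x ord0 i, drop_rV i x) = x.
Proof.
apply/rowP => j; have [k ->|->] := unliftP i j.
  by rewrite insert_rV_lift mxE.
by rewrite insert_rV_same.
Qed.

Lemma cube_at_insert i (x : V) r t y : cube_at x r (insert_rV i (t, y)) <->
  (x ord0 i - r <= t <= x ord0 i + r)%R /\ cube_at (drop_rV i x) r y.
Proof.
split=> [H|[H1 H2] j].
  split=> [|j]; first by have := H i; rewrite insert_rV_same.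
  by have := H (lift i j); rewrite insert_rV_lift mxE.
have [k ->|->] := unliftP i j; last by rewrite insert_rV_same.
by have := H2 k; rewrite insert_rV_lift mxE.
Qed.

Lemma dotv_insert i t (y : 'rV[R]_n) :
  dotv (insert_rV i (t, y)) (insert_rV i (t, y)) = (t ^+ 2 + dotv y y)%R.
Proof.
rewrite /dotv (bigD1_ord i)//= insert_rV_same expr2; congr (_ + _)%R.
by apply: eq_bigr => j _; rewrite insert_rV_lift.
Qed.

End slices.

Section sphere.
Variables (R : realType) (n : nat) (theta : R).
Hypothesis theta0 : 0 < theta.
Local Notation V := 'rV[R]_n.+1.
Local Notation mu := (lebesgue_rV R n.+1).
Local Notation leb := (@lebesgue_measure R).
Local Notation ipow := (ipow theta).
Local Open Scope ereal_scope.

(** With tau = s^2 one has t^2 - tau = (t - s) (t + s), and the factor in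
    which the two terms have the same sign is at least |t|; for tau < 0 the
    bound t^2 - tau >= t^2 is the case s = 0. *)
Lemma ipow_square_le (c tau t : R) : (0 < c)%R -> (c <= `|t|)%R ->
  ipow (t ^+ 2 - tau)%R <= (c `^ (- theta))%:E *
    (ipow (t - Num.sqrt tau)%R + ipow (t + Num.sqrt tau)%R).
Proof.
move=> c0 ct; set s := Num.sqrt tau; have s0 : (0 <= s)%R := sqrtr_ge0 tau.
have key (z w : R) : (`|t ^+ 2 - tau| >= `|z| * `|w|)%R -> (c <= `|w|)%R ->
    ipow (t ^+ 2 - tau)%R <= (c `^ (- theta))%:E * ipow z.
  move=> h cw; rewrite -ipowM//; apply: le_ipow => //.
  by rewrite normrM gtr0_norm// (le_trans _ h)// mulrC ler_wpM2l.
have sq : (`|t ^+ 2 - tau| >= `|t - s| * `|t + s|)%R.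
  rewrite -normrM -subr_sqr; have [tau0|tau0] := leP 0%R tau; first by rewrite sqr_sqrtr.
  rewrite /s ler0_sqrtr ?(ltW tau0)// expr0n/= subr0 !ger0_norm ?sqr_ge0//.
    by rewrite lerDl oppr_ge0 ltW.
  by rewrite addr_ge0 ?sqr_ge0// oppr_ge0 ltW.
have cge : 0 <= (c `^ (- theta))%:E by rewrite lee_fin powR_ge0.
have [t0|t0] := leP 0%R t.
  rewrite ger0_norm// in ct.
  have h : (c <= `|t + s|)%R by rewrite ger0_norm ?addr_ge0//; lra.
  have H := key _ _ sq h.
  apply: (le_trans H).
  by rewrite lee_wpmul2l// leeDl// ipow_ge0.
rewrite ltr0_norm// in ct; rewrite mulrC in sq.
have h : (c <= `|t - s|)%R by rewrite ltr0_norm; lra.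
apply: (le_trans (key _ _ sq h)).
by rewrite lee_wpmul2l// leeDr// ipow_ge0.
Qed.

Lemma measurable_dotvv (m : nat) : measurable_fun setT (fun x : 'rV[R]_m => dotv x x).
Proof.
apply: continuous_measurable_rV; first exact: openT.
by move=> x _; exact: differentiable_continuous (differentiable_dotvv x).1.
Qed.

Lemma measurable_ipow_sphere (k : R) : measurable_fun setT (fun x : V => ipow (dotv x x - k)%R).
Proof.
apply: (measurableT_comp (measurable_ipow theta)).
by apply: measurable_funB => //; exact: measurable_dotvv.
Qed.

Definition slab (x0 : V) (r c : R) (i : 'I_n.+1) : set V :=
  cube_at x0 r `&` [set x | (c <= `|x ord0 i|)%R].

Let measurable_slab x0 r c i : measurable (slab x0 r c i).
Proof.
apply: measurableI; first exact: measurable_cube_at.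
rewrite -[X in measurable X]setTI; apply: (@measurable_fun_le _ _ _ setT (cst c)) => //.
by apply: measurableT_comp => //; exact: (measurable_coord_rV i).
Qed.

(** Along the i-th coordinate [ipow_square_le] and [ipow_interval_le] give the
    power r^(1 - theta); the other coordinates range over a cube of side 2 r. *)
Lemma slab_integral_le (x0 : V) (r c k : R) i : (theta < 1)%R -> (0 < r)%R -> (0 < c)%R ->
  \int[mu]_(x in slab x0 r c i) ipow (dotv x x - k)%R <=
  (c `^ (- theta) * (2 * ((2 / (1 - theta) + 2) * r `^ (1 - theta))) * (2 * r) ^+ n)%:E.
Proof.
move=> t1 r0 c0; rewrite integral_mkcond.
have mf := measurable_ipow_sphere k.
have mF : measurable_fun setT ((fun x : V => ipow (dotv x x - k)%R) \_ (slab x0 r c i)).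
  by apply/(measurable_restrictT _ _).1 => //; exact: measurable_funTS.
rewrite EFinM -(lebesgue_cube_at (drop_rV i x0) (ltW r0)).
apply: (slice_integral_le (i := i)).
- exact: mF.
- by move=> x; rewrite patchE; case: ifP => // _; exact: ipow_ge0.
- exact: measurable_cube_at.
- move=> y Qy; pose J : set R := `[(x0 ord0 i - r)%R, (x0 ord0 i + r)%R]%classic.
  have mJ : measurable J by exact: measurable_itv.
  pose s : R := Num.sqrt (k - dotv y y).
  have mp : measurable_fun J (fun t => ipow (t + s)%R).
    rewrite (_ : (fun t => _) = (fun t => ipow (t - - s)%R)); first exact: measurable_ipow_shift.
    by apply/funext => t; rewrite opprK.
  have mm : measurable_fun J (fun t => ipow (t - s)%R) by exact: measurable_ipow_shift.
  apply: (@le_trans _ _ (\int[leb]_(t in J) ((c `^ (- theta))%:E *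
      (ipow (t - s)%R + ipow (t + s)%R)))).
    rewrite [leRHS]integral_mkcond; apply: ge0_le_integral => //.
    + by move=> t _; rewrite patchE; case: ifP => // _; exact: ipow_ge0.
    + exact: (measurableT_comp mF (measurableT_comp (measurable_insert_rV i) (pair2_measurable y))).
    + apply/(measurable_restrictT _ _).1 => //; apply: measurable_funeM; exact: emeasurable_funD.
    + move=> t _; rewrite !patchE; case: ifPn => [|_].
        rewrite inE => -[/cube_at_insert[Jt _] /=]; rewrite insert_rV_same => ct.
        rewrite ifT; last by rewrite inE /J/= in_itv/=.
        rewrite dotv_insert (_ : t ^+ 2 + dotv y y - k = t ^+ 2 - (k - dotv y y))%R; last by ring.
        exact: ipow_square_le.
      case: ifP => // _; rewrite mule_ge0// ?lee_fin ?powR_ge0// adde_ge0//; exact: ipow_ge0.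
  rewrite ge0_integralZl//; last 3 first.
  - exact: emeasurable_funD.
  - by move=> t _; rewrite adde_ge0// ipow_ge0.
  - by rewrite lee_fin powR_ge0.
  rewrite [leRHS]EFinM lee_wpmul2l// ?lee_fin ?powR_ge0//.
  rewrite ge0_integralD//; last 2 first.
  - by move=> t _; exact: ipow_ge0.
  - by move=> t _; exact: ipow_ge0.
  rewrite mulr2n mulrDl mul1r EFinD; apply: leeD.
    exact: ipow_interval_le.
  rewrite [leLHS](_ : _ = \int[leb]_(t in J) ipow (t - - s)%R); last first.
    by apply: eq_integral => t _; rewrite opprK.
  exact: ipow_interval_le.
- move=> t y nQ; rewrite patchE; case: ifPn => //; rewrite inE => -[/cube_at_insert[_ Qy]].
  by case: nQ.
Qed.

Lemma measurable_shell (x0 : V) r c :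
  measurable (cube_at x0 r `&` [set x : V | (c <= enorm x)%R]).
Proof.
apply: measurableI; first exact: measurable_cube_at.
rewrite -[X in measurable X]setTI; apply: (@measurable_fun_le _ _ _ setT (cst c)) => //.
apply: continuous_measurable_rV; first exact: openT.
by move=> x _; exact: continuous_enorm.
Qed.

(** If every coordinate were below c / (2 N), the Euclidean norm would be at
    most c / 2. *)
Lemma shell_slab (x0 : V) r c : (0 < c)%R ->
  cube_at x0 r `&` [set x | (c <= enorm x)%R] `<=`
  \bigcup_(i in [set: 'I_n.+1]) slab x0 r (c / (2 * n.+1%:R))%R i.
Proof.
move=> c0 x [Qx cx]; set c' := (c / _)%R.
have c'0 : (0 <= c')%R by rewrite divr_ge0 ?(ltW c0).
apply: contrapT => H; have : (`|x| <= c')%R.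
  apply: norm_rV_le => // i; rewrite leNgt; apply/negP => h; apply: H; exists i => //.
  by split => //=; exact: ltW.
have := le_trans cx (enorm_le_norm x).
rewrite /c' ler_pdivlMr// mulrCA => h1 h2; lra.
Qed.

(** Away from the origin some coordinate is bounded below, so the slabs cover
    the domain. Neither x0 nor k enters the constant. *)
Lemma sphere_integral_le (x0 : V) (r c k : R) : (theta < 1)%R -> (0 < r)%R -> (0 < c)%R ->
  \int[mu]_(x in cube_at x0 r `&` [set x | (c <= enorm x)%R]) ipow (dotv x x - k)%R <=
  ((\sum_(i < n.+1) (c / (2 * n.+1%:R)) `^ (- theta) *
     (2 * (2 / (1 - theta) + 2)) * 2 ^+ n) * r `^ (n.+1%:R - theta))%:E.
Proof.
move=> t1 r0 c0; have mf := measurable_ipow_sphere k.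
have c'0 : (0 < c / (2 * n.+1%:R))%R by rewrite divr_gt0.
apply: (@le_trans _ _ (\sum_(i < n.+1)
  \int[mu]_(x in slab x0 r (c / (2 * n.+1%:R)) i) ipow (dotv x x - k)%R)).
  rewrite integral_mkcond; under eq_bigr do rewrite integral_mkcond.
  have mF i : measurable_fun setT ((fun x : V => ipow (dotv x x - k)%R) \_
      (slab x0 r (c / (2 * n.+1%:R)) i)%R).
    by apply/(measurable_restrictT _ _).1 => //; exact: measurable_funTS.
  have F0 (A : set V) x : 0 <= ((fun x : V => ipow (dotv x x - k)%R) \_ A) x.
    by rewrite patchE; case: ifP => // _; exact: ipow_ge0.
  rewrite -ge0_integral_sum//.
  apply: ge0_le_integral => //.
  - apply/(measurable_restrictT _ _).1 => //; last exact: measurable_funTS.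
    exact: measurable_shell.
  - by apply: emeasurable_sum => i; exact: mF.
  - move=> x _; rewrite patchE; case: ifPn; last by move=> _; apply: sume_ge0 => i _; exact: F0.
    move=> /set_mem/(shell_slab c0)[i _ Hi]; rewrite (bigD1 i)//=.
    rewrite [X in X + _]patchE ifT; last by rewrite inE.
    by rewrite leeDl// sume_ge0// => j _; exact: F0.
rewrite mulr_suml -sumEFin; apply: lee_sum => i _.
apply: (le_trans (slab_integral_le _ _ _ t1 r0 c'0)).
rewrite lee_fin exprMn (_ : r `^ (n.+1%:R - theta) = r `^ (1 - theta) * r ^+ n)%R; first by lra.
rewrite -powR_mulrn ?(ltW r0)// -powRD; last by rewrite (gt_eqF r0) implybT.
by congr powR; rewrite -natr1; ring.
Qed.

(** Some coordinate of x0 is nonzero, and near x0 the sphere through x0 is the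
    graph of that coordinate as a function of the others. *)
Lemma sphere_graph (x0 : V) (d : R) : x0 != 0%R -> (0 < d)%R ->
  exists (i : 'I_n.+1) (e : R) (g : 'rV[R]_n -> R), (0 < e <= d)%R /\
    forall y, cube_at (drop_rV i x0) e y ->
      (g y ^+ 2 = dotv x0 x0 - dotv y y /\ `|g y - x0 ord0 i| <= d)%R.
Proof.
move=> x00 d0; have [i ai] : exists i, x0 ord0 i != 0%R.
  apply: contrapT => H; move/eqP: x00; apply; apply/rowP => i; rewrite mxE.
  by apply/eqP/negPn/negP => h; apply: H; exists i.
set al := x0 ord0 i; set y0 := drop_rV i x0.
have x0E : (dotv x0 x0 = al ^+ 2 + dotv y0 y0)%R.
  by rewrite -(insert_dropK i x0) dotv_insert.
pose h (y : 'rV[R]_n) : R := Num.sqrt (dotv x0 x0 - dotv y y).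
have hy0 : h y0 = `|al|%R by rewrite /h x0E addrK sqrtr_sqr.
have ch : {for y0, continuous h}.
  have c1 : {for y0, continuous (fun y : 'rV[R]_n => dotv y y)}.
    exact: differentiable_continuous (differentiable_dotvv y0).1.
  have c2 : {for y0, continuous (fun y : 'rV[R]_n => (dotv x0 x0 - dotv y y)%R)}.
    exact: (continuousB (@cst_continuous _ _ (dotv x0 x0) y0) c1).
  by apply: (continuous_comp c2); exact: sqrt_continuous.
have al0 : (0 < `|al|)%R by rewrite normr_gt0.
have m0 : (0 < Num.min d (`|al| / 2))%R by rewrite lt_min d0 divr_gt0.
have : \forall y \near y0, (`|h y0 - h y| <= Num.min d (`|al| / 2))%R.
  by move: (Num.min _ _) m0; exact/(@cvgrPdist_le _ R^o _ (nbhs y0) _ h).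
move=> /nbhs_ballP[e /= e0 He].
have e'0 : (0 < Num.min d (e / 2))%R by rewrite lt_min d0 divr_gt0.
(* h is the absolute value of the i-th coordinate on the sphere; it carries the
   sign of the coordinate of x0 *)
exists i, (Num.min d (e / 2))%R, (fun y => Num.sg al * h y)%R; split.
  by rewrite e'0 ge_min lexx.
move=> y /(cube_atP _ _ (ltW e'0)); rewrite le_min => /andP[_ ye].
have : ball y0 e y.
  by rewrite -ball_normE /ball_/= (le_lt_trans ye)// ltr_pdivrMr// ltr_pMr// ltr1n.
move=> /He; rewrite hy0 le_min => /andP[h1 h2].
have hy : (0 < h y)%R by move: h2; rewrite ler_norml => /andP[_ h2]; lra.
split.
  rewrite exprMn sqr_sg ai mul1r /h sqr_sqrtr//.
  by move: hy; rewrite sqrtr_gt0 => /ltW.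
rewrite -/al [X in (_ - X)%R](numEsg al) -mulrBr normrM normr_sg ai mul1r.
by rewrite distrC.
Qed.

(** On the line through a point y of the base of the graph, the integrand is
    at least a multiple of |t - g y|^-theta near t = g y. *)
Lemma sphere_integral_oo (x0 : V) (d : R) : (1 <= theta)%R -> x0 != 0%R -> (0 < d)%R ->
  \int[mu]_(x in cube_at x0 d) ipow (dotv x x - dotv x0 x0)%R = +oo.
Proof.
move=> t1 x00 d0; set k := dotv x0 x0; have mf := measurable_ipow_sphere k.
have d20 : (0 < d / 2)%R by rewrite divr_gt0.
have [i [e [g [/andP[e0 ed] Hg]]]] := sphere_graph x00 d20.
have mQ := @measurable_cube_at R n.+1 x0 d.
have mF : measurable_fun setT ((fun x : V => ipow (dotv x x - k)%R) \_ (cube_at x0 d)).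
  by apply/(measurable_restrictT _ _).1 => //; exact: measurable_funTS.
rewrite integral_mkcond.
apply: (slice_integral_oo (i := i) (Q := cube_at (drop_rV i x0) e)).
- exact: mF.
- by move=> x; rewrite patchE; case: ifP => // _; exact: ipow_ge0.
- exact: measurable_cube_at.
- by rewrite lebesgue_cube_at ?(ltW e0)// lte_fin exprn_gt0// mulr_gt0.
move=> y Qy; have [gE gx] := Hg y Qy; set al := x0 ord0 i in gx.
pose J : set R := `[(g y - d / 2)%R, (g y + d / 2)%R]%classic.
have mJ : measurable J by exact: measurable_itv.
pose M : R := (2 * (`|al| + d))%R.
have M0 : (0 < M)%R by rewrite mulr_gt0// ltr_wpDl.
apply/eqP; rewrite eq_le leey/=.
apply: (@le_trans _ _ (\int[leb]_(t in J) ((M `^ (- theta))%:E * ipow (t - g y)%R))).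
  rewrite ge0_integralZl//; last 3 first.
  - exact: measurable_ipow_shift.
  - by move=> t _; exact: ipow_ge0.
  - by rewrite lee_fin powR_ge0.
  rewrite /J (_ : \int[leb]_(t in `[(g y - d / 2)%R, (g y + d / 2)%R]) ipow (t - g y)%R = +oo).
    by rewrite gt0_muley// lte_fin powR_gt0.
  by rewrite [LHS]ipow_shift [LHS]ipow_sym// ipow_half_oo// gt0_muley// lte_fin.
rewrite integral_mkcond; apply: ge0_le_integral => //.
- by move=> t _; rewrite patchE; case: ifP => // _; rewrite mule_ge0 ?lee_fin ?powR_ge0 ?ipow_ge0.
- apply/(measurable_restrictT _ _).1 => //; apply: measurable_funeM.
  exact: measurable_ipow_shift.
- exact: (measurableT_comp mF (measurableT_comp (measurable_insert_rV i) (pair2_measurable y))).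
move=> t _; rewrite !patchE; case: ifPn => [|_]; last first.
  by case: ifP => // _; exact: ipow_ge0.
rewrite inE /J/= in_itv/= => /andP[t1' t2'].
move: gx; rewrite ler_norml => /andP[g1 g2].
rewrite ifT; last first.
  rewrite inE; apply/cube_at_insert; split; first by rewrite -/al; apply/andP; split; lra.
  move=> j; have := Qy j; rewrite /= !in_itv/= => /andP[h1 h2].
  by apply/andP; split; lra.
rewrite -ipowM//; apply: le_ipow => //.
rewrite dotv_insert (_ : t ^+ 2 + dotv y y - k = (t - g y) * (t + g y))%R; last first.
  by rewrite -subr_sqr gE; ring.
rewrite (normrM (t - g y)%R) (normrM M) mulrC ler_wpM2r//.
have := ler_norm al; have := ler_norm (- al)%R; rewrite normrN => a1 a2.
rewrite (gtr0_norm M0) /M ler_norml; apply/andP; split; lra.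
Qed.

End sphere.

(** * The sphere as a hypersurface *)

Section sphere_smooth.
Variables (R : realType) (n : nat).
Local Notation V := 'rV[R]_n.

Lemma differentiable_quadric (al c : R) (be x : V) :
  differentiable (fun y : V => al * dotv y y + dotv be y + c) x /\
  grad (fun y : V => al * dotv y y + dotv be y + c) x = (2 * al) *: x + be.
Proof.
apply: (@differentiable_quadratic R n _ x ((2 * al) *: x + be) (`|al| * n%:R)) => h.
rewrite !dotvDr !dotvDl dotvZl (dotvC h x).
rewrite [X in `|X|](_ : _ = al * dotv h h); last by ring.
rewrite normrM -mulrA ler_wpM2l//.
by rewrite (le_trans (dotv_norm_le _ _))// expr2.
Qed.

(** The functions al |y|^2 + be . y + c are stable under partial derivatives. *)
Lemma smooth_quadric (al c : R) (be : V) (s : seq 'I_n) x :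
  differentiable (foldr (@partial R n) (fun y : V => al * dotv y y + dotv be y + c) s) x.
Proof.
suff [al' [be' [c' ->]]] : exists al' (be' : V) c',
    foldr (@partial R n) (fun y : V => al * dotv y y + dotv be y + c) s =
    (fun y : V => al' * dotv y y + dotv be' y + c').
  by have [] := differentiable_quadric al' c' be' x.
elim: s => [|i s [al' [be' [c' IH]]]]; first by exists al, be, c.
exists 0, ((2 * al') *: delta_mx ord0 i), (be' ord0 i).
apply/funext => y; rewrite /= IH.
have := congr1 (fun w : V => w ord0 i) (differentiable_quadric al' c' be' y).2.
rewrite !mxE => ->; rewrite mul0r add0r dotvZl; congr (_ * _ + _).
rewrite /dotv (bigD1 i)//= big1; first by rewrite mxE !eqxx mul1r addr0.
by move=> j ji; rewrite mxE (negbTE ji) andbF mul0r.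
Qed.

(** The sphere is the zero set of |y|^2 - r^2, whose gradient 2 y vanishes at
    the origin only. *)
Lemma smooth_sphere (r : R) : 0 < r -> smooth_hypersurface [set x : V | enorm x = r].
Proof.
move=> r0 x xr; exists [set y : V | 0 < enorm y], (fun y => 1 * dotv y y + dotv 0 y + - r ^+ 2).
have gE (y : V) : 1 * dotv y y + dotv 0 y + - r ^+ 2 = enorm y ^+ 2 - r ^+ 2.
  by rewrite mul1r enorm_sqr [dotv 0 y]big1 ?addr0// => i _; rewrite mxE mul0r.
split.
- split; last by rewrite /= xr.
  rewrite (_ : [set y | _] = @enorm R n @^-1` [set s | 0 < s]).
    by apply: open_comp => [y _|]; [exact: continuous_enorm|exact: open_gt].
  by [].
- by move=> s y _; exact: smooth_quadric.
- apply/seteqP; split => y [y0 /=]; rewrite gE.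
    by move=> ->; rewrite subrr.
  move=> /eqP; rewrite subr_eq0 eqrXn2 ?enorm_ge0 ?(ltW r0)// => /eqP yr.
  by split.
- move=> y; rewrite inE/= => y0; rewrite (differentiable_quadric _ _ _ _).2.
  by rewrite addr0 mulr1 scaler_eq0 pnatr_eq0/= -enorm_gt0.
Qed.

End sphere_smooth.

(** * The gradient near the critical sphere *)

Section mean_flux.
Variables (R : realType) (n : nat).
Local Notation N := (n.+1%:R : R).

(** The quotient of [flux n r s] by r - s, expanded so that it makes sense at
    s = r. *)
Definition mean_flux (r s : R) : R :=
  (\sum_(i < n.+1) r ^+ (n - i) * s ^+ i) / (N * s ^+ n).

Lemma flux_mean r s : flux n r s = (r - s) * mean_flux r s.
Proof. by rewrite /flux subrXX mulrA. Qed.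

Lemma mean_flux_self r : r != 0 -> mean_flux r r = 1.
Proof.
move=> r0; rewrite /mean_flux (eq_bigr (fun=> r ^+ n)); last first.
  by move=> i _; rewrite -exprD subnK// -ltnS.
by rewrite sumr_const card_ord mulr_natl divff// mulrn_eq0 expf_eq0 (negbTE r0) andbF.
Qed.

Lemma continuous_mean_flux r s : s != 0 -> {for s, continuous (mean_flux r)}.
Proof.
move=> s0; have cX k : {for s, continuous (fun s : R => s ^+ k)} by exact: exprn_continuous.
have c1 : {for s, continuous (fun s : R => \sum_(i < n.+1) r ^+ (n - i) * s ^+ i)}.
  apply: continuous_sumR => i.
  exact: (continuousM (@cst_continuous _ _ (r ^+ (n - i)) s) (cX i)).
have c2 : {for s, continuous (fun s : R => N * s ^+ n)}.
  exact: (continuousM (@cst_continuous _ _ N s) (cX n)).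
have c3 : {for s, continuous (fun s : R => (N * s ^+ n)^-1)}.
  by apply: continuousV => //; rewrite mulf_neq0// expf_neq0.
exact: (continuousM c1 c3).
Qed.

(** Each of the N terms of the sum lies between a^n and b^n, and s^n does too. *)
Lemma mean_flux_bounds (a b r s : R) : 0 < a -> a <= r <= b -> a <= s <= b ->
  (a / b) ^+ n <= mean_flux r s <= (b / a) ^+ n.
Proof.
move=> a0 /andP[ar rb] /andP[as_ sb].
have r0 := lt_le_trans a0 ar; have s0 := lt_le_trans a0 as_.
have b0 := lt_le_trans r0 rb.
have le_term (x y z w : R) : 0 < x -> x <= z -> x <= w -> z <= y -> w <= y ->
    \sum_(i < n.+1) x ^+ n <= \sum_(i < n.+1) z ^+ (n - i) * w ^+ i <=
    \sum_(i < n.+1) y ^+ n.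
  move=> x0 xz xw zy wy; have z0 := lt_le_trans x0 xz; have w0 := lt_le_trans x0 xw.
  have y0 := lt_le_trans w0 wy.
  apply/andP; split; apply: ler_sum => i _; have ni : (i <= n)%N by rewrite -ltnS ltn_ord.
    rewrite -[leLHS](_ : x ^+ (n - i) * x ^+ i = _); last by rewrite -exprD subnK.
    by apply: ler_pM; rewrite ?exprn_ge0 ?(ltW x0)// lerXn2r// nnegrE ltW.
  rewrite -[leRHS](_ : y ^+ (n - i) * y ^+ i = _); last by rewrite -exprD subnK.
  by apply: ler_pM; rewrite ?exprn_ge0 ?(ltW z0) ?(ltW w0)// lerXn2r// nnegrE ltW.
have := le_term a b r s a0 ar as_ rb sb; rewrite !sumr_const card_ord.
rewrite -(mulr_natl (a ^+ n)) -(mulr_natl (b ^+ n)) => /andP[h1 h2].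
have e0 x : 0 < x -> 0 < x ^+ n by move=> ?; exact: exprn_gt0.
have D0 : 0 < N * s ^+ n by rewrite mulr_gt0// e0.
rewrite /mean_flux ler_pdivlMr// ler_pdivrMr//.
apply/andP; split.
  apply: le_trans h1; rewrite mulrCA ler_pM2l// expr_div_n mulrAC.
  rewrite ler_pdivrMr ?e0// ler_pM2l ?e0//.
  by rewrite lerXn2r// nnegrE ltW.
apply: (le_trans h2); rewrite mulrCA ler_pM2l// expr_div_n mulrAC.
rewrite ler_pdivlMr ?e0// ler_pM2l ?e0//.
by rewrite lerXn2r// nnegrE ltW.
Qed.

Lemma norm_flux_bounds (a b r s : R) : 0 < a -> a <= r <= b -> a <= s <= b ->
  (a / b) ^+ n * `|s - r| <= `|flux n r s| <= (b / a) ^+ n * `|s - r|.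
Proof.
move=> a0 arb asb; have /andP[h1 h2] := mean_flux_bounds a0 arb asb.
have b0 : 0 < b by case/andP: arb => ar rb; rewrite (lt_le_trans a0)// (le_trans ar).
have h0 : 0 < mean_flux r s by rewrite (lt_le_trans _ h1)// exprn_gt0// divr_gt0.
rewrite flux_mean normrM distrC (gtr0_norm h0) [_ * mean_flux _ _]mulrC.
by apply/andP; split; rewrite ler_wpM2r.
Qed.
End mean_flux.

Section critical.
Variables (R : realType) (n : nat) (p a b r0 : R).
Local Notation V := 'rV[R]_n.+1.
Local Notation Omega := (@annulus R n.+1 a b).
Local Notation mu := (lebesgue_rV R n.+1).
Local Notation theta := ((2 - p) / (p - 1)).
Local Notation q := (p - 1)^-1.
Hypotheses (p12 : 1 < p < 2) (ab : 0 < a < b) (r0ab : a < r0 < b).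
Variable u : V -> R.
Hypothesis uE : forall x, Omega x -> u x = radial_sol p a r0 x.

Let p1 : 0 < p - 1. Proof. by case/andP: p12; rewrite subr_gt0. Qed.
Let q0 : 0 < q. Proof. by rewrite invr_gt0. Qed.
Let a0 : 0 < a. Proof. by case/andP: ab. Qed.
Let r00 : 0 < r0. Proof. by case/andP: r0ab => ar _; exact: lt_trans ar. Qed.
Let b0 : 0 < b. Proof. by case/andP: ab => ? ?; exact: lt_trans a0 _. Qed.
Let th0 : 0 < theta. Proof. exact: theta_gt0. Qed.
Let r0ab' : a <= r0 <= b. Proof. by case/andP: r0ab => /ltW -> /ltW ->. Qed.

Lemma enorm_grad_annulus x : Omega x ->
  enorm (grad u x) = `|flux n r0 (enorm x)| `^ q.
Proof.
move=> Ox; have /andP[/ltW ax _] := Ox.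
rewrite -(enorm_grad_radial r0 p12 ab ax); congr enorm; apply/rowP => i; rewrite !mxE.
apply: near_eq_derive; have nO : nbhs x Omega by apply: open_nbhs_nbhs; split => //; exact: open_annulus.
by apply: filterS nO => y /uE.
Qed.

Let Omega_ab (x : V) : Omega x -> a <= enorm x <= b.
Proof. by move=> /andP[/ltW -> /ltW ->]. Qed.

Let flux0 (x : V) : Omega x -> (flux n r0 (enorm x) == 0) = (enorm x == r0).
Proof.
move=> Ox; have := mean_flux_bounds n a0 r0ab' (Omega_ab Ox).
move=> /andP[h _]; have m0 : mean_flux n r0 (enorm x) != 0.
  by rewrite gt_eqF// (lt_le_trans _ h)// exprn_gt0// divr_gt0.
by rewrite flux_mean mulf_eq0 (negbTE m0) orbF subr_eq0 eq_sym.
Qed.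

Lemma grad_annulus_eq0 x : Omega x -> (grad u x == 0) = (enorm x == r0).
Proof.
move=> Ox; rewrite -enorm_eq0 enorm_grad_annulus// powR_eq0 normr_eq0 flux0//.
by rewrite (gt_eqF q0) andbT.
Qed.

Lemma critical_setE : critical_set Omega u = [set x | enorm x = r0].
Proof.
apply/seteqP; split => x /=; first by move=> [Ox /eqP]; rewrite grad_annulus_eq0// => /eqP.
move=> xr; have Ox : Omega x by rewrite /annulus /= xr.
by split => //; apply/eqP; rewrite grad_annulus_eq0// xr.
Qed.

Lemma weightE x : Omega x -> weight p u x = ipow theta (flux n r0 (enorm x)).
Proof.
move=> Ox; rewrite /weight /ipow grad_annulus_eq0// -flux0//; case: ifP => // _.
rewrite enorm_grad_annulus// -powRrM; congr (_ `^ _)%:E.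
by field; rewrite gt_eqF.
Qed.

Lemma sphere_nonempty (r : R) : 0 <= r -> exists x : V, enorm x = r.
Proof.
move=> r_ge0; exists (r *: delta_mx ord0 ord0).
rewrite enormZ ger0_norm// (_ : enorm _ = 1) ?mulr1// /enorm /dotv (bigD1 ord0)//= big1.
  by rewrite mxE !eqxx mulr1 addr0 sqrtr1.
by move=> i i0; rewrite mxE (negbTE i0) andbF mul0r.
Qed.

(** The quotient is |mean_flux r0 |x||^(1/(p-1)), and [mean_flux] is
    continuous and equal to 1 at r0. *)
Lemma grad_asymptotic (e : R) : 0 < e -> \forall r \near r0^',
  forall x : V, enorm x = r ->
  `|enorm (grad u x) / `|enorm x - r0| `^ q - 1| < e.
Proof.
move=> e0; pose h (s : R) := `|mean_flux n r0 s| `^ q.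
have c1 := @continuous_mean_flux R n r0 r0 (lt0r_neq0 r00).
have ch : {for r0, continuous h}.
  have c2 : {for mean_flux n r0 r0, continuous (fun s : R => `|s| `^ q)} by exact: continuous_norm_powR.
  exact: (continuous_comp c1 c2).
have h1 : h r0 = 1 by rewrite /h mean_flux_self ?lt0r_neq0// normr1 powR1.
have nh : \forall r \near r0, `|h r0 - h r| < e.
  by have /(@cvgrPdist_lt _ R^o _ (nbhs r0) _ h) := ch; exact.
have nab : \forall r \near r0, a < r < b.
  have : nbhs r0 `]a, b[%classic.
    by apply: open_nbhs_nbhs; split; [exact: interval_open|rewrite /= in_itv].
  by apply: filterS => r; rewrite /= in_itv.
rewrite near_withinE; apply: filterS2 nh nab => r hr rab rr0 x xr.
have Ox : Omega x by rewrite /annulus /= xr.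
have dr : `|r - r0| != 0 by rewrite normr_eq0 subr_eq0.
rewrite enorm_grad_annulus// xr flux_mean normrM powRM// (distrC r0 r).
rewrite mulrAC divff ?mul1r; last by rewrite powR_eq0 (negbTE dr).
by move: hr; rewrite h1 (distrC 1).
Qed.

(** Outside the interior of W, the distance | |x| - r0 | has a positive
    minimum over the compact shell a <= |x| <= b. *)
Lemma grad_away (W : set V) : critical_set Omega u `<=` W° ->
  exists2 c : R, 0 < c & forall x, (Omega `\` W) x -> c <= enorm (grad u x).
Proof.
rewrite critical_setE => ZW; pose K := [set x : V | a <= enorm x <= b] `\` W°.
have cK : compact K.
  apply: (subclosed_compact _ (@compact_shell R n.+1 a b)); last by move=> x [].
  by apply: closedI; [exact: closed_shell|apply: open_closedC; exact: open_interior].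
pose f (x : V) := `|enorm x - r0|.
have cf : continuous f.
  move=> x; have c1 := @continuous_enorm R n.+1 x.
  have c2 : {for x, continuous (fun x : V => enorm x - r0)}.
    exact: (continuousB c1 (@cst_continuous _ _ r0 x)).
  exact: (continuous_comp c2 (@norm_continuous _ R^o _)).
have [K0|/set0P[x0 Kx0]] := eqVneq K set0.
  exists 1 => // x [Ox Wx]; suff : K x by rewrite K0.
  by split; [exact: Omega_ab|move=> /interior_subset].
have [x /set_mem Kx xmin] := compact_EVT_min (ex_intro _ x0 Kx0) cK (continuous_subspaceT cf).
have fx0 : 0 < f x.
  rewrite normr_gt0 subr_eq0; apply/eqP => xr; have [_ nW] := Kx.
  by apply: nW; exact: ZW.
(* the value of the lower bound of |Du| at the minimum x of f *)
exists (((a / b) ^+ n * f x) `^ q) => [|y [Oy Wy]].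
  by rewrite powR_gt0// mulr_gt0// exprn_gt0// divr_gt0.
have fxy : f x <= f y.
  by apply: xmin; rewrite inE; split; [exact: Omega_ab|move=> /interior_subset].
rewrite enorm_grad_annulus//; apply: (ge0_ler_powR (ltW q0)); rewrite ?nnegrE//.
  by rewrite mulr_ge0 ?(ltW fx0)// exprn_ge0// divr_ge0// ltW.
have /andP[h _] := norm_flux_bounds n a0 r0ab' (Omega_ab Oy).
by rewrite (le_trans _ h)// ler_wpM2l// exprn_ge0// divr_ge0// ltW.
Qed.

End critical.

(** * The singular weight of the solution *)

Section weight_integrals.
Variables (R : realType) (n : nat) (p a b r0 : R).
Local Notation V := 'rV[R]_n.+1.
Local Notation Omega := (@annulus R n.+1 a b).
Local Notation mu := (lebesgue_rV R n.+1).
Local Notation theta := ((2 - p) / (p - 1)).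
Local Notation N := (n.+1%:R : R).
Hypotheses (p12 : 1 < p < 2) (ab : 0 < a < b) (r0ab : a < r0 < b).
Variable u : V -> R.
Hypothesis uE : forall x, Omega x -> u x = radial_sol p a r0 x.
Local Notation w := (weight p u).

Let a0 : 0 < a. Proof. by case/andP: ab. Qed.
Let r00 : 0 < r0. Proof. by case/andP: r0ab => ar _; exact: lt_trans ar. Qed.
Let b0 : 0 < b. Proof. by case/andP: ab => ? ?; exact: lt_trans a0 _. Qed.
Let th0 : 0 < theta. Proof. exact: theta_gt0. Qed.
Let r0ab' : a <= r0 <= b. Proof. by case/andP: r0ab => /ltW -> /ltW ->. Qed.
Let abn : 0 < (a / b) ^+ n. Proof. by rewrite exprn_gt0// divr_gt0. Qed.
Let ban : 0 < (b / a) ^+ n. Proof. by rewrite exprn_gt0// divr_gt0. Qed.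
Let Omega_ab (x : V) : Omega x -> a <= enorm x <= b.
Proof. by move=> /andP[/ltW -> /ltW ->]. Qed.
Let mOmega : measurable Omega.
Proof. by apply: open_measurable_rV; exact: open_annulus. Qed.

Let sphereE (x : V) : `|dotv x x - r0 ^+ 2| = `|enorm x - r0| * (enorm x + r0).
Proof.
by rewrite -enorm_sqr subr_sqr normrM [X in _ * X]ger0_norm// addr_ge0 ?enorm_ge0// ltW.
Qed.

Local Open Scope ereal_scope.

Lemma weight_ge0 x : 0 <= w x.
Proof. by rewrite /weight; case: ifP => // _; rewrite lee_fin powR_ge0. Qed.

(** On the annulus both |flux| and | |x|^2 - r0^2 | are comparable to | |x| -
    r0 |. The polynomial is preferred because its restrictions to coordinate
    lines are explicit. *)
Lemma weight_le_sphere x : Omega x ->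
  w x <= (((a / b) ^+ n / (2 * b)) `^ (- theta))%:E * ipow theta (dotv x x - r0 ^+ 2)%R.
Proof.
move=> Ox; rewrite (weightE p12 ab r0ab uE Ox) -ipowM; last by rewrite divr_gt0// mulr_gt0.
apply: le_ipow => //; have /andP[h _] := norm_flux_bounds n a0 r0ab' (Omega_ab Ox).
apply: (le_trans _ h); rewrite normrM sphereE ger0_norm; last first.
  by rewrite divr_ge0 ?(ltW abn)// mulr_ge0// ltW.
rewrite -mulrA ler_wpM2l ?(ltW abn)// mulrC ler_pdivrMr ?mulr_gt0//.
rewrite ler_wpM2l//; have /andP[_ xb] := Omega_ab Ox; have /andP[_ rb] := r0ab'; lra.
Qed.

Lemma weight_ge_sphere x : Omega x ->
  (((b / a) ^+ n / (2 * a)) `^ (- theta))%:E * ipow theta (dotv x x - r0 ^+ 2)%R <= w x.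
Proof.
move=> Ox; rewrite (weightE p12 ab r0ab uE Ox) -ipowM; last by rewrite divr_gt0// mulr_gt0.
apply: le_ipow => //; have /andP[_ h] := norm_flux_bounds n a0 r0ab' (Omega_ab Ox).
apply: (le_trans h); rewrite normrM sphereE ger0_norm; last first.
  by rewrite divr_ge0 ?(ltW ban)// mulr_ge0// ltW.
rewrite -mulrA ler_wpM2l ?(ltW ban)// mulrC ler_pdivlMr ?mulr_gt0//.
rewrite ler_wpM2l//; have /andP[xa _] := Omega_ab Ox; have /andP[ra _] := r0ab'; lra.
Qed.

Lemma weight_ge_dist x (r : R) : Omega x -> (0 < r)%R -> (`|enorm x - r0| <= r)%R ->
  (((b / a) ^+ n * r) `^ (- theta))%:E <= w x.
Proof.
move=> Ox r1 xr; have k0 : (0 < (b / a) ^+ n * r)%R by rewrite mulr_gt0.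
rewrite (_ : _%:E = ipow theta ((b / a) ^+ n * r)%R); last first.
  by rewrite /ipow gt_eqF// gtr0_norm.
rewrite (weightE p12 ab r0ab uE Ox); apply: le_ipow => //.
have /andP[_ h] := norm_flux_bounds n a0 r0ab' (Omega_ab Ox).
by rewrite (le_trans h)// (gtr0_norm k0) ler_wpM2l// ltW.
Qed.

Lemma measurable_weight : measurable_fun Omega w.
Proof.
apply: (eq_measurable_fun (ipow theta \o (fun x : V => flux n r0 (enorm x)))).
  by move=> x /set_mem Ox; rewrite (weightE p12 ab r0ab uE Ox).
apply: (measurableT_comp (measurable_ipow theta)).
apply: continuous_measurable_rV; first exact: open_annulus.
move=> x /set_mem/Omega_ab/andP[ax _].
have c1 := @continuous_enorm R n.+1 x.
have c2 : {for enorm x, continuous (flux n r0)}.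
  by apply: continuous_flux; exact: lt_le_trans a0 ax.
exact: (continuous_comp c1 c2).
Qed.

Let K := (((a / b) ^+ n / (2 * b)) `^ (- theta))%R.
Let K0 : (0 < K)%R. Proof. by rewrite powR_gt0// divr_gt0// mulr_gt0. Qed.

Let msph : measurable_fun setT (fun x : V => ipow theta (dotv x x - r0 ^+ 2)%R).
Proof. exact: measurable_ipow_sphere. Qed.

Lemma weight_integral_le : (theta < 1)%R -> exists2 C : R, (0 < C)%R &
  forall (A : set V) x0 r, measurable A -> (0 < r)%R -> A `<=` Omega ->
    A `<=` cube_at x0 r -> \int[mu]_(x in A) w x <= (C * r `^ (N - theta))%:E.
Proof.
move=> t1.
pose C1 : R := (\sum_(i < n.+1) (a / (2 * n.+1%:R)) `^ (- theta) *
     (2 * (2 / (1 - theta) + 2)) * 2 ^+ n)%R.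
have C10 : (0 < C1)%R.
  rewrite /C1 big_ord_recl ltr_pwDl ?sumr_ge0//.
    rewrite !mulr_gt0 ?powR_gt0 ?divr_gt0 ?exprn_gt0 ?mulr_gt0//.
    by rewrite ltr_wpDl// divr_ge0// subr_ge0 ltW.
  move=> i _; rewrite !mulr_ge0 ?powR_ge0//.
  by rewrite addr_ge0// divr_ge0// subr_ge0 ltW.
exists (K * C1)%R; first by rewrite mulr_gt0.
move=> A x0 r mA r1 AO Ax.
apply: (@le_trans _ _ (\int[mu]_(x in A) (K%:E * ipow theta (dotv x x - r0 ^+ 2)%R))).
  apply: ge0_le_integral => //.
  - by move=> x _; exact: weight_ge0.
  - exact: measurable_funS measurable_weight.
  - by apply: measurable_funeM; exact: measurable_funTS.
  - by move=> x /AO; exact: weight_le_sphere.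
rewrite ge0_integralZl//; last 3 first.
- exact: measurable_funTS.
- by move=> x _; exact: ipow_ge0.
- by rewrite lee_fin ltW.
rewrite -mulrA EFinM lee_wpmul2l ?lee_fin ?(ltW K0)//.
apply: le_trans (sphere_integral_le th0 x0 (r0 ^+ 2) t1 r1 a0).
apply: ge0_subset_integral => //; first exact: measurable_shell.
- exact: measurable_funTS.
- by move=> x _; exact: ipow_ge0.
- by move=> x Hx; split; [exact: Ax|have /AO/Omega_ab/andP[] := Hx].
Qed.

Lemma measurable_eball (x0 : V) r : measurable (eball x0 r).
Proof.
apply: open_measurable_rV; rewrite (_ : eball x0 r = (fun y => enorm (y - x0)) @^-1` [set s | (s < r)%R]).
  apply: open_comp => [y _|]; last exact: open_lt.
  have c1 : {for y, continuous (fun y : V => (y - x0)%R)}.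
    exact: (continuousB (@cvg_id _ (nbhs y)) (@cst_continuous _ _ x0 y)).
  exact: (continuous_comp c1 (@continuous_enorm R n.+1 (y - x0)%R)).
by [].
Qed.

Let cube_eball (x0 : V) r d : (0 < d)%R -> (N * d < r)%R -> cube_at x0 d `<=` eball x0 r.
Proof.
move=> d0 dr y /(cube_atP _ _ (ltW d0)) yd; rewrite /eball /= (le_lt_trans _ dr)//.
by rewrite (le_trans (enorm_le_norm _))// distrC ler_wpM2l.
Qed.

Let half_lt (r : R) : (0 < r)%R -> (N * (r / (2 * N)) < r)%R.
Proof.
move=> r1; rewrite (_ : N * (r / (2 * N)) = r / 2)%R; first by lra.
by field; rewrite addrC natr1 pnatr_eq0.
Qed.

(** A ball of radius r centred on the sphere lies within r of it, so the
    weight is at least a multiple of r^-theta there; and the ball contains a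
    cube of side r / N. *)
Lemma weight_integral_ge : exists2 c : R, (0 < c)%R &
  forall (x0 : V) r, enorm x0 = r0 -> (0 < r)%R -> eball x0 r `<=` Omega ->
    (c * r `^ (N - theta))%:E <= \int[mu]_(x in eball x0 r) w x.
Proof.
exists (((b / a) ^+ n) `^ (- theta) * (N^-1) ^+ n.+1)%R.
  by apply: mulr_gt0; [exact: powR_gt0|rewrite exprn_gt0// invr_gt0].
move=> x0 r x0r r1 BO; pose d := (r / (2 * N))%R.
have d0 : (0 < d)%R by rewrite divr_gt0.
have cB : cube_at x0 d `<=` eball x0 r.
  by apply: cube_eball => //; exact: half_lt.
have md := @measurable_cube_at R n.+1 x0 d.
apply: (@le_trans _ _ (\int[mu]_(x in cube_at x0 d) (((b / a) ^+ n * r) `^ (- theta))%:E)).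
  rewrite integral_cst// [X in _ * X](lebesgue_cube_at x0 (ltW d0)) -EFinM lee_fin.
  rewrite powRM ?(ltW ban) ?(ltW r1)//.
  rewrite powRD ?(gt_eqF r1) ?implybT// powR_mulrn ?(ltW r1)//.
  rewrite (_ : 2 * d = N^-1 * r)%R; first by rewrite (exprMn n.+1 N^-1%R r) le_eqVlt; apply/orP; left; apply/eqP; ring.
  by rewrite /d; field; rewrite addrC natr1 pnatr_eq0.
apply: (@le_trans _ _ (\int[mu]_(x in cube_at x0 d) w x)).
  apply: ge0_le_integral => //.
  - by move=> x _; rewrite lee_fin powR_ge0.
  - by apply: measurable_funS measurable_weight => // x /cB/BO.
  - move=> x /cB Bx; apply: weight_ge_dist => //; first exact: BO.
    by rewrite -x0r (le_trans (enormB_ge _ _))// ltW.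
apply: ge0_subset_integral => //; first exact: measurable_eball.
- exact: measurable_funS measurable_weight.
- by move=> x _; exact: weight_ge0.
Qed.

(** A small cube around x0 lies in the ball and in the annulus. *)
Lemma weight_integral_oo (x0 : V) r : (1 <= theta)%R -> enorm x0 = r0 -> (0 < r)%R ->
  \int[mu]_(x in eball x0 r `&` Omega) w x = +oo.
Proof.
move=> t1 x0r r1; pose m : R := Num.min r (Num.min (r0 - a) (b - r0))%R.
have m0 : (0 < m)%R by rewrite !lt_min r1 !subr_gt0.
pose d := (m / (2 * N))%R.
have d0 : (0 < d)%R by rewrite divr_gt0.
have dm : (N * d < m)%R by exact: half_lt.
have cB : cube_at x0 d `<=` eball x0 r `&` Omega.
  move=> y /(cube_eball d0 dm); rewrite /eball /= !lt_min => /andP[h1 /andP[h2 h3]].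
  split => //; rewrite /annulus /=; have := enormB_ge y x0; rewrite x0r ler_norml => /andP[h4 h5].
  by apply/andP; split; lra.
have md := @measurable_cube_at R n.+1 x0 d.
have mB : measurable (eball x0 r `&` Omega).
  by apply: measurableI => //; exact: measurable_eball.
apply/eqP; rewrite eq_le leey/=.
have mw A : A `<=` Omega -> measurable_fun A w.
  by move=> AO; exact: measurable_funS measurable_weight.
apply: (@le_trans _ _ (\int[mu]_(x in cube_at x0 d) w x)); last first.
  apply: ge0_subset_integral => //.
  - by apply: mw => x [].
  - by move=> x _; exact: weight_ge0.
apply: (@le_trans _ _ (\int[mu]_(x in cube_at x0 d)
    ((((b / a) ^+ n / (2 * a)) `^ (- theta))%:E * ipow theta (dotv x x - r0 ^+ 2)%R))).
  rewrite ge0_integralZl//; last 3 first.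
  - exact: measurable_funTS.
  - by move=> x _; exact: ipow_ge0.
  - by rewrite lee_fin powR_ge0.
  rewrite -x0r enorm_sqr sphere_integral_oo//; last by rewrite -enorm_gt0 x0r.
  by rewrite gt0_muley// lte_fin powR_gt0// divr_gt0// mulr_gt0.
apply: ge0_le_integral => //.
- by move=> x _; rewrite mule_ge0 ?lee_fin ?powR_ge0 ?ipow_ge0.
- by apply: measurable_funeM; exact: measurable_funTS.
- by apply: mw => x /cB[].
- by move=> x /cB[_]; exact: weight_ge_sphere.
Qed.

Lemma integrable_weight : mu.-integrable Omega w <-> (theta < 1)%R.
Proof.
have absw : \int[mu]_(x in Omega) `|w x| = \int[mu]_(x in Omega) w x.
  by apply: eq_integral => x _; rewrite gee0_abs// weight_ge0.
split=> [/integrableP[_]|t1].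
  rewrite ltNge => H; rewrite ltNge; apply/negP => t1; move/negP : H; apply.
  have [x0 x0r] := @sphere_nonempty R n r0 (ltW r00).
  rewrite -(weight_integral_oo t1 x0r ltr01); rewrite absw.
  apply: ge0_subset_integral => //.
  - by apply: measurableI => //; exact: measurable_eball.
  - exact: measurable_weight.
  - by move=> x _; exact: weight_ge0.
apply/integrableP; split; first exact: measurable_weight.
have [C _ HC] := weight_integral_le t1.
rewrite absw.
apply: (le_lt_trans (HC Omega 0%R b mOmega b0 _ _)) => //; last exact: ltry.
move=> x /Omega_ab/andP[_ xb]; apply/cube_atP; first exact: ltW.
by rewrite sub0r normrN (le_trans (norm_le_enorm _)).
Qed.

End weight_integrals.

(** * The torsion function of the annulus *)

Theorem proposition10 (R : realType) (N : nat) (p a b : R)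
    (u : 'rV[R]_N -> R) :
  let Omega := @annulus R N a b in
  let Zu := critical_set Omega u in
  let mu := lebesgue_rV R N in
  let rho := weight p u in
  let theta := (2 - p) / (p - 1) in
  (2 <= N)%N -> 1 < p < 2 -> 0 < a < b ->
  C1_closure Omega u -> weak_solution p Omega u ->
  (forall x, (closure Omega `\` Omega) x -> u x = 0) ->
  [/\ [/\ forall x, Omega x -> 0 < u x,
          radial_on Omega u,
          exists! r0 : R,
            [/\ a < r0 < b,
                Zu = [set x | enorm x = r0]
              & forall e : R, 0 < e -> \forall r \near r0^',
                  forall x : 'rV[R]_N, enorm x = r ->
                  `|enorm (grad u x) / `|enorm x - r0| `^ (p - 1)^-1 - 1| < e],
          forall V : set 'rV[R]_N, Zu `<=` V° ->
            exists2 c : R, 0 < c &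
              forall x, (Omega `\` V) x -> c <= enorm (grad u x)
        & smooth_hypersurface Zu],
      mu.-integrable Omega rho <-> 3 / 2 < p,
      3 / 2 < p -> forall x0, Zu x0 ->
        comparable_on [set r : R | 0 < r /\ eball x0 r `<=` Omega]
          (fun r => \int[mu]_(x in eball x0 r) rho x)%E
          (fun r => r `^ (N%:R - theta))
    & p <= 3 / 2 -> forall x0, Zu x0 -> forall r : R, 0 < r ->
        (\int[mu]_(x in eball x0 r `&` Omega) rho x = +oo)%E].
Proof.
case: N u => [//|n] u Omega Zu mu rho theta _ p12 ab C1u weak_u u0.
have th0 : 0 < theta by exact: theta_gt0.
have a0 : 0 < a by case/andP: ab.
have [r0 r0ab r0E] := exists_crit n th0 ab.
have uE x : Omega x -> u x = radial_sol p a r0 x.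
  exact: (unique_radial p12 ab r0ab r0E C1u weak_u u0).
have ZE : Zu = [set x | enorm x = r0] := critical_setE p12 ab r0ab uE.
have th1 : (theta < 1) = (3 / 2 < p).
  have /andP[p1 p2] := p12; rewrite /theta ltr_pdivrMr ?subr_gt0//.
  by apply/idP/idP => ?; lra.
have r00 : 0 < r0 by case/andP: r0ab => ar _; exact: lt_trans ar.
split.
- split.
  + by move=> x Ox; rewrite uE//; exact: (profile_gt0 th0 ab r0ab r0E Ox).
  + by exists (profile n theta a r0) => x /set_mem /uE.
  + exists r0; split.
      by split => // e e0; exact: (grad_asymptotic p12 ab r0ab uE e0).
    move=> r1 [_ Zr1 _]; have [x xr] := @sphere_nonempty R n r0 (ltW r00).
    have : Zu x by rewrite ZE.
    by rewrite Zr1 /= xr.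
  + exact: (grad_away p12 ab r0ab uE).
  + by rewrite ZE; exact: smooth_sphere.
- by rewrite -th1; exact: (integrable_weight p12 ab r0ab uE).
- rewrite -th1 => t1 x0; rewrite ZE /= => x0r.
  have [C C0 HC] := weight_integral_le p12 ab r0ab uE t1.
  have [c c0 Hc] := weight_integral_ge p12 ab r0ab uE.
  exists c, C; split => // r [r1 BO]; apply/andP; split; first exact: Hc.
  apply: HC => //; first exact: measurable_eball.
  move=> y yr; apply/cube_atP; first exact: ltW.
  rewrite distrC; apply: (le_trans (norm_le_enorm _)); exact: (ltW yr).
- move=> p32 x0; rewrite ZE /= => x0r r r1.
  apply: (weight_integral_oo p12 ab r0ab uE) => //.
  by rewrite leNgt th1 -leNgt.
Qed.
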